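(* Consider the Poissonized Karlin occupancy scheme with probabilities $(p_k)_{k\in\mathbb N}$, counting function $\rho$ and variables $K_j(t)$ as in the context. Assume that, for some $\alpha\in(0,1)$ and some $L$ slowly varying at $+\infty$, $\rho(t)\sim t^\alpha L(t)$ as $t\to\infty$. Then, for each $j\in\mathbb N$, $$\limsup_{t\to\infty}\frac{K_j(t)-\mathbb E K_j(t)}{(\operatorname{Var}K_j(t)\log\log\operatorname{Var}K_j(t))^{1/2}}=2^{1/2}\quad\text{almost surely},$$ and, as $t\to\infty$, $$\mathbb E K_j(t)\sim\frac{\Gamma(j-\alpha)}{(j-1)!}t^\alpha L(t)\quad\text{and}\quad\operatorname{Var}K_j(t)\sim c_jt^\alpha L(t),$$ where $\Gamma$ is the Euler gamma function and $$c_j:=\frac1{(j-1)!}\Big(\frac1{2^{j-1-\alpha}}\sum_{i=0}^{j-1}\frac{\Gamma(i+j-\alpha)}{i!\,2^i}-\Gamma(j-\alpha)\Big)>0.$$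
   Context: Let $(p_k)_{k\in\mathbb N}$ be a discrete probability distribution with $p_k>0$ for infinitely many $k$. Balls are allocated independently over boxes $1,2,\dots$, each ball hitting box $k$ with probability $p_k$. In the Poissonized version of Karlin's occupancy scheme the $n$th ball is thrown at time $S_n$, where $(S_n)_{n\in\mathbb N}$ is a random walk with independent exponential(1) increments, independent of the box indices; thus the number of balls thrown up to time $t$ is a unit-rate Poisson process. $K_j(t)$ denotes the number of boxes containing at least $j$ balls at time $t\ge0$. Equivalently, $K_j(t)=\sum_{k\ge1}\mathbf 1_{\{\pi_k(t)\ge j\}}$, where $\pi_k(t)$ is the number of balls in box $k$ at time $t$; the processes $(\pi_k(t))_{t\ge0}$, $k\in\mathbb N$, are independent Poisson processes with intensities $p_k$. The counting function is $\rho(t):=\#\{k\in\mathbb N:1/p_k\le t\}$, $t>0$. A positive measurable function $L$ on a neighborhood of $\infty$ is slowly varying at $\infty$ if $L(\lambda t)/L(t)\to1$ as $t\to\infty$ for all $\lambda>0$. $x(t)\sim y(t)$ means $x(t)/y(t)\to1$. *)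

(* Defs.v *)
From HB Require Import structures.
From mathcomp Require Import all_boot all_order all_algebra finmap.
From mathcomp Require Import all_classical all_reals all_analysis.

Set Implicit Arguments.
Unset Strict Implicit.
Unset Printing Implicit Defensive.

Import Order.TTheory GRing.Theory Num.Theory.
Import numFieldNormedType.Exports.

Local Open Scope classical_set_scope.
Local Open Scope ring_scope.

Definition asymp_equiv (R : realType) (x y : R -> R) : Prop :=
  x t / y t @[t --> +oo] --> (1 : R).

Definition slowly_varying (R : realType) (L : R -> R) : Prop :=
  (exists a : R,
     (forall t, a < t -> 0 < L t) /\ measurable_fun `]a, +oo[%classic L) /\
  (forall l : R, 0 < l -> L (l * t) / L t @[t --> +oo] --> (1 : R)).

Definition Gamma (R : realType) (x : R) : R :=
  \int[lebesgue_measure]_(t in `]0, +oo[) (t `^ (x - 1) * expR (- t)).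

(* The boxes 1, 2, ... and the balls 1, 2, ... are numbered from 0. *)

Definition discrete_distribution (R : realType) (p : nat -> R) : Prop :=
  (forall k, 0 <= p k) /\ (\sum_(0 <= k <oo) (p k)%:E = 1)%E.

(* The conjunct [0 < p k] matches 1 / p_k = +oo for p_k = 0, whereas 0^-1 = 0
   in a field. For [t : R] the set is finite, so that [fine] is harmless. *)
Definition rho (R : realType) (p : nat -> R) (t : R) : R :=
  fine (counting [set k | 0 < p k /\ (p k)^-1 <= t]).

Definition mutual_independence d (T : measurableType d) (R : realType)
    (P : probability T R) (I : choiceType) (F : I -> set (set T)) : Prop :=
  forall (J : {fset I}) (A : I -> set T), (forall i, i \in J -> F i (A i)) ->
    P (\bigcap_(i in [set` J]) A i) = (\prod_(i <- J) P (A i))%E.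

Definition sigma_of d d' (T : measurableType d) (T' : measurableType d')
    (f : T -> T') : set (set T) :=
  preimage_set_system setT f measurable.

(* [X n] is the box hit by the ball [n], and [E n] is the time between the
   throws of the balls [n.-1] and [n] (the time of the first throw if n = 0). *)
Record poissonized_karlin d (T : measurableType d) (R : realType)
    (P : probability T R) (p : nat -> R)
    (X : nat -> {RV P >-> nat}) (E : nat -> {RV P >-> R}) : Prop := {
  box_law : forall n k, P (X n @^-1` [set k]) = (p k)%:E ;
  increment_law : forall n (A : set R), measurable A ->
    P (E n @^-1` A) = exponential_prob 1 A ;
  scheme_independence : mutual_independence P (fun i : nat + nat =>
    match i with inl n => sigma_of (X n) | inr n => sigma_of (E n) end)
}.

Section occupancy.
Context d (T : measurableType d) (R : realType).
Variables (X : nat -> T -> nat) (E : nat -> T -> R).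

Definition throw_time (n : nat) (w : T) : R := \sum_(i < n.+1) E i w.

Definition box_content (k : nat) (t : R) (w : T) : \bar R :=
  counting [set n | X n w = k /\ throw_time n w <= t].

(* The number of boxes is infinite only on the null event that infinitely many
   balls are thrown by time [t]; [fine] gives it the value 0 there. *)
Definition occupancy (j : nat) (t : R) (w : T) : R :=
  fine (counting [set k | (j%:R%:E <= box_content k t w)%E]).

End occupancy.

Definition var_coef (R : realType) (alpha : R) (j : nat) : R :=
  (j.-1)`!%:R^-1 *
  ((2 `^ (j%:R - 1 - alpha))^-1 *
     (\sum_(i < j) Gamma (i%:R + j%:R - alpha) / (i`!%:R * 2 ^+ i))
   - Gamma (j%:R - alpha)).

(* Main.v *)
Require Import Defs.
From HB Require Import structures.
From mathcomp Require Import all_boot all_order all_algebra finmap.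
From mathcomp Require Import all_classical all_reals all_analysis.
From mathcomp Require Import measurable_realfun ring lra.

Set Implicit Arguments.
Unset Strict Implicit.
Unset Printing Implicit Defensive.

Import Order.TTheory GRing.Theory Num.Theory.
Import numFieldNormedType.Exports.

Local Open Scope classical_set_scope.
Local Open Scope ring_scope.

(** Throwing the balls at the times of a Poisson process makes the boxes
    independent. Here this is derived from the random walk itself: give a weight
    [z c] to each ball that falls in the cell [c] (a box and an interval of
    times). The product of the weights of the first balls, times the exponential
    of minus the intensity that the cells still have in store, has a constant mean
    ([integral_marks]); letting the number of balls go to infinity yields the
    joint generating function of the numbers of balls in disjoint cells
    ([mean_prod_expr_ball_count]), hence the independence, over the boxes, of the
    events that a box gets its [j]th ball in a given interval
    ([mean_prod_crosses]). Their probabilities are differences of the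
    distribution function [poisson_tail j], so that the occupancy and its
    increments are sums of independent indicators.

    The mean and the variance of the occupancy are then series over the boxes of
    a function of [p k * t], which are integrals of the derivative of this function
    against [y |-> rho p (t / y)] ([series_integral_rho]). By regular variation and
    dominated convergence under Potter's bound, division by [rho p t] leaves the
    integral of the derivative against [y `^ (- alpha)]
    ([integral_rho_asymptotics]), a combination of gamma integrals. The boxes with
    [1 <= p k * t < 2] alone contribute a positive multiple of [rho p t] to the
    variance, whence the positivity of its constant ([var_coef_gt0]).

    Upper half of the law of the iterated logarithm ([lil_upper]). The mean [a]
    of the occupancy is a clock in which the increments have exponential moments
    that grow with the elapsed time. The clock is cut into blocks with ends in a
    geometric progression of ratio close to 1. The Chernoff bound with the exact
    asymptotic variance handles the left end of a block, and dyadic chaining,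
    where constants are allowed to be lost, the oscillation within the block;
    since the occupancy increases, finitely many dyadic levels are enough. The
    exceptional probabilities are summable, and the first Borel-Cantelli lemma
    applies.

    Lower half ([lil_lower]). At time [t], nearly all the variance comes from the
    boxes with [1 / B <= p k * t < B], when [B] is large ([window_remainder]).
    Along the times [B ^+ (2 * i)] these windows are disjoint, so that their
    contributions to the occupancy are independent. Kolmogorov's lower
    exponential bound ([kolmogorov_lower]) makes the probabilities of their large
    deviations have a divergent sum, the second Borel-Cantelli lemma
    ([windows_infinitely_often]) produces infinitely many of them, and the boxes
    outside the window vary too little to compensate. *)

(** * Exponential expansions *)

Section exponential_expansion.
Context (R : realType).
Implicit Types x y h : R.

Lemma expR_series_le x n : 0 <= x -> series (exp_coeff x) n <= expR x.
Proof.
move=> x0; rewrite /expR; apply: nondecreasing_cvgn_le; last exact: is_cvg_series_exp_coeff.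
apply/nondecreasing_seqP => k; rewrite seriesSr lerDl.
exact: exp_coeff_ge0.
Qed.

(** The remainder of the exponential series, term by term: [n! i!] divides
    [(n + i)!]. *)
Lemma expR_taylor n x :
  `|expR x - \sum_(i < n) x ^+ i / i`!%:R| <= `|x| ^+ n / n`!%:R * expR `|x|.
Proof.
pose s : R^nat := series (exp_coeff x).
have cs : s @ \oo --> expR x by exact: is_cvg_series_exp_coeff.
have h : (fun N => `|s N - \sum_(i < n) x ^+ i / i`!%:R|) @ \oo -->
    `|expR x - \sum_(i < n) x ^+ i / i`!%:R|.
  by apply: cvg_norm; apply: cvgB => //; exact: cvg_cst.
rewrite -(cvg_lim (@Rhausdorff R) h); apply: limr_le; first by apply/cvg_ex; eexists; exact: h.
exists n => // N /= nN.
have -> : s N - \sum_(i < n) x ^+ i / i`!%:R =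
    \sum_(i < N - n) x ^+ (n + i) / (n + i)`!%:R.
  rewrite /s /series/= -(big_mkord predT (fun i => x ^+ i / i`!%:R)).
  rewrite (big_cat_nat (leq0n n) nN)/= /exp_coeff/= addrAC subrr add0r.
  by rewrite -{1}[n]add0n big_addn big_mkord; apply: eq_bigr => i _; rewrite addnC.
apply: (le_trans (ler_norm_sum _ _ _)).
apply: (@le_trans _ _ (`|x| ^+ n / n`!%:R * series (exp_coeff `|x|) (N - n)%N)).
  rewrite /series/= big_mkord mulr_sumr; apply: ler_sum => i _.
  rewrite normrM normrX normfV [ `|(_`!)%:R| ]ger0_norm// exprD /exp_coeff/=.
  rewrite mulrACA -invfM ler_wpM2l ?mulr_ge0 ?exprn_ge0//.
  rewrite lef_pV2 ?posrE -?natrM ?ltr0n ?muln_gt0 ?fact_gt0// ler_nat.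
  have := bin_fact (leq_addr i n); rewrite addKn => <-.
  by rewrite leq_pmull// bin_gt0 leq_addr.
by rewrite ler_wpM2l ?divr_ge0 ?exprn_ge0// expR_series_le.
Qed.

Lemma expR1_le3 : expR (1 : R) <= 3.
Proof.
have := expR_taylor 3 (1 / 4 : R).
rewrite [ `|1 / 4| ]ger0_norm//.
have -> : \sum_(i < 3) (1 / 4 : R) ^+ i / i`!%:R = 1 + 1 / 4 + 1 / 32.
  by rewrite !big_ord_recl big_ord0 /= /bump /= !factS fact0 expr0 expr1; field.
have -> : (1 / 4 : R) ^+ 3 / 3`!%:R = 1 / 384 by rewrite !factS fact0; field.
move=> h; set y := expR (1 / 4) in h.
have y1310 : y <= 13 / 10 by move: h; rewrite ler_norml => /andP[_ h]; lra.
have y0 : 0 <= y by exact: expR_ge0.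
have -> : expR (1 : R) = y ^+ 4.
  by rewrite /y -expRM_natl; congr expR; lra.
apply: (@le_trans _ _ ((13 / 10) ^+ 4)); last by lra.
by rewrite lerXn2r ?nnegrE.
Qed.

(** The constant comes from [expR 1 <= 3] in the remainder of order 3. *)
Lemma expR_second_order x : `|x| <= 1 ->
  `|expR x - (1 + x + x ^+ 2 / 2)| <= `|x| ^+ 3 / 2.
Proof.
move=> x1; have := expR_taylor 3 x.
rewrite !big_ord_recl big_ord0 /= /bump /= !factS fact0.
have -> : x ^+ 0 / 1%:R + (x ^+ (1 + 0) / (1 * 1)%:R + (x ^+ (1 + (1 + 0)) / (2 * (1 * 1))%:R + 0)) =
  1 + x + x ^+ 2 / 2 by rewrite expr0 expr1; field.
move=> /le_trans; apply; rewrite -mulrA ler_wpM2l ?exprn_ge0//.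
have := @ler_expR R `|x| 1; rewrite x1 => e1.
have e3 : expR `|x| <= 3 by apply: le_trans expR1_le3; rewrite e1.
lra.
Qed.

(** If the coefficients agree below [n], comparing the two expansions at order
    [n + 1] bounds the difference of the [n]th coefficients by a multiple of [z];
    then [z] tends to [0]. *)
Lemma expansion_unique (G : R -> R) (b b' : nat -> R) :
  (forall n, exists K, forall z, 0 <= z <= 1 -> `|G z - \sum_(i < n) b i * z ^+ i| <= K * z ^+ n) ->
  (forall n, exists K, forall z, 0 <= z <= 1 -> `|G z - \sum_(i < n) b' i * z ^+ i| <= K * z ^+ n) ->
  forall n, b n = b' n.
Proof.
move=> hb hb'; elim/ltn_ind => n IH.
have [K hK] := hb n.+1; have [K' hK'] := hb' n.+1.
have K0 : 0 <= K by have := le_trans (normr_ge0 _) (hK 1 _); rewrite expr1n mulr1; apply; rewrite ler01 lexx.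
have K'0 : 0 <= K' by have := le_trans (normr_ge0 _) (hK' 1 _); rewrite expr1n mulr1; apply; rewrite ler01 lexx.
apply/eqP; rewrite -subr_eq0 -normr_le0; apply/ler_addgt0Pr => e e0; rewrite add0r.
pose z := Num.min 1 (e / (K + K' + 1)).
have D0 : 0 < K + K' + 1 by rewrite ltr_wpDl ?addr_ge0.
have z0 : 0 < z by rewrite lt_min ltr01 divr_gt0.
have z01 : 0 <= z <= 1 by rewrite ltW//= ge_min lexx.
have : `|(b n - b' n) * z ^+ n| <= (K + K') * z ^+ n.+1.
  have -> : (b n - b' n) * z ^+ n =
      (G z - \sum_(i < n.+1) b' i * z ^+ i) - (G z - \sum_(i < n.+1) b i * z ^+ i).
    have e1 : \sum_(i < n) b i * z ^+ i = \sum_(i < n) b' i * z ^+ i.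
      by apply: eq_bigr => i _; rewrite IH.
    by rewrite !big_ord_recr/= e1; ring.
  rewrite mulrDl (le_trans (ler_normB _ _))// addrC lerD//; [exact: hK|exact: hK'].
rewrite normrM [ `|z ^+ n| ]ger0_norm ?exprn_ge0 ?(ltW z0)// exprS mulrA.
rewrite ler_pM2r ?exprn_gt0// => /le_trans; apply.
apply: (@le_trans _ _ ((K + K' + 1) * z)); first by rewrite ler_wpM2r ?(ltW z0)// lerDl.
by rewrite mulrC -ler_pdivlMr// ge_min lexx orbT.
Qed.

End exponential_expansion.

(** * Bounded variables and independence *)

Section bounded_expectation.
Context d (T : measurableType d) (R : realType) (P : probability T R).
Implicit Types (f g : T -> R).

(** Boundedness makes integrability automatic, so that means may take their values
    in [R]. *)
Definition bounded_measurable f :=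
  measurable_fun setT f /\ exists M : R, forall w, `|f w| <= M.

Local Notation bm := bounded_measurable.
Local Notation Ex f := (Rintegral P setT f).

Lemma bm_integrable f : bm f -> P.-integrable setT (EFin \o f).
Proof.
move=> [mf [M Mf]].
apply: (le_integrable measurableT _ _ (finite_measure_integrable_cst P M measurableT)).
- exact/measurable_EFinP.
- by move=> w _ /=; rewrite lee_fin (le_trans (Mf w)) ?ler_norm.
Qed.

Lemma bm_cst (r : R) : bm (fun=> r).
Proof. by split => //; exists `|r|. Qed.

Lemma bmD f g : bm f -> bm g -> bm (fun w => f w + g w).
Proof.
move=> [mf [M Mf]] [mg [N Ng]]; split; first exact: measurable_funD.
by exists (M + N) => w; rewrite (le_trans (ler_normD _ _))// lerD.
Qed.

Lemma bmM f g : bm f -> bm g -> bm (fun w => f w * g w).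
Proof.
move=> [mf [M Mf]] [mg [N Ng]]; split; first exact: measurable_funM.
by exists (M * N) => w; rewrite normrM ler_pM.
Qed.

Lemma bmN f : bm f -> bm (fun w => - f w).
Proof.
move=> [mf [M Mf]]; split; first exact: measurableT_comp.
by exists M => w; rewrite normrN.
Qed.

Lemma bmB f g : bm f -> bm g -> bm (fun w => f w - g w).
Proof. by move=> bf bg; apply: bmD => //; apply: bmN. Qed.

Lemma bm_indic (A : set T) : measurable A -> bm (\1_A).
Proof.
move=> mA; split; first exact: measurable_indic.
by exists 1 => w; rewrite indicE; case: (w \in A); rewrite ?normr1 ?normr0.
Qed.

Lemma bm_sum (I : Type) (s : seq I) (Q : pred I) (F : I -> T -> R) :
  (forall i, Q i -> bm (F i)) -> bm (fun w => \sum_(i <- s | Q i) F i w).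
Proof.
move=> bF; elim: s => [|i s IH].
  by rewrite (_ : (fun _ => _) = fun=> 0); [exact: bm_cst|apply/funext => w; rewrite big_nil].
rewrite (_ : (fun _ => _) = fun w => (if Q i then F i w else 0) +
  \sum_(i <- s | Q i) F i w).
  apply: bmD => //; case: (boolP (Q i)) => // Qi; [exact: bF|exact: bm_cst].
by apply/funext => w; rewrite big_cons; case: ifP => // _; rewrite add0r.
Qed.

Lemma bm_prod (I : Type) (s : seq I) (Q : pred I) (F : I -> T -> R) :
  (forall i, Q i -> bm (F i)) -> bm (fun w => \prod_(i <- s | Q i) F i w).
Proof.
move=> bF; elim: s => [|i s IH].
  by rewrite (_ : (fun _ => _) = fun=> 1); [exact: bm_cst|apply/funext => w; rewrite big_nil].
rewrite (_ : (fun _ => _) = fun w => (if Q i then F i w else 1) *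
  \prod_(i <- s | Q i) F i w).
  apply: bmM => //; case: (boolP (Q i)) => // Qi; [exact: bF|exact: bm_cst].
by apply/funext => w; rewrite big_cons; case: ifP => // _; rewrite mul1r.
Qed.

Lemma Ex_cst r : Ex (fun=> r) = r.
Proof.
rewrite Rintegral_cst//; have -> : fine (P setT) = 1 by rewrite probability_setT.
by rewrite mulr1.
Qed.

Lemma ExD f g : bm f -> bm g -> Ex (fun w => f w + g w) = Ex f + Ex g.
Proof. by move=> bf bg; apply: RintegralD => //; exact: bm_integrable. Qed.

Lemma ExB f g : bm f -> bm g -> Ex (fun w => f w - g w) = Ex f - Ex g.
Proof. by move=> bf bg; apply: RintegralB => //; exact: bm_integrable. Qed.

Lemma ExZ r f : bm f -> Ex (fun w => r * f w) = r * Ex f.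
Proof. by move=> bf; apply: RintegralZl => //; exact: bm_integrable. Qed.

Lemma Ex_sum (I : Type) (s : seq I) (F : I -> T -> R) :
  (forall i, bm (F i)) ->
  Ex (fun w => \sum_(i <- s) F i w) = \sum_(i <- s) Ex (F i).
Proof.
move=> bF; elim: s => [|i s IH].
  under eq_Rintegral do rewrite big_nil.
  by rewrite Ex_cst big_nil.
under eq_Rintegral do rewrite big_cons.
by rewrite ExD ?big_cons ?IH//; exact: bm_sum.
Qed.

Lemma le_Ex f g : bm f -> bm g -> (forall w, f w <= g w) -> Ex f <= Ex g.
Proof.
by move=> bf bg fg; apply: le_Rintegral => //; exact: bm_integrable.
Qed.

Lemma Ex_ge0 f : (forall w, 0 <= f w) -> 0 <= Ex f.
Proof. by move=> f0; apply: Rintegral_ge0. Qed.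

Lemma Ex_indic (A : set T) : measurable A -> Ex (\1_A) = fine (P A).
Proof. by move=> mA; rewrite /Rintegral integral_indic// setIT. Qed.

Lemma EFin_Ex f : bm f -> (Ex f)%:E = (\int[P]_w (f w)%:E)%E.
Proof.
move=> bf; rewrite /Rintegral fineK//.
exact: (integrable_fin_num measurableT (bm_integrable bf)).
Qed.

Lemma norm_Ex f : bm f -> `|Ex f| <= Ex (fun w => `|f w|).
Proof. by move=> bf; apply: le_normr_Rintegral => //; exact: bm_integrable. Qed.

(** The joint law of independent variables is a product measure, to which Tonelli's
    theorem applies. *)
Lemma ge0_integral_independent d1 d2 (S1 : measurableType d1)
    (S2 : measurableType d2) (Y : {mfun T >-> S1}) (V : {mfun T >-> S2})
    (f : S1 * S2 -> \bar R) :
  (forall A B, measurable A -> measurable B ->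
    P (Y @^-1` A `&` V @^-1` B) = P (Y @^-1` A) * P (V @^-1` B))%E ->
  measurable_fun setT f -> (forall z, 0 <= f z)%E ->
  (\int[P]_w f (Y w, V w) =
   \int[P]_w \int[distribution P V]_b f (Y w, b))%E.
Proof.
move=> YV mf f0.
have mYV : measurable_fun setT (fun w => (Y w, V w)) by exact: measurable_fun_pair.
pose YVm : {mfun T >-> (S1 * S2)%type} :=
  HB.pack (fun w => (Y w, V w)) (isMeasurableFun.Build _ _ _ _ _ mYV).
transitivity (\int[distribution P YVm]_z f z)%E.
  by rewrite ge0_integral_distribution.
transitivity (\int[(distribution P Y \x distribution P V)%E]_z f z)%E.
  apply: eq_measure_integral => A mA _.
  by apply/esym/product_measure_unique => // B C mB mC /=; exact: YV.
rewrite fubini_tonelli1// /fubini_F.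
rewrite ge0_integral_distribution//.
  exact: (measurable_fun_fubini_tonelli_F (m2 := distribution P V)).
by move=> y; apply: integral_ge0.
Qed.

End bounded_expectation.

Section independence_of_the_others.
Context d (T : measurableType d) (R : realType) (P : probability T R).
Variables (I : choiceType) (F : I -> set (set T)).
Hypothesis Fm : forall i A, F i A -> measurable A.
Hypothesis FT : forall i, F i setT.
Hypothesis FI : forall i, setI_closed (F i).
Hypothesis indF : mutual_independence P F.

Definition rectangles_avoiding (i : I) : set (set T) :=
  [set U | exists (J : {fset I}) (A : I -> set T),
     [/\ i \notin J, (forall j, j \in J -> F j (A j)) &
         U = \bigcap_(j in [set` J]) A j]].

Lemma rectangles_avoiding_measurable i U :
  rectangles_avoiding i U -> measurable U.
Proof.
move=> [J [A [_ FA ->]]]; apply: fin_bigcap_measurable.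
  exact: finite_fset.
by move=> j Jj; apply: Fm; exact: FA.
Qed.

Lemma rectangles_avoiding_setI i : setI_closed (rectangles_avoiding i).
Proof.
move=> _ _ [J1 [A1 [iJ1 FA1 ->]]] [J2 [A2 [iJ2 FA2 ->]]].
pose B1 j := if j \in J1 then A1 j else setT.
pose B2 j := if j \in J2 then A2 j else setT.
exists (J1 `|` J2)%fset, (fun j => B1 j `&` B2 j); split.
- by rewrite in_fsetU negb_or iJ1.
- move=> j _; apply: FI; rewrite /B1 /B2; case: ifP => // ?; [exact: FA1|exact: FA2].
- apply/seteqP; split => w.
    move=> [w1 w2] j /= _; rewrite /B1 /B2; split; case: ifPn => // ?;
    by [apply: w1|apply: w2].
  move=> w12; split => j /= Jj.
    have /= := w12 j; rewrite in_fsetU Jj => /(_ isT) [].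
    by rewrite /B1 Jj.
  have /= := w12 j; rewrite in_fsetU Jj orbT => /(_ isT) [] _.
  by rewrite /B2 Jj.
Qed.

Lemma independence_rectangle i U V : rectangles_avoiding i U -> F i V ->
  (P (U `&` V) = P U * P V)%E.
Proof.
move=> [J [A [iJ FA ->]]] FV.
pose B j := if j == i then V else A j.
have BA j : j \in J -> B j = A j.
  by rewrite /B; case: eqP => // -> ; rewrite (negbTE iJ).
have -> : \bigcap_(j in [set` J]) A j `&` V =
    \bigcap_(j in [set` (i |` J)%fset]) B j.
  apply/seteqP; split => w.
    move=> [wA wV] j /=; rewrite in_fset1U => /predU1P[->|Jj]; first by rewrite /B eqxx.
    by rewrite BA//; apply: wA.
  move=> wB; split.
    by move=> j /= Jj; rewrite -BA//; apply: wB => /=; rewrite in_fset1U Jj orbT.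
  by have := wB i; rewrite /B eqxx; apply; rewrite /= in_fset1U eqxx.
rewrite indF; last first.
  move=> j; rewrite in_fset1U => /predU1P[->|Jj]; first by rewrite /B eqxx.
  by rewrite BA//; exact: FA.
rewrite indF//.
have -> : (\prod_(j <- (i |` J)%fset) P (B j) = P (B i) * \prod_(j <- J) P (B j))%E.
  exact: big_fsetU1.
rewrite muleC {2}/B eqxx; congr (_ * _)%E.
by apply: eq_big_seq => j Jj; rewrite BA.
Qed.

(** The others taken together: by Dynkin's theorem independence passes from
    finite intersections of events of the other families to the sigma-algebra
    that they generate. *)
Lemma independence_of_the_others i U V : <<s rectangles_avoiding i >> U ->
  F i V -> (P (U `&` V) = P U * P V)%E.
Proof.
move=> sU FV.
have mV : measurable V by exact: Fm FV.
pose D : set (set T) := [set U | measurable U /\ (P (U `&` V) = P U * P V)%E].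
suff : <<s rectangles_avoiding i >> `<=` D by move=> /(_ _ sU)[].
have fP A : measurable A -> P A \is a fin_num by move=> mA; exact: fin_num_measure.
apply: lambda_system_subset => //.
- exact: rectangles_avoiding_setI.
- split => //.
  + by split => //; rewrite setTI probability_setT mul1e.
  + move=> A B BA [mA PA] [mB PB]; split; first exact: measurableD.
    have mAV := measurableI _ _ mA mV; have mBV := measurableI _ _ mB mV.
    have -> : (A `\` B) `&` V = (A `&` V) `\` (B `&` V).
      apply/seteqP; split => w; first by move=> [[Aw Bw] Vw]; split => // -[].
      by move=> [[Aw Vw] Bw]; split => //; split => // ?; apply: Bw.
    have e1 : P ((A `&` V) `\` (B `&` V)) = (P (A `&` V) - P (B `&` V))%E.
      have h : A `&` V `&` (B `&` V) = B `&` V by rewrite setIACA setIid (setIidr BA).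
      by rewrite (measureD mAV mBV) ?h// ltey_eq fP.
    have e2 : P (A `\` B) = (P A - P B)%E.
      by rewrite (measureD mA mB) ?(setIidr BA)// ltey_eq fP.
    rewrite e1 e2 PA PB.
    by rewrite muleBl ?fP//; apply: fin_num_adde_defr; exact: fP.
  + move=> A ndA AD; have mA n : measurable (A n) by case: (AD n).
    split; first exact: bigcup_measurable.
    have h1 : P (A n) @[n --> \oo] --> P (\bigcup_n A n).
      by apply: nondecreasing_cvg_mu => //; exact: bigcup_measurable.
    have h2 : P (A n `&` V) @[n --> \oo] --> P (\bigcup_n A n `&` V).
      rewrite setI_bigcupl; apply: nondecreasing_cvg_mu.
      * by move=> n; exact: measurableI.
      * by apply: bigcup_measurable => n _; exact: measurableI.
      * by move=> m n mn; apply/subsetPset; apply: setSI; apply/subsetPset; exact: ndA.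
    have h3 : P (A n `&` V) @[n --> \oo] --> (P (\bigcup_n A n) * P V)%E.
      have -> : (fun n => P (A n `&` V)) = (fun n => P (A n) * P V)%E.
        by apply/funext => n; case: (AD n).
      by apply: cvgeZr => //; exact: fP.
    exact: (cvg_unique _ h2 h3).
- move=> A rA; split; first exact: (rectangles_avoiding_measurable rA).
  exact: independence_rectangle rA FV.
Qed.

End independence_of_the_others.

Section integral_density.
Context d (T : measurableType d) (R : realType).
Variables (mu nu : {measure set T -> \bar R}) (q : T -> R).
Hypotheses (mq : measurable_fun setT q) (q0 : forall x, 0 <= q x).
Hypothesis mE : forall A, measurable A -> nu A = (\int[mu]_(x in A) (q x)%:E)%E.

Import HBNNSimple.

Let integral_density_indic (A : set T) : measurable A ->
  (\int[nu]_x (\1_A x)%:E = \int[mu]_x ((\1_A x)%:E * (q x)%:E))%E.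
Proof.
move=> mA; rewrite integral_indic//= mE ?setIT// integral_mkcond/=.
apply: eq_integral => x _; rewrite patchE indicE.
by case: ifP => _; rewrite ?mul1e ?mul0e.
Qed.

Let integral_density_nnsfun (f : {nnsfun T >-> R}) :
  (\int[nu]_x (f x)%:E = \int[mu]_x ((f x)%:E * (q x)%:E))%E.
Proof.
under [LHS]eq_integral do rewrite fimfunE -fsumEFin//.
rewrite [LHS]ge0_integral_fsum//; last 2 first.
  - by move=> r; apply/measurable_EFinP/measurable_funM => //; exact: measurable_indic.
  - by move=> n x _; rewrite EFinM nnfun_muleindic_ge0.
under [RHS]eq_integral.
  move=> x xD; rewrite fimfunE -fsumEFin// muleC ge0_mule_fsumr; last first.
    by move=> r; rewrite EFinM nnfun_muleindic_ge0.
  over.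
rewrite [RHS]ge0_integral_fsum//; last 2 first.
  - move=> r; apply: emeasurable_funM; first exact/measurable_EFinP.
    by apply/measurable_EFinP/measurable_funM => //; exact: measurable_indic.
  - move=> n x _; rewrite EFinM mule_ge0//; last by rewrite nnfun_muleindic_ge0.
    by rewrite lee_fin.
apply: eq_fsbigr => r _.
rewrite integralZl_indic_nnsfun// integral_density_indic//.
have [r0|r0] := leP 0 r; last first.
  have -> : f @^-1` [set r] = set0.
    apply/seteqP; split => // x /= fx.
    by have := (fun_ge0 x : 0 <= f x); rewrite fx leNgt r0.
  by rewrite !integral0_eq ?mule0// => x _; rewrite indic0/= ?mulr0 ?mul0e ?mule0.
rewrite -ge0_integralZl//.
- by apply: eq_integral => x _; rewrite EFinM [RHS]muleC -muleA.
- by apply: emeasurable_funM; apply/measurable_EFinP => //; exact: measurable_indic.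
- by move=> x _; rewrite mule_ge0// lee_fin.
Qed.

(** From indicators to simple functions, and to their increasing limits. *)
Lemma ge0_integral_density (f : T -> \bar R) :
  measurable_fun setT f -> (forall x, 0 <= f x)%E ->
  (\int[nu]_x f x = \int[mu]_x (f x * (q x)%:E))%E.
Proof.
move=> mf f0.
pose f_ := nnsfun_approx measurableT mf.
have fcvg x : ((f_ n x)%:E)%E @[n --> \oo] --> f x by exact: cvg_nnsfun_approx.
have nd x m n : (m <= n)%N -> ((f_ m x)%:E <= (f_ n x)%:E)%E.
  by move=> mn; rewrite lee_fin; exact/lefP/nd_nnsfun_approx.
transitivity (lim (\int[nu]_x (f_ n x)%:E @[n --> \oo])%E).
  rewrite -monotone_convergence//=.
  - by apply: eq_integral => x _; apply/esym/cvg_lim => //=.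
  - by move=> n; exact/measurable_EFinP.
  - by move=> n ? _; rewrite lee_fin.
  - by move=> x _ k n; exact: nd.
under eq_fun do rewrite integral_density_nnsfun.
rewrite -monotone_convergence//=.
- apply: eq_integral => x _; apply/cvg_lim => //=.
  by apply: cvgeZr => //; exact: fcvg.
- by move=> n; apply: emeasurable_funM; exact/measurable_EFinP.
- by move=> n ? _; rewrite mule_ge0// lee_fin.
- by move=> x _ k n kn; rewrite lee_wpmul2r// ?lee_fin//; exact: nd.
Qed.

End integral_density.

(** * The coordinates of the scheme *)

Lemma measurable_fun_nat_param d d' (S : measurableType d)
    (S' : measurableType d') (h : S -> nat -> S') :
  (forall k, measurable_fun setT (h ^~ k)) ->
  measurable_fun setT (fun z : S * nat => h z.1 z.2).
Proof.
move=> mh _ B mB; rewrite setTI.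
have -> : (fun z : S * nat => h z.1 z.2) @^-1` B =
  \bigcup_k (((fun z : S * nat => h z.1 k) @^-1` B) `&` (snd @^-1` [set k])).
  apply/seteqP; split => [z Bz|z [k _ [/= hz zk]]].
    by exists z.2.
  by rewrite /preimage/= zk.
apply: bigcupT_measurable => k; apply: measurableI.
  have : measurable_fun setT (fun z : S * nat => h z.1 k).
    exact: (measurableT_comp (mh k) measurable_fst).
  by move=> /(_ measurableT B mB); rewrite setTI.
by rewrite -[X in measurable X]setTI; apply: measurable_snd.
Qed.

Section karlin_coordinates.
Context d (T : measurableType d) (R : realType) (P : probability T R).
Variables (p : nat -> R) (X : nat -> {RV P >-> nat}) (E : nat -> {RV P >-> R}).
Hypothesis hXE : poissonized_karlin p X E.

Local Notation Ex f := (Rintegral P setT f).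

Definition coordinate_events (i : nat + nat) : set (set T) :=
  match i with inl n => sigma_of (X n) | inr n => sigma_of (E n) end.

(** Measurability with respect to this sigma-algebra encodes the functions of the
    coordinates other than [i], without naming these coordinates. *)
Definition others i := g_sigma_algebraType (rectangles_avoiding coordinate_events i).

Lemma coordinate_events_measurable i A : coordinate_events i A -> measurable A.
Proof.
case: i => n [B mB <-]; first exact: (measurable_funP (X n)).
exact: (measurable_funP (E n)).
Qed.

Lemma coordinate_eventsT i : coordinate_events i setT.
Proof. by case: i => n; exists setT => //; rewrite preimage_setT setIT. Qed.

Lemma coordinate_eventsI i : setI_closed (coordinate_events i).
Proof.
case: i => n _ _ [A mA <-] [B mB <-]; exists (A `&` B); try exact: measurableI.
  by rewrite !setTI preimage_setI.
by rewrite !setTI preimage_setI.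
Qed.

Lemma sub_others i j A : i != j -> coordinate_events j A ->
  measurable (A : set (others i)).
Proof.
move=> ij FA; apply: sub_sigma_algebra.
exists [fset j]%fset, (fun=> A); split => //.
- by rewrite in_fset1.
- by move=> k; rewrite in_fset1 => /eqP ->.
- apply/seteqP; split => [w Aw k //|w].
  by apply => /=; rewrite in_fset1.
Qed.

Lemma measurable_others i (A : set T) : measurable (A : set (others i)) ->
  measurable A.
Proof.
move: A; apply: smallest_sub; first exact: sigma_algebra_measurable.
by move=> A; apply: rectangles_avoiding_measurable; exact: coordinate_events_measurable.
Qed.

Lemma measurable_fun_others i d' (S : measurableType d') (f : T -> S) :
  measurable_fun (setT : set (others i)) (f : others i -> S) ->
  measurable_fun setT f.
Proof.
move=> mf _ A mA; apply: (@measurable_others i).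
exact: (mf measurableT A mA).
Qed.

Lemma measurable_others_box i n : i != inl n ->
  measurable_fun (setT : set (others i)) (X n : others i -> nat).
Proof. by move=> iXn _ A mA; apply: (sub_others iXn); exists A. Qed.

Lemma measurable_others_gap i n : i != inr n ->
  measurable_fun (setT : set (others i)) (E n : others i -> R).
Proof. by move=> iEn _ A mA; apply: (sub_others iEn); exists A. Qed.

Lemma ge0_integral_others i d1 d2 (S1 : measurableType d1)
    (S2 : measurableType d2) (Y : T -> S1) (V : {mfun T >-> S2})
    (f : S1 * S2 -> \bar R) :
  measurable_fun (setT : set (others i)) (Y : others i -> S1) ->
  coordinate_events i = sigma_of V ->
  measurable_fun setT f -> (forall z, 0 <= f z)%E ->
  (\int[P]_w f (Y w, V w) =
   \int[P]_w \int[distribution P V]_b f (Y w, b))%E.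
Proof.
move=> mY iV mf f0.
pose Ym : {mfun T >-> S1} :=
  HB.pack Y (isMeasurableFun.Build _ _ _ _ _ (measurable_fun_others mY)).
apply: (@ge0_integral_independent _ _ _ _ _ _ _ _ Ym V f) => // A B mA mB.
have := @independence_of_the_others _ _ _ P _ coordinate_events
  coordinate_events_measurable coordinate_eventsT coordinate_eventsI
  (scheme_independence hXE) i (Ym @^-1` A) (V @^-1` B).
apply; last by rewrite iV; exists B; rewrite ?setTI.
by have := mY measurableT A mA; rewrite setTI.
Qed.

(** The ball [n] is thrown at the time [gap_sum n.+1], so that [gap_sum n] is the
    time of the previous throw. *)
Definition gap_sum n w := \sum_(i < n) E i w.

Lemma measurable_others_gap_sum i n : (forall m, (m < n)%N -> i != inr m) ->
  measurable_fun (setT : set (others i)) (gap_sum n : others i -> R).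
Proof.
elim: n => [|n IH] iE.
  by apply: (eq_measurable_fun (cst 0 : others i -> R)) => // w _; rewrite /gap_sum big_ord0.
apply: (eq_measurable_fun (fun w : others i => gap_sum n w + E n w)).
  by move=> w _; rewrite /gap_sum big_ord_recr.
apply: measurable_funD; first by apply: IH => m mn; exact/iE/leqW.
by apply: measurable_others_gap; exact: iE.
Qed.

(** The box of the ball [M] is independent of the gaps and of the other boxes, of
    which [Y] and the time are functions. *)
Lemma integral_box M (Y : T -> R) (n : nat) (h : R -> nat -> R) :
  (forall w, 0 <= Y w) -> (forall s k, 0 <= h s k) ->
  (forall k, measurable_fun setT (h ^~ k)) ->
  measurable_fun (setT : set (others (inl M))) (Y : others (inl M) -> R) ->
  (\int[P]_w (Y w * h (gap_sum n w) (X M w))%:E =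
   \int[P]_w ((Y w)%:E * \int[distribution P (X M)]_k (h (gap_sum n w) k)%:E))%E.
Proof.
move=> Y0 h0 mh mY.
pose f (z : (R * R) * nat) := (`|z.1.1| * h z.1.2 z.2)%:E.
have mhh : measurable_fun setT (fun z : (R * R) * nat => h z.1.2 z.2).
  apply: (@measurable_fun_nat_param _ _ _ _ (fun y : R * R => h y.2)) => k.
  exact: (measurableT_comp (mh k) measurable_snd).
transitivity (\int[P]_w f ((Y w, gap_sum n w), X M w))%E.
  by apply: eq_integral => w _; rewrite /f /= ger0_norm.
rewrite (@ge0_integral_others (inl M) _ _ _ _ (fun w => (Y w, gap_sum n w)))//.
- apply: eq_integral => w _; rewrite /f/= ger0_norm//.
  under eq_integral do rewrite EFinM.
  rewrite ge0_integralZl//.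
  - by move=> k _; rewrite lee_fin.
  - by rewrite lee_fin.
- by apply: measurable_fun_pair => //; apply: measurable_others_gap_sum.
- apply/measurable_EFinP; apply: measurable_funM => //.
  apply: measurableT_comp => //.
  exact: (measurableT_comp measurable_fst measurable_fst).
- by move=> z; rewrite /f lee_fin mulr_ge0.
Qed.

(** The gap before the ball [M] is exponential, and independent of the time of the
    previous throw and of [Y]. *)
Lemma integral_gap M (Y : T -> R) (h : R -> R) :
  (forall w, 0 <= Y w) -> (forall s, 0 <= h s) -> measurable_fun setT h ->
  measurable_fun (setT : set (others (inr M))) (Y : others (inr M) -> R) ->
  (\int[P]_w (Y w * h (gap_sum M.+1 w))%:E =
   \int[P]_w ((Y w)%:E *
     \int[lebesgue_measure]_(s in `[0%R, +oo[) (h (gap_sum M w + s) * expR (- s))%:E))%E.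
Proof.
move=> Y0 h0 mh mY.
pose f (z : (R * R) * R) := (`|z.1.1| * h (z.1.2 + z.2))%:E.
transitivity (\int[P]_w f ((Y w, gap_sum M w), E M w))%E.
  by apply: eq_integral => w _; rewrite /f /gap_sum /= big_ord_recr/= ger0_norm.
have m12 : measurable_fun setT (fun z : (R * R) * R => z.1.2).
  exact: (measurableT_comp measurable_snd measurable_fst).
have mhh : measurable_fun setT (fun z : (R * R) * R => h (z.1.2 + z.2)).
  by apply: (measurableT_comp mh); apply: measurable_funD.
pose V : {mfun T >-> measurableTypeR R} := HB.pack (E M : T -> measurableTypeR R)
  (isMeasurableFun.Build _ _ _ (measurableTypeR R) _ (measurable_funP (E M))).
rewrite (@ge0_integral_others (inr M) _ _ _ _ (fun w => (Y w, gap_sum M w)) V f)//.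
- apply: eq_integral => w _; rewrite /f/= ger0_norm//.
  have mhs : measurable_fun setT (fun s => h (gap_sum M w + s)).
    by apply: (measurableT_comp mh); apply: measurable_funD.
  under eq_integral do rewrite EFinM.
  rewrite ge0_integralZl//.
  + congr (_ * _)%E.
    etransitivity.
      apply: (@ge0_integral_density _ _ _ (@lebesgue_measure R) _ (exponential_pdf 1)).
    * exact: measurable_exponential_pdf.
    * by move=> s; apply: exponential_pdf_ge0.
    * by move=> A mA; exact: (increment_law hXE M mA).
    * exact/measurable_EFinP.
    * by move=> s; rewrite lee_fin.
    * rewrite [RHS]integral_mkcond/=; apply: eq_integral => s _.
      rewrite /exponential_pdf !patchE; case: ifP => _; last by rewrite mule0.
      by rewrite mul1r mulN1r EFinM.
  + exact/measurable_EFinP.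
  + by move=> s _; rewrite lee_fin.
  + by rewrite lee_fin.
- apply: measurable_fun_pair => //; apply: measurable_others_gap_sum => m mM.
  by apply: contraTneq mM => -[->]; rewrite ltnn.
- apply/measurable_EFinP; apply: measurable_funM => //.
  apply: measurableT_comp => //.
  exact: (measurableT_comp measurable_fst measurable_fst).
- by move=> z; rewrite /f lee_fin mulr_ge0.
Qed.

End karlin_coordinates.

(** * The balance between the accepted balls and the intensity in store *)

Section step_rate.
Context (R : realType) (m : nat) (r aa bb : nat -> R).
Hypotheses (r0 : forall c, 0 <= r c) (aabb : forall c, aa c <= bb c).

(** The length of the part of the interval from [a] to [b] after the time [x]:
    this closed form is piecewise affine in [x] with known breakpoints. *)
Definition overlap (a b x : R) := Num.max 0 (b - x) - Num.max 0 (a - x).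
Definition rate s := \sum_(c < m) r c * ((aa c < s <= bb c)%R : bool)%:R.
Definition future x := \sum_(c < m) r c * overlap (aa c) (bb c) x.

Let max0E (t : R) : (0 <= t /\ Num.max 0 t = t) \/ (t <= 0 /\ Num.max 0 t = 0).
Proof. by case: (leP 0 t) => h; [left|right; split => //; exact: ltW]. Qed.

Lemma overlap_ge0 a b x : a <= b -> 0 <= overlap a b x.
Proof. by move=> ab; rewrite /overlap; case: (max0E (b - x)) => -[? ->];
  case: (max0E (a - x)) => -[? ->]; lra. Qed.

Lemma future_ge0 x : 0 <= future x.
Proof. by apply: sumr_ge0 => c _; rewrite mulr_ge0// overlap_ge0. Qed.

Lemma measurable_overlap a b : measurable_fun setT (overlap a b).
Proof.
by apply: measurable_funB; apply: measurable_maxr => //; apply: measurable_funB.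
Qed.

Lemma measurable_future : measurable_fun setT future.
Proof.
apply: measurable_sum => c; apply: measurable_funM => //.
exact: measurable_overlap.
Qed.

Lemma measurable_rate : measurable_fun setT rate.
Proof.
apply: measurable_sum => c; apply: measurable_funM => //.
rewrite (_ : (fun _ => _) = \1_(`]aa c, bb c]%classic)).
  exact: measurable_indic.
by apply/funext => s; rewrite indicE/= mem_setE in_itv/=.
Qed.

Definition survival s := expR (- future s) * expR (- s).

Let flow s := expR (- future s) * (1 - rate s) * expR (- s).

Lemma measurable_flow : measurable_fun setT flow.
Proof.
apply: measurable_funM; last by apply: measurableT_comp.
apply: measurable_funM; last by apply: measurable_funB => //; exact: measurable_rate.
by do 2 apply: measurableT_comp => //; exact: measurable_future.
Qed.

(** Between two consecutive breakpoints the rate is a constant [g] and the future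
    is affine with slope [- g], so that [survival] is an antiderivative of minus
    the flow. *)
Let integral_flow_between a b : a < b ->
  (forall c, (c < m)%N -> ~~ (a < aa c < b) && ~~ (a < bb c < b)) ->
  (\int[lebesgue_measure]_(s in `[a, b]) (flow s)%:E =
   (survival a - survival b)%:E)%E.
Proof.
move=> ab nobreak.
pose on c := (aa c <= a) && (b <= bb c).
pose g := \sum_(c < m) r c * (on c)%:R.
have sides c : (c < m)%N -> (aa c <= a \/ b <= aa c) /\ (bb c <= a \/ b <= bb c).
  move=> /nobreak /andP[]; rewrite !negb_and -!leNgt => /orP n1 /orP n2.
  by split.
have rateE s : a < s < b -> rate s = g.
  move=> /andP[as_ sb]; apply: eq_bigr => c _; congr (_ * (_ : bool)%:R).
  have [ha hb] := sides c (ltn_ord c); have := aabb c; rewrite /on => abc.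
  by apply/idP/idP => /andP[l1 l2]; apply/andP; split; case: ha => ?; case: hb => ?; lra.
have futureE s : a <= s <= b -> future s = future b + g * (b - s).
  move=> /andP[as_ sb]; rewrite /future /g mulr_suml -big_split/=; apply: eq_bigr => c _.
  rewrite -mulrA -mulrDr; congr (_ * _).
  have [ha hb] := sides c (ltn_ord c); have := aabb c; rewrite /on /overlap => abc.
  case: ha => ha; case: hb => hb.
  - have -> : (b <= bb c) = false by apply/negbTE; rewrite -ltNge; lra.
    rewrite andbF/= mul0r; case: (max0E (bb c - s)) => -[? ->]; case: (max0E (aa c - s)) => -[? ->];
      case: (max0E (bb c - b)) => -[? ->]; case: (max0E (aa c - b)) => -[? ->]; lra.
  - rewrite ha hb/= mul1r; case: (max0E (bb c - s)) => -[? ->]; case: (max0E (aa c - s)) => -[? ->];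
      case: (max0E (bb c - b)) => -[? ->]; case: (max0E (aa c - b)) => -[? ->]; lra.
  - lra.
  - have -> : (aa c <= a) = false by apply/negbTE; rewrite -ltNge; lra.
    rewrite /= mul0r; case: (max0E (bb c - s)) => -[? ->]; case: (max0E (aa c - s)) => -[? ->];
      case: (max0E (bb c - b)) => -[? ->]; case: (max0E (aa c - b)) => -[? ->]; lra.
pose F s := expR (- (future b + g * (b - s)) - s).
have dF (s : R) : is_derive s (1 : R) F ((g - 1) * F s).
  rewrite /F; apply: is_derive_eq; rewrite /GRing.scale/=; ring.
have cF : continuous F by move=> s; apply: differentiable_continuous; apply/derivable1_diffP; exact: ex_derive.
transitivity (\int[lebesgue_measure]_(s in `[a, b]) ((1 - g) * F s)%:E)%E.
  apply: eq_integral_itv_bounded.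
  - by apply: measurable_funTS; exact: measurable_flow.
  - by apply: measurable_funTS; apply: measurable_funM => //; exact: continuous_measurable_fun.
  - move=> s; rewrite in_itv/= => asb.
    by rewrite /flow /F rateE// futureE ?expRD; [ring|case/andP: asb => /ltW-> /ltW->].
rewrite (@continuous_FTC2 _ _ (fun s => - F s) a b)//.
- by rewrite /survival -!expRD futureE ?lexx ?(ltW ab)// [in LHS]/F subrr mulr0 addr0; congr EFin; ring.
- apply: continuous_subspaceT => s; apply: cvgM; [exact: cvg_cst|exact: cF].
- split.
  + by move=> s _; apply: derivableN; exact: ex_derive.
  + by apply: cvg_at_right_filter; apply: cvgN; exact: cF.
  + by apply: cvg_at_left_filter; apply: cvgN; exact: cF.
- by move=> s _; rewrite derive1E; apply: derive_val; apply: is_derive_eq; ring.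
Qed.

Hypothesis rate01 : forall s, 0 <= rate s <= 1.

Let flow_ge0 s : 0 <= flow s.
Proof. by rewrite !mulr_ge0 ?expR_ge0// subr_ge0; case/andP: (rate01 s). Qed.

(** Here [l] lists the breakpoints, at which the interval is cut one after the
    other; the differences of [survival] telescope. *)
Let integral_flow (l : seq R) a b : a <= b ->
  (forall c, (c < m)%N -> a < aa c < b -> aa c \in l) ->
  (forall c, (c < m)%N -> a < bb c < b -> bb c \in l) ->
  (\int[lebesgue_measure]_(s in `[a, b]) (flow s)%:E =
   (survival a - survival b)%:E)%E.
Proof.
elim: l a b => [|x l IH] a b; rewrite le_eqVlt => /predU1P[->|ab] ha hb.
- by rewrite set_itv1 integral_set1 subrr.
- apply: integral_flow_between => // c cm; apply/andP; split; apply/negP.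
    by move/(ha _ cm).
  by move/(hb _ cm).
- by rewrite set_itv1 integral_set1 subrr.
have [/andP[ax xb]|xab] := boolP (a < x < b); last first.
  apply: IH; first exact: ltW.
    move=> c cm h; have := ha c cm h; rewrite inE => /predU1P[cx|//].
    by move: xab; rewrite -cx h.
  move=> c cm h; have := hb c cm h; rewrite inE => /predU1P[cx|//].
  by move: xab; rewrite -cx h.
have sub y : a < y < x -> a < y < b by case/andP => -> /lt_trans; apply.
have sub' y : x < y < b -> a < y < b by case/andP => /(lt_trans ax) -> ->.
have nx y : a < y < x -> y \in x :: l -> y \in l.
  by case/andP => _ yx; rewrite inE (lt_eqF yx).
have nx' y : x < y < b -> y \in x :: l -> y \in l.
  by case/andP => xy _; rewrite inE (gt_eqF xy).
have -> : `[a, b]%classic = `[a, x]%classic `|` `]x, b]%classic.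
  by rewrite -itv_bndbnd_setU// bnd_simp ltW.
have mflow D : measurable_fun D (EFin \o flow).
  by apply: measurable_funTS; apply/measurable_EFinP; exact: measurable_flow.
rewrite ge0_integral_setU//=.
- rewrite integral_itv_obnd_cbnd; last exact: mflow.
  rewrite IH ?(ltW ax)//; last 2 first.
  + by move=> c cm h; apply: nx => //; apply: ha => //; exact: sub.
  + by move=> c cm h; apply: nx => //; apply: hb => //; exact: sub.
  rewrite IH ?(ltW xb)//; last 2 first.
  + by move=> c cm h; apply: nx' => //; apply: ha => //; exact: sub'.
  + by move=> c cm h; apply: nx' => //; apply: hb => //; exact: sub'.
  by rewrite -EFinD addrA subrK.
- exact: mflow.
- by move=> s _; rewrite lee_fin.
- apply/disj_setPS => s [/=]; rewrite !in_itv/= => /andP[_ sx] /andP[xs _].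
  by have := lt_le_trans xs sx; rewrite ltxx.
Qed.

(** If a ball thrown at the time [s] is accepted with probability [1 - rate s],
    waiting for it an exponential time preserves the mean of [expR (- future)]: the
    loss of intensity compensates the risk of rejection. *)
Lemma integral_exponential_flow :
  (\int[lebesgue_measure]_(s in `[0%R, +oo[)
     (expR (- future s) * (1 - rate s) * expR (- s))%:E =
   (expR (- future 0))%:E)%E.
Proof.
have mflow D : measurable_fun D (EFin \o flow).
  by apply: measurable_funTS; apply/measurable_EFinP; exact: measurable_flow.
have -> : `[0%R, +oo[%classic = \bigcup_n `[0%R, (n%:R : R)]%classic.
  apply/seteqP; split => s /=.
    rewrite in_itv/= andbT => s0; exists (Num.truncn s).+1 => //=; rewrite in_itv/= s0/= ltW//.
    exact: truncnS_gt.
  by move=> [n _ /=]; rewrite !in_itv/= => /andP[->].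
have h1 : (\int[lebesgue_measure]_(s in `[0%R, (n%:R : R)]%classic) (flow s)%:E)%E
    @[n --> \oo] --> (\int[lebesgue_measure]_(s in \bigcup_n `[0%R, (n%:R : R)]%classic)
     (flow s)%:E)%E.
  apply: ge0_nondecreasing_set_cvg_integral => //.
  - move=> k n kn; apply/subsetPset => s /=; rewrite !in_itv/= => /andP[-> sk]/=.
    by rewrite (le_trans sk)// ler_nat.
  - by move=> n; exact: mflow.
  - by move=> n s _; rewrite lee_fin.
have h2 : (\int[lebesgue_measure]_(s in `[0%R, (n%:R : R)]%classic) (flow s)%:E)%E
    @[n --> \oo] --> (expR (- future 0))%:E.
  have -> : (fun n : nat => \int[lebesgue_measure]_(s in `[0%R, (n%:R : R)]%classic) (flow s)%:E)%E =
      (fun n : nat => (survival 0 - survival n%:R)%:E).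
    apply/funext => n; apply: (@integral_flow (mkseq aa m ++ mkseq bb m)) => //.
      by move=> c cm _; rewrite mem_cat; apply/orP; left; apply/mapP; exists c; rewrite ?mem_iota.
    by move=> c cm _; rewrite mem_cat; apply/orP; right; apply/mapP; exists c; rewrite ?mem_iota.
  apply: cvg_EFin; first exact: nearW.
  rewrite -[X in _ --> X]subr0; apply: cvgB.
    by rewrite /survival oppr0 expR0 mulr1; exact: cvg_cst.
  apply: (@squeeze_cvgr _ _ _ _ (cst 0) (fun n => (n%:R + 1)^-1)).
  - apply: nearW => n; rewrite mulr_ge0 ?expR_ge0//=.
    rewrite -[leRHS]mul1r ler_pM ?expR_ge0//.
      by rewrite expR_le1 oppr_le0 future_ge0.
    by rewrite expRN lef_pV2 ?posrE ?expR_gt0// ?ltr_wpDl// addrC expR_ge1Dx.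
  - exact: cvg_cst.
  - rewrite (_ : (fun _ => _) = @harmonic R); first exact: cvg_harmonic.
    by apply/funext => n; rewrite /harmonic /= -natr1.
exact: (cvg_unique _ h1 h2).
Qed.

End step_rate.

Section poisson_cells.
Context d (T : measurableType d) (R : realType) (P : probability T R).
Variables (p : nat -> R) (X : nat -> {RV P >-> nat}) (E : nat -> {RV P >-> R}).
Hypothesis hXE : poissonized_karlin p X E.
Variables (m : nat) (kk : nat -> nat) (aa bb z : nat -> R).
Hypothesis z01 : forall c, 0 <= z c <= 1.
Hypothesis aabb : forall c, aa c <= bb c.

Local Notation gaps := (gap_sum E).

(** The cell [c] consists of the balls of the box [kk c] thrown after the time
    [aa c] and by the time [bb c]; each of them is weighted by [z c]. *)
Definition in_cell c (s : R) (k : nat) := (aa c < s <= bb c) && (k == kk c).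
Definition mark s k := \prod_(c < m) z c ^+ in_cell c s k.
Definition thinning c := (1 - z c) * p (kk c).

Hypothesis disjoint_cells : forall c c' s k, (c < m)%N -> (c' < m)%N ->
  in_cell c s k -> in_cell c' s k -> c = c'.

Lemma box_prob_ge0 k : 0 <= p k.
Proof. by rewrite -lee_fin -(box_law hXE 0 k). Qed.

Lemma thinning_ge0 c : 0 <= thinning c.
Proof. by rewrite mulr_ge0 ?box_prob_ge0// subr_ge0; case/andP: (z01 c). Qed.

Lemma mark01 s k : 0 <= mark s k <= 1.
Proof.
apply/andP; split.
  by apply: prodr_ge0 => c _; rewrite exprn_ge0//; case/andP: (z01 c).
apply: prodr_ile1 => c _; have /andP[z0 z1] := z01 c.
by rewrite exprn_ge0//= exprn_ile1.
Qed.

Lemma mark_sum s k : mark s k = 1 - \sum_(c < m) (1 - z c) * (in_cell c s k)%:R.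
Proof.
have [[c0 c0s]|no] := pselect (exists c : 'I_m, in_cell c s k).
  have off (c : 'I_m) : c != c0 -> in_cell c s k = false.
    apply: contra_neqF => cs; apply/val_inj.
    exact: (disjoint_cells (ltn_ord c) (ltn_ord c0) cs c0s).
  rewrite /mark (bigD1 c0)//= (bigD1 (F := fun c : 'I_m => (1 - z c) * (in_cell c s k)%:R) c0)//=.
  rewrite c0s expr1 mulr1 big1 ?big1.
  - by rewrite addr0 mulr1; ring.
  - by move=> c cc0; rewrite off// mulr0.
  - by move=> c cc0; rewrite off// expr0.
have off (c : 'I_m) : in_cell c s k = false.
  by apply/negbTE/negP => cs; apply: no; exists c.
rewrite /mark big1; last by move=> c _; rewrite off expr0.
by rewrite big1 ?subr0// => c _; rewrite off mulr0.
Qed.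

Lemma measurable_mark k : measurable_fun setT (mark ^~ k).
Proof.
have -> : mark ^~ k = fun s => 1 - \sum_(c < m) (1 - z c) * (in_cell c s k)%:R.
  by apply/funext => s; rewrite mark_sum.
apply: measurable_funB => //; apply: measurable_sum => c.
apply: measurable_funM => //; rewrite /in_cell.
case: (k == kk c).
  rewrite (_ : (fun _ => _) = \1_(`]aa c, bb c]%classic)).
    exact: measurable_indic.
  by apply/funext => s; rewrite indicE/= mem_setE in_itv/= andbT.
rewrite (_ : (fun _ => _) = cst 0); first exact: measurable_cst.
by apply/funext => s; rewrite andbF.
Qed.

Lemma integral_mark M s :
  (\int[distribution P (X M)]_k (mark s k)%:E =
   (1 - rate m thinning aa bb s)%:E)%E.
Proof.
under eq_integral do rewrite mark_sum.
pose nu : probability _ R := distribution P (X M).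
have bmi c : bounded_measurable (fun k : nat => (1 - z c) * (in_cell c s k)%:R).
  split => //; exists (`|1 - z c|) => k; rewrite normrM.
  by rewrite -[leRHS]mulr1 ler_wpM2l//; case: in_cell; rewrite ?normr1 ?normr0.
have bm_sum : bounded_measurable (fun k : nat =>
    \sum_(c < m) (1 - z c) * (in_cell c s k)%:R).
  exact: bm_sum.
have bm1 : bounded_measurable (fun _ : nat => 1 : R) by exact: bm_cst.
rewrite -(EFin_Ex nu (bmB bm1 bm_sum)); congr EFin.
rewrite (ExB nu bm1 bm_sum) Ex_cst (Ex_sum nu _ (fun c : 'I_m => bmi c)).
congr (_ - _); apply: eq_bigr => c _.
have bmk : bounded_measurable (\1_[set kk c] : nat -> R) by exact: bm_indic.
transitivity (Rintegral nu setT
  (fun k => (1 - z c) * ((aa c < s <= bb c)%R : bool)%:R * \1_[set kk c] k)).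
  apply: eq_Rintegral => k _; rewrite -mulrA; congr (_ * _).
  rewrite /in_cell indicE in_set1 eq_sym [in RHS]eq_sym -natrM mulnb.
  by rewrite [kk c == k]eq_sym.
rewrite (ExZ nu _ bmk) (Ex_indic nu)//.
have -> : fine (nu [set kk c]) = p (kk c) by have := box_law hXE M (kk c); rewrite /nu/= /distribution/= /pushforward => ->.
by rewrite /thinning; ring.
Qed.

Lemma rate01 s : 0 <= rate m thinning aa bb s <= 1.
Proof.
rewrite sumr_ge0/=; last by move=> c _; rewrite mulr_ge0// thinning_ge0.
rewrite -subr_ge0 -lee_fin -(integral_mark 0 s) integral_ge0// => k _.
by rewrite lee_fin; case/andP: (mark01 s k).
Qed.

Lemma measurable_others_mark i0 i : i0 != inl i ->
  (forall n, (n <= i)%N -> i0 != inr n) ->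
  measurable_fun (setT : set (others X E i0))
    (fun w : others X E i0 => mark (gaps i.+1 w) (X i w)).
Proof.
move=> iX iE.
have mpair : measurable_fun (setT : set (others X E i0))
    (fun w : others X E i0 => (gaps i.+1 w, X i w)).
  apply: measurable_fun_pair; last exact: measurable_others_box.
  exact: measurable_others_gap_sum.
exact: (measurableT_comp (measurable_fun_nat_param measurable_mark) mpair).
Qed.

Definition marks n w := \prod_(i < n) mark (gaps i.+1 w) (X i w).

Lemma marks_ge0 n w : 0 <= marks n w.
Proof. by apply: prodr_ge0 => i _; case/andP: (mark01 (gaps i.+1 w) (X i w)). Qed.

Lemma marks_le1 n w : marks n w <= 1.
Proof. by apply: prodr_ile1 => i _; exact: mark01. Qed.

Lemma measurable_others_marks i0 n :
  (forall i, (i < n)%N -> i0 != inl i) -> (forall i, (i < n)%N -> i0 != inr i) ->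
  measurable_fun (setT : set (others X E i0)) (marks n : others X E i0 -> R).
Proof.
move=> iX iE; rewrite /marks.
elim: n iX iE => [|n IH] iX iE.
  by apply: (eq_measurable_fun (cst 1 : others X E i0 -> R)) => // w _; rewrite big_ord0.
apply: (eq_measurable_fun (fun w : others X E i0 =>
   \prod_(i < n) mark (gaps i.+1 w) (X i w) * mark (gaps n.+1 w) (X n w))).
  by move=> w _; rewrite big_ord_recr.
apply: measurable_funM.
  by apply: IH => i /leqW ?; [exact: iX|exact: iE].
by apply: measurable_others_mark => [|i ni]; [exact: iX|exact: iE].
Qed.

(** By induction on the number of balls. The box of the last ball is averaged
    first, which turns its mark into [1 - rate]; then the gap before it, by
    [integral_exponential_flow] with the cells shifted to the time of the previous
    throw. *)
Lemma integral_marks n :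
  (\int[P]_w (marks n w * expR (- future m thinning aa bb (gaps n w)))%:E =
   (expR (- future m thinning aa bb 0))%:E)%E.
Proof.
have mfut := measurable_future m thinning aa bb.
elim: n => [|n <-].
  under eq_integral do rewrite /marks /gap_sum !big_ord0 mul1r.
  by rewrite -(EFin_Ex P (bm_cst _ _)) Ex_cst.
under eq_integral do rewrite /marks big_ord_recr/= mulrAC.
rewrite (@integral_box _ _ _ _ _ _ _ hXE n (fun w => marks n w *
    expR (- future m thinning aa bb (gaps n.+1 w))) n.+1 mark)//; last 4 first.
- by move=> w; rewrite mulr_ge0 ?marks_ge0 ?expR_ge0.
- by move=> s k; case/andP: (mark01 s k).
- exact: measurable_mark.
- apply: measurable_funM.
    by apply: measurable_others_marks => i ni //; apply: contraTneq ni => -[<-]; rewrite ltnn.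
  apply: measurableT_comp => //; apply: measurableT_comp => //.
  apply: measurableT_comp => //; exact: measurable_others_gap_sum.
pose h s := expR (- future m thinning aa bb s) * (1 - rate m thinning aa bb s).
transitivity (\int[P]_w (marks n w * h (gaps n.+1 w))%:E)%E.
  by apply: eq_integral => w _; rewrite integral_mark -EFinM mulrA.
rewrite (integral_gap hXE)//.
- apply: eq_integral => w _; rewrite EFinM; congr (_ * _)%E.
  set x := gaps n w.
  have overlapE a b s : overlap a b (x + s) = overlap (a - x) (b - x) s.
    by rewrite /overlap !opprD !addrA.
  have futE s : future m thinning aa bb (x + s) =
      future m thinning (fun c => aa c - x) (fun c => bb c - x) s.
    by apply: eq_bigr => c _; rewrite overlapE.
  have rateE s : rate m thinning aa bb (x + s) =
      rate m thinning (fun c => aa c - x) (fun c => bb c - x) s.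
    by apply: eq_bigr => c _; rewrite ltrBlDl lerBrDl.
  rewrite -[x in RHS]addr0 futE -integral_exponential_flow//.
  + by apply: eq_integral => s _; rewrite /h futE rateE.
  + exact: thinning_ge0.
  + by move=> c; rewrite lerB.
  + by move=> s; rewrite -rateE rate01.
- exact: marks_ge0.
- by move=> s; rewrite mulr_ge0 ?expR_ge0// subr_ge0; case/andP: (rate01 s).
- apply: measurable_funM.
    by do 2 apply: measurableT_comp => //.
  by apply: measurable_funB => //; exact: measurable_rate.
- by apply: measurable_others_marks => i ni //; apply: contraTneq ni => -[<-]; rewrite ltnn.
Qed.

End poisson_cells.

(** * Poissonization *)

Lemma measurable_truncn (R : realType) :
  measurable_fun setT (Num.truncn : R -> nat).
Proof.
move=> _ U mU; rewrite setTI.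
have -> : Num.truncn @^-1` U = \bigcup_(n in U) (Num.truncn @^-1` [set n] : set R).
  by apply/seteqP; split => [x Ux|x [n Un /= ->]//]; exists (Num.truncn x).
apply: bigcup_measurable => n _.
have mlt k : measurable [set x : R | x < k.+1%:R].
  have -> : [set x : R | x < k.+1%:R] = `]-oo, k.+1%:R[%classic.
    by apply/seteqP; split => x; rewrite /= in_itv.
  exact: measurable_itv.
case: n => [|n].
  rewrite (_ : _ @^-1` _ = [set x : R | x < 1%:R])//.
  apply/seteqP; split => x /=; rewrite -truncn_le_nat leqn0; first by move->.
  by move/eqP.
rewrite (_ : _ @^-1` _ = [set x : R | x < n.+2%:R] `\` [set x | x < n.+1%:R]).
  exact: measurableD.
apply/seteqP; split => x /=; rewrite -!truncn_le_nat.
  by move=> ->; rewrite ltnn.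
by move=> [h1 h2]; apply/eqP; rewrite eqn_leq h1 ltnNge; exact/negP.
Qed.

Section ball_counts.
Context d (T : measurableType d) (R : realType) (P : probability T R).
Variables (p : nat -> R) (X : nat -> {RV P >-> nat}) (E : nat -> {RV P >-> R}).
Hypothesis hXE : poissonized_karlin p X E.

Local Notation gaps := (gap_sum E).
Local Notation Ex f := (Rintegral P setT f).

Lemma measurable_gap_sum n : measurable_fun setT (gaps n).
Proof. by apply: measurable_sum => i; exact: measurable_funP. Qed.

(** On these outcomes, almost all, the series that define the contents of the
    boxes are finite sums. *)
Definition regular w := (forall i, 0 <= E i w) /\ (forall t, exists n, t < gaps n w).

Lemma ae_gap_ge0 i : {ae P, forall w, 0 <= E i w}.
Proof.
exists (E i @^-1` `]-oo, 0[%classic); split.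
- exact: measurable_funPTI.
- rewrite (increment_law hXE)// /exponential_prob integral0_eq// => x /=.
  by rewrite in_itv/= => x0; rewrite lt0_exponential_pdf.
- by move=> w /= /negP; rewrite -ltNge in_itv.
Qed.

(** Markov's inequality for these means, which tend to [0], shows that the throws
    exceed every bounded time. *)
Lemma mean_exp_gap_sum n :
  (\int[P]_w (expR (- gaps n w))%:E = (2 ^- n)%:E)%E.
Proof.
elim: n => [|n IH].
  under eq_integral do rewrite /gap_sum big_ord0 oppr0 expR0.
  by rewrite -(EFin_Ex P (bm_cst _ _)) Ex_cst expr0 invr1.
have mexpN : measurable_fun setT (fun s : R => expR (- s)).
  by do 2 apply: measurableT_comp => //.
transitivity (\int[P]_w (1 * expR (- gaps n.+1 w))%:E)%E.
  by apply: eq_integral => w _; rewrite mul1r.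
rewrite (@integral_gap _ _ _ _ _ _ _ hXE n (cst 1) (fun s => expR (- s)))//.
transitivity (\int[P]_w ((2^-1)%:E * (expR (- gaps n w))%:E))%E.
  apply: eq_integral => w _; rewrite mul1e muleC.
  transitivity (\int[lebesgue_measure]_(s in `[0%R, +oo[)
      ((expR (- gaps n w) / 2)%:E * (exponential_pdf 2 s)%:E))%E.
    apply: eq_integral => s; rewrite inE/= in_itv/= andbT => s0.
    rewrite exponential_pdfE// -EFinM opprD -!expRD; congr EFin.
    rewrite mulrA -[_ / 2 * 2]mulrA mulVf// mulr1 -expRD; congr expR; ring.
  rewrite ge0_integralZl//.
  - rewrite EFinM -muleA; congr (_ * _)%E.
    rewrite -[RHS]mule1 -(@integral_exponential_pdf R 2)//; congr (_ * _)%E.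
    rewrite [LHS]integral_mkcond; apply: eq_integral => s _; rewrite patchE.
    case: ifPn => //; rewrite notin_setE/= in_itv/= andbT => /negP; rewrite -ltNge => s0.
    by rewrite lt0_exponential_pdf.
  - by apply/measurable_EFinP/measurable_funTS; exact: measurable_exponential_pdf.
  - by move=> s _; rewrite lee_fin exponential_pdf_ge0.
rewrite ge0_integralZl//.
- by rewrite IH -EFinM exprS invfM.
- by apply/measurable_EFinP; apply: (measurableT_comp mexpN); exact: measurable_gap_sum.
Qed.

Lemma ae_gap_sum_unbounded t : {ae P, forall w, exists n, t < gaps n w}.
Proof.
pose A n := [set w | gaps n w <= t].
have mA n : measurable (A n).
  rewrite (_ : A n = gaps n @^-1` `]-oo, t]%classic).
    by rewrite -[X in measurable X]setTI; exact: measurable_gap_sum.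
  by apply/seteqP; split => w; rewrite /A /= in_itv.
exists (\bigcap_n A n); split.
- exact: bigcapT_measurable.
- have PA n : (P (\bigcap_n A n) <= (expR t * 2 ^- n)%:E)%E.
    apply: (@le_trans _ _ (P (A n))).
      by apply: le_measure; rewrite ?inE//; [exact: bigcapT_measurable|exact: bigcap_inf].
    have mexp : measurable_fun setT (fun w => (expR (- gaps n w))%:E).
      apply/measurable_EFinP; do 2 apply: measurableT_comp => //.
      exact: measurable_gap_sum.
    rewrite EFinM -mean_exp_gap_sum -ge0_integralZl//.
      have -> : P (A n) = (\int[P]_w (\1_(A n) w)%:E)%E by rewrite integral_indic// setIT.
      apply: ge0_le_integral => //.
      - by apply/measurable_EFinP; exact: measurable_indic.
      - exact: measurable_funeM.
      - move=> w _; rewrite -EFinM lee_fin indicE.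
        case: (boolP (w \in A n)) => [|_]; last by rewrite mulr_ge0 ?expR_ge0.
        by rewrite inE /A/= => wt; rewrite -expRD -expR0 ler_expR subr_ge0.
  have mI : measurable (\bigcap_n A n) by exact: bigcapT_measurable.
  have fI : P (\bigcap_n A n) \is a fin_num by exact: fin_num_measure.
  apply/eqP; rewrite -(fineK fI); apply/eqP; congr EFin.
  set x := fine _; apply/eqP; rewrite eq_le fine_ge0 ?andbT ?measure_ge0//.
  rewrite leNgt; apply/negP => x0.
  have := PA (Num.truncn (expR t / x)); rewrite -(fineK fI) lee_fin -/x leNgt => /negP; apply.
  rewrite ltr_pdivrMr ?exprn_gt0// mulrC -ltr_pdivrMr//.
  apply: (lt_le_trans (truncnS_gt _)).
  by rewrite -natrX ler_nat ltn_expl.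
- move=> w /= nex n _; rewrite /A/=; rewrite leNgt; apply/negP => tn.
  by apply: nex; exists n.
Qed.

Lemma ae_regular : {ae P, forall w, regular w}.
Proof.
have h1 := ae_foralln ae_gap_ge0.
have h2 : {ae P, forall w, forall m : nat, exists n, m%:R < gaps n w}.
  by apply: ae_foralln => m; exact: ae_gap_sum_unbounded.
apply: filterS2 h1 h2 => w w1 w2; split => // t.
have [n nt] := w2 (Num.truncn t).+1; exists n.
exact: lt_trans (truncnS_gt _) nt.
Qed.

Lemma regular_gap_sum_homo w m n : regular w -> (m <= n)%N ->
  gaps m w <= gaps n w.
Proof.
move=> [w0 _] /subnKC <-; elim: (n - m)%N => [|k IH]; first by rewrite addn0.
by rewrite (le_trans IH)// addnS [leRHS]big_ord_recr/= lerDl.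
Qed.

Definition lands k (a b : R) n w := [&& a < gaps n.+1 w, gaps n.+1 w <= b & X n w == k].

(** The detour through the series makes the count measurable on all outcomes,
    also where it is infinite and gets the value [0]. *)
Definition ball_count k a b w : nat :=
  Num.truncn (fine (\sum_(0 <= n <oo) ((lands k a b n w)%:R : R)%:E)%E).

Lemma lands_late w k a b n m : regular w -> b < gaps n w -> (n <= m)%N ->
  lands k a b m w = false.
Proof.
move=> rw bn nm; apply/negbTE; rewrite /lands !negb_and -!ltNge.
by rewrite (lt_le_trans bn) ?orbT//; apply: regular_gap_sum_homo => //; exact: leqW.
Qed.

Lemma series_lands w k a b n : regular w -> b < gaps n w ->
  (\sum_(0 <= i <oo) ((lands k a b i w)%:R : R)%:E =
   ((\sum_(i < n) lands k a b i w)%N%:R)%:E)%E.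
Proof.
move=> rw bn; rewrite (nneseries_split 0 n)//.
rewrite add0n eseries0 ?adde0; last first.
  by move=> i ni _; rewrite (lands_late k a rw bn ni).
by rewrite big_mkord sumEFin natr_sum.
Qed.

Lemma ball_countE w k a b n : regular w -> b < gaps n w ->
  ball_count k a b w = (\sum_(i < n) lands k a b i w)%N.
Proof. by move=> rw bn; rewrite /ball_count (series_lands k a rw bn)/= natrK. Qed.

Lemma measurable_lands k a b n :
  measurable_fun setT (fun w => ((lands k a b n w)%:R : R)).
Proof.
have -> : (fun w => ((lands k a b n w)%:R : R)) =
  \1_((gaps n.+1 @^-1` `]a, b]%classic) `&` (X n @^-1` [set k])).
  apply/funext => w; rewrite indicE in_setI /lands andbA.
  have -> : (w \in gaps n.+1 @^-1` `]a, b]%classic) = (a < gaps n.+1 w <= b).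
    by apply/idP/idP; rewrite inE/= in_itv.
  have -> : (w \in X n @^-1` [set k]) = (X n w == k) by apply/idP/eqP; rewrite inE.
  by [].
apply: measurable_indic; apply: measurableI; last exact: measurable_funPTI.
by rewrite -[X in measurable X]setTI; exact: measurable_gap_sum.
Qed.

Lemma measurable_series_lands k a b : measurable_fun setT
  (fun w => \sum_(0 <= n <oo) ((lands k a b n w)%:R : R)%:E)%E.
Proof.
apply: ge0_emeasurable_sum => [n w _ _|n _]; first by rewrite lee_fin.
by apply/measurable_EFinP; exact: measurable_lands.
Qed.

Lemma measurable_ball_count k a b : measurable_fun setT (ball_count k a b).
Proof.
apply: (measurableT_comp (@measurable_truncn R)).
apply: (measurableT_comp (fine_measurable measurableT)).
exact: measurable_series_lands.
Qed.

Lemma bm_ball_count k a b (f : nat -> R) : (exists M, forall n, `|f n| <= M) ->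
  bounded_measurable (fun w => f (ball_count k a b w)).
Proof.
move=> [M fM]; split; last by exists M => w.
by apply: (measurableT_comp _ (measurable_ball_count k a b)).
Qed.

End ball_counts.

Lemma expr01_bounded (R : realType) (z : R) : 0 <= z <= 1 -> exists M, forall n, `|z ^+ n| <= M.
Proof.
move=> /andP[z0 z1]; exists 1 => n.
by rewrite ger0_norm ?exprn_ge0// exprn_ile1.
Qed.

Section independent_boxes.
Context d (T : measurableType d) (R : realType) (P : probability T R).
Variables (p : nat -> R) (X : nat -> {RV P >-> nat}) (E : nat -> {RV P >-> R}).
Hypothesis hXE : poissonized_karlin p X E.

Local Notation gaps := (gap_sum E).
Local Notation Ex f := (Rintegral P setT f).
Local Notation ball_count := (ball_count X E).

Lemma bm_expr_ball_count (z : R) k a b : 0 <= z <= 1 ->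
  bounded_measurable (fun w => z ^+ ball_count k a b w).
Proof. by move=> z01; apply: bm_ball_count; exact: expr01_bounded. Qed.

(** This is the limit of [integral_marks] as the number of balls tends to infinity:
    for a regular outcome the cells have eventually nothing in store, and the
    marks have multiplied up to powers of the [z c]. *)
Lemma mean_prod_expr_ball_count m (kk : nat -> nat) (aa bb z : nat -> R) :
  (forall c, 0 <= z c <= 1) -> (forall c, aa c <= bb c) ->
  (forall c c' s k, (c < m)%N -> (c' < m)%N ->
    in_cell kk aa bb c s k -> in_cell kk aa bb c' s k -> c = c') ->
  Ex (fun w => \prod_(c < m) z c ^+ ball_count (kk c) (aa c) (bb c) w) =
  \prod_(c < m) expR (- (p (kk c) * overlap (aa c) (bb c) 0 * (1 - z c))).
Proof.
move=> z01 aabb dis.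
pose G w := \prod_(c < m) z c ^+ ball_count (kk c) (aa c) (bb c) w.
pose H n w := marks X E m kk aa bb z n w *
  expR (- future m (thinning p kk z) aa bb (gaps n w)).
have bG : bounded_measurable G.
  by apply: bm_prod => c _; exact: bm_expr_ball_count.
have th0 c : 0 <= thinning p kk z c by apply: (thinning_ge0 hXE).
have mH n : measurable_fun setT (H n).
  apply: measurable_funM.
    apply: (@measurable_fun_others _ _ _ _ X E (inl n)).
    apply: measurable_others_marks => // i ni.
    by apply: contraTneq ni => -[<-]; rewrite ltnn.
  do 2 apply: measurableT_comp => //.
  by apply: measurableT_comp; [exact: measurable_future|exact: measurable_gap_sum].
have H01 n w : 0 <= H n w <= 1.
  rewrite mulr_ge0 ?marks_ge0 ?expR_ge0//=.
  rewrite -[leRHS]mulr1 ler_pM ?marks_ge0 ?expR_ge0 ?marks_le1//.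
  by rewrite expR_le1 oppr_le0 future_ge0.
have HG w : regular E w -> H n w @[n --> \oo] --> G w.
  move=> rw; pose b := \sum_(c < m) `|bb c|.
  have [n0 n0b] := rw.2 b.
  have late c n : (c < m)%N -> (n0 <= n)%N -> bb c < gaps n w.
    move=> cm n0n; apply: (lt_le_trans _ (regular_gap_sum_homo rw n0n)).
    apply: le_lt_trans n0b; apply: (le_trans (ler_norm _)).
    by rewrite /b (bigD1 (Ordinal cm))//= lerDl sumr_ge0.
  apply: cvg_near_cst; exists n0 => // n /= n0n.
  rewrite /H /G.
  have -> : future m (thinning p kk z) aa bb (gaps n w) = 0.
    apply: big1 => c _; rewrite /overlap.
    have bn := late c n (ltn_ord c) n0n.
    rewrite !max_l ?subrr ?mulr0// subr_le0 ltW//.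
    exact: le_lt_trans (aabb c) bn.
  rewrite oppr0 expR0 mulr1 /marks /mark exchange_big/=.
  apply: eq_bigr => c _; rewrite prodrXr; congr (_ ^+ _).
  rewrite (ball_countE X (kk c) (aa c) rw (late c n (ltn_ord c) n0n)).
  by apply: eq_bigr => i _; rewrite /in_cell /lands andbA.
have mean n : Ex (H n) = expR (- future m (thinning p kk z) aa bb 0).
  by rewrite /Rintegral (integral_marks hXE z01 aabb dis n).
have : Ex G = expR (- future m (thinning p kk z) aa bb 0).
  have [_ _ cvgG] : [/\ P.-integrable setT (EFin \o G),
      [sequence \int[P]_(x in setT) `|(H n x)%:E - (G x)%:E|]_n @ \oo --> 0 &
      [sequence \int[P]_(x in setT) (H n x)%:E]_n @ \oo --> \int[P]_(x in setT) (G x)%:E]%E.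
    apply: (@dominated_convergence _ _ _ _ _ _ (fun n w => (H n w)%:E) _ (cst 1%E)) => //.
    - by move=> n; exact/measurable_EFinP.
    - by apply/measurable_EFinP; case: bG.
    - apply: filterS (ae_regular hXE) => w rw _.
      by apply: cvg_EFin; [exact: nearW|exact: HG].
    - exact: (finite_measure_integrable_cst P 1 measurableT).
    - apply: nearW => w n _; rewrite /= lee_fin ger0_norm; by case/andP: (H01 n w).
  rewrite /Rintegral; have -> : (\int[P]_w (G w)%:E = (expR (- future m (thinning p kk z) aa bb 0))%:E)%E.
    apply/esym/(cvg_unique _ _ cvgG) => //.
    rewrite (_ : (fun _ => _) = cst (expR (- future m (thinning p kk z) aa bb 0))%:E); first exact: cvg_cst.
    by apply/funext => n /=; rewrite (integral_marks hXE z01 aabb dis n).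
  by [].
move=> ->; rewrite /future -sumrN expR_sum; apply: eq_bigr => c _.
by rewrite /thinning; congr expR; ring.
Qed.

End independent_boxes.

(** * Crossings of a level by independent boxes *)

(** The probability that a Poisson variable of mean [x] is at least [j]. *)
Definition poisson_tail (R : realType) (j : nat) (x : R) : R :=
  1 - \sum_(i < j) expR (- x) * (x ^+ i / i`!%:R).

Section poisson_test.
Context d (T : measurableType d) (R : realType) (P : probability T R).
Local Notation Ex f := (Rintegral P setT f).
Local Notation bm := bounded_measurable.
Implicit Types (W : T -> R) (M N : T -> nat).

Lemma bm_nat_test M (f : nat -> R) : measurable_fun setT M ->
  (exists K, forall n, `|f n| <= K) -> bm (fun w => f (M w)).
Proof.
by move=> mM [K fK]; split; [exact: (measurableT_comp _ mM)|exists K => w].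
Qed.

Lemma bool_natr_bounded (Q : pred nat) : exists K : R, forall n, `|(Q n)%:R| <= K.
Proof. by exists 1 => n; case: (Q n); rewrite ?normr1 ?normr0. Qed.

Lemma sum_eqn_natr (m n : nat) (f : nat -> R) :
  \sum_(i < n) (m == i)%:R * f i = (m < n)%:R * f m.
Proof.
have [mn|nm] := ltnP m n.
  rewrite (bigD1 (Ordinal mn))//= eqxx big1 ?addr0// => i im.
  suff -> : (m == i) = false by rewrite mul0r.
  by apply: contraNF im => /eqP mi; apply/eqP/val_inj.
by rewrite big1 ?mul0r// => i _; rewrite gtn_eqF ?mul0r//; exact: leq_trans nm.
Qed.

Lemma measurable_addn M N : measurable_fun setT M -> measurable_fun setT N ->
  measurable_fun setT (fun w => (M w + N w)%N).
Proof.
move=> mM mN.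
have h : measurable_fun setT (fun z : T * nat => (M z.1 + z.2)%N).
  apply: (@measurable_fun_nat_param _ _ _ _ (fun w b => (M w + b)%N)) => k.
  exact: (measurableT_comp (f := fun a : nat => (a + k)%N) _ mM).
exact: (measurableT_comp h (measurable_fun_pair (@measurable_id _ _ setT) mN)).
Qed.

(** Both sides are the coefficients of the generating function, by
    [expansion_unique]; the weight [W] stands for what happens in the other boxes,
    so that the lemma applies to one box at a time. *)
Lemma mean_weight_pmf W M (C lam : R) : bm W -> measurable_fun setT M -> 0 <= lam ->
  (forall z, 0 <= z <= 1 -> Ex (fun w => W w * z ^+ M w) = C * expR (- (lam * (1 - z)))) ->
  forall a, Ex (fun w => W w * (M w == a)%:R) = C * (expR (- lam) * (lam ^+ a / a`!%:R)).
Proof.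
move=> bW mM lam0 gf.
have bE a : bm (fun w => W w * (M w == a)%:R).
  by apply: bmM => //; apply: (bm_nat_test mM (bool_natr_bounded (pred1 a))).
have [K WK] := bW.2.
apply: (@expansion_unique _ (fun z => Ex (fun w => W w * z ^+ M w))) => n.
- exists K => z z01; have /andP[z0 z1] := z01.
  have bz : bm (fun w => W w * z ^+ M w).
    by apply: bmM => //; apply: (bm_nat_test mM); exact: expr01_bounded.
  have bs : bm (fun w => \sum_(i < n) W w * (M w == i)%:R * z ^+ i).
    by apply: bm_sum => i _; apply: bmM => //; exact: bm_cst.
  have -> : \sum_(i < n) Ex (fun w => W w * (M w == i)%:R) * z ^+ i =
      Ex (fun w => \sum_(i < n) W w * (M w == i)%:R * z ^+ i).
    rewrite Ex_sum; last by move=> i; apply: bmM => //; exact: bm_cst.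
    apply: eq_bigr => i _; rewrite mulrC -(ExZ P (z ^+ i) (bE i)).
    by apply: eq_Rintegral => w _; rewrite mulrC.
  rewrite -(ExB P bz bs); apply: (le_trans (norm_Ex P (bmB bz bs))).
  rewrite -[leRHS](Ex_cst P); apply: le_Ex.
  + split; first by apply: measurableT_comp => //; case: (bmB bz bs).
    by have [_ [L hL]] := bmB bz bs; exists L => w; rewrite normr_id.
  + exact: bm_cst.
  move=> w; under eq_bigr do rewrite -mulrA.
  rewrite -mulr_sumr -mulrBr normrM ler_pM// ler_norml.
  rewrite sum_eqn_natr; have [Mn|nM] := ltnP (M w) n.
    by rewrite mul1r subrr oppr_le0 exprn_ge0.
  rewrite mul0r subr0.
  rewrite (le_trans _ (exprn_ge0 _ z0)) ?oppr_le0 ?exprn_ge0//=.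
  by rewrite -(subnKC nM) exprD ler_piMr ?exprn_ge0// exprn_ile1.
- exists (`|C| * expR (- lam) * (lam ^+ n / n`!%:R) * expR lam) => z z01; have /andP[z0 z1] := z01.
  rewrite gf//.
  have -> : C * expR (- (lam * (1 - z))) -
      \sum_(i < n) C * (expR (- lam) * (lam ^+ i / i`!%:R)) * z ^+ i =
      C * expR (- lam) * (expR (lam * z) - \sum_(i < n) (lam * z) ^+ i / i`!%:R).
    have -> : C * expR (- (lam * (1 - z))) = C * expR (- lam) * expR (lam * z).
      by rewrite -mulrA -expRD; congr (_ * expR _); ring.
    rewrite mulrBr mulr_sumr; congr (_ - _).
    by apply: eq_bigr => i _; rewrite exprMn; ring.
  rewrite !normrM [ `|expR _| ]ger0_norm ?expR_ge0//.
  apply: (@le_trans _ _ (`|C| * expR (- lam) * ((lam * z) ^+ n / n`!%:R * expR (lam * z)))).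
    rewrite ler_wpM2l ?mulr_ge0 ?expR_ge0//.
    by apply: (le_trans (expR_taylor _ _)); rewrite ger0_norm// mulr_ge0.
  rewrite exprMn.
  have e1 : expR (lam * z) <= expR lam by rewrite ler_expR ler_piMr.
  set c := `|C| * _; have c0 : 0 <= c by rewrite mulr_ge0 ?expR_ge0.
  rewrite (_ : c * (lam ^+ n * z ^+ n / n`!%:R * expR (lam * z)) =
    c * (lam ^+ n / n`!%:R) * z ^+ n * expR (lam * z)); last by ring.
  rewrite (_ : c * (lam ^+ n / n`!%:R) * expR lam * z ^+ n =
    c * (lam ^+ n / n`!%:R) * z ^+ n * expR lam); last by ring.
  by rewrite ler_wpM2l// !mulr_ge0 ?exprn_ge0 ?invr_ge0.
Qed.

Lemma mean_weight_lt W M (C lam : R) j : bm W -> measurable_fun setT M -> 0 <= lam ->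
  (forall z, 0 <= z <= 1 -> Ex (fun w => W w * z ^+ M w) = C * expR (- (lam * (1 - z)))) ->
  Ex (fun w => W w * (M w < j)%:R) = C * (1 - poisson_tail j lam).
Proof.
move=> bW mM lam0 gf.
have bE a : bm (fun w => W w * (M w == a)%:R).
  by apply: bmM => //; apply: (bm_nat_test mM (bool_natr_bounded (pred1 a))).
transitivity (Ex (fun w => \sum_(a < j) W w * (M w == a)%:R)).
  apply: eq_Rintegral => w _; rewrite -mulr_sumr; congr (_ * _).
  have := sum_eqn_natr (M w) j (fun=> 1); rewrite mulr1 => <-.
  by apply: eq_bigr => i _; rewrite mulr1.
rewrite Ex_sum//; under eq_bigr do rewrite (mean_weight_pmf bW mM lam0 gf).
by rewrite -mulr_sumr /poisson_tail; congr (_ * _); ring.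
Qed.

(** A box with [a] balls by the first time and [b] more by the second one passes
    the level [j] in between. *)
Definition crosses j (a b : nat) := (a < j <= a + b)%N.

Lemma mean_weight_crosses W M N (C lam mu : R) j : bm W ->
  measurable_fun setT M -> measurable_fun setT N -> 0 <= lam -> 0 <= mu ->
  (forall z z', 0 <= z <= 1 -> 0 <= z' <= 1 ->
    Ex (fun w => W w * (z ^+ M w * z' ^+ N w)) =
    C * (expR (- (lam * (1 - z))) * expR (- (mu * (1 - z'))))) ->
  Ex (fun w => W w * (crosses j (M w) (N w))%:R) =
  C * (poisson_tail j (lam + mu) - poisson_tail j lam).
Proof.
move=> bW mM mN lam0 mu0 gf.
have mMN : measurable_fun setT (fun w => (M w + N w)%N) by exact: measurable_addn.
have blt (L : T -> nat) : measurable_fun setT L -> bm (fun w => W w * (L w < j)%:R).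
  move=> mL; apply: bmM => //.
  by apply: (bm_nat_test mL (bool_natr_bounded (fun n => n < j)%N)).
have -> : Ex (fun w => W w * (crosses j (M w) (N w))%:R) =
    Ex (fun w => W w * (M w < j)%:R) - Ex (fun w => W w * (M w + N w < j)%:R).
  rewrite -ExB; [|exact: blt|exact: blt].
  apply: eq_Rintegral => w _; rewrite -mulrBr; congr (_ * _); rewrite /crosses.
  have [MNj|jMN] := ltnP (M w + N w) j; last by rewrite andbT subr0.
  by rewrite andbF (leq_ltn_trans (leq_addr _ _) MNj) subrr.
rewrite (mean_weight_lt (C := C) (lam := lam))//; last first.
  move=> z z01; have := gf z 1 z01; rewrite ler01 lexx => /(_ isT).
  rewrite subrr mulr0 oppr0 expR0 mulr1 => <-.
  by apply: eq_Rintegral => w _; rewrite expr1n mulr1.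
rewrite (mean_weight_lt (C := C) (lam := lam + mu))//; first by ring.
  exact: addr_ge0.
move=> z z01; rewrite mulrDl opprD expRD -gf//.
by apply: eq_Rintegral => w _; rewrite exprD.
Qed.

End poisson_test.

Lemma prod_pairs (R : comPzSemiRingType) n (F : nat -> R) :
  \prod_(c < n.*2) F c = \prod_(k < n) (F k.*2 * F k.*2.+1).
Proof.
elim: n => [|n IH]; first by rewrite !big_ord0.
by rewrite doubleS !big_ord_recr/= IH mulrA.
Qed.

Section box_crossings.
Context d (T : measurableType d) (R : realType) (P : probability T R).
Variables (p : nat -> R) (X : nat -> {RV P >-> nat}) (E : nat -> {RV P >-> R}).
Hypothesis hXE : poissonized_karlin p X E.

Local Notation gaps := (gap_sum E).
Local Notation Ex f := (Rintegral P setT f).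
Local Notation ball_count := (ball_count X E).
Local Notation bm := bounded_measurable.

Variables (s t : nat -> R).
Hypothesis st : forall k, 0 <= s k <= t k.

(** The first interval starts at [-1] in order to contain the time [0]. *)
Let early k := ball_count k (-1) (s k).
Let late k := ball_count k (s k) (t k).

Let mean_prod_early_late n (z z' : nat -> R) :
  (forall k, 0 <= z k <= 1) -> (forall k, 0 <= z' k <= 1) ->
  Ex (fun w => \prod_(k < n) (z k ^+ early k w * z' k ^+ late k w)) =
  \prod_(k < n) (expR (- (p k * s k * (1 - z k))) *
                 expR (- (p k * (t k - s k) * (1 - z' k)))).
Proof.
move=> z01 z'01.
pose kk (c : nat) := c./2.
pose aa c := if odd c then s c./2 else -1.
pose bb c := if odd c then t c./2 else s c./2.
pose zz c := if odd c then z' c./2 else z c./2.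
have half2 k : (k.*2)./2 = k by exact: doubleK.
transitivity (Ex (fun w => \prod_(c < n.*2)
    zz c ^+ ball_count (kk c) (aa c) (bb c) w)).
  apply: eq_Rintegral => w _.
  rewrite (prod_pairs n (fun c => zz c ^+ ball_count (kk c) (aa c) (bb c) w)).
  by apply: eq_bigr => k _; rewrite /zz /kk /aa /bb /= odd_double/= ?half2 ?uphalf_double.
rewrite (mean_prod_expr_ball_count hXE).
- rewrite (prod_pairs n (fun c =>
    expR (- (p (kk c) * overlap (aa c) (bb c) 0 * (1 - zz c))))).
  apply: eq_bigr => k _; rewrite /zz /kk /aa /bb /= odd_double/= ?half2 ?uphalf_double.
  have /andP[s0 st'] := st k.
  have -> : overlap (-1) (s k) 0 = s k.
    by rewrite /overlap !subr0 max_r// max_l ?subr0// lerN10.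
  have -> : overlap (s k) (t k) 0 = t k - s k.
    by rewrite /overlap !subr0 !max_r// (le_trans s0).
  by [].
- by move=> c; rewrite /zz; case: ifP.
- move=> c; have /andP[s0 st'] := st c./2.
  by rewrite /aa /bb; case: ifP => // _; rewrite (le_trans _ s0)// lerN10.
- move=> c c' x k _ _; rewrite /in_cell /kk /aa /bb.
  move=> /andP[h1 /eqP ->] /andP[h2 /eqP e].
  rewrite -(odd_double_half c) -(odd_double_half c') -e; congr (_ + _)%N.
  move: h1 h2; rewrite e; case: (odd c); case: (odd c') => // /andP[l1 l2] /andP[l3 l4].
    by have := lt_le_trans l1 l4; rewrite ltxx.
  by have := lt_le_trans l3 l2; rewrite ltxx.
Qed.

Definition crossing_prob j k := poisson_tail j (p k * t k) - poisson_tail j (p k * s k).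

Let measurable_early k : measurable_fun setT (early k).
Proof. exact: measurable_ball_count. Qed.

Let measurable_late k : measurable_fun setT (late k).
Proof. exact: measurable_ball_count. Qed.

Let bm_gf (z z' : R) k : 0 <= z <= 1 -> 0 <= z' <= 1 ->
  bm (fun w => z ^+ early k w * z' ^+ late k w).
Proof. by move=> z01 z'01; apply: bmM; exact: bm_expr_ball_count. Qed.

Lemma bm_crosses j k : bm (fun w => (crosses j (early k w) (late k w))%:R : R).
Proof.
have mf : measurable_fun setT (fun w => crosses j (early k w) (late k w)).
  apply: (@measurableT_comp _ _ _ _ _ _ (fun z : nat * nat => crosses j z.1 z.2) _ (fun w => (early k w, late k w))).
    by apply: (measurable_fun_nat_param (h := crosses j)) => b.
  exact: measurable_fun_pair.
split; last by exists 1 => w; case: crosses; rewrite ?normr1 ?normr0.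
exact: (measurableT_comp (f := fun b : bool => b%:R : R) _ mf).
Qed.

(** Box by box, the generating functions of its two counts are exchanged for an
    affine function of the indicator of the crossing, the other boxes forming the
    weight in [mean_weight_crosses]. *)
Lemma mean_prod_crosses j n (y : nat -> R) :
  Ex (fun w => \prod_(k < n) (1 + y k * (crosses j (early k w) (late k w))%:R)) =
  \prod_(k < n) (1 + y k * crossing_prob j k).
Proof.
pose A i k z z' w : R := if (k < i)%N then 1 + y k * (crosses j (early k w) (late k w))%:R
  else z ^+ early k w * z' ^+ late k w.
pose B i k z z' : R := if (k < i)%N then 1 + y k * crossing_prob j k
  else expR (- (p k * s k * (1 - z))) * expR (- (p k * (t k - s k) * (1 - z'))).
have bA i k z z' : 0 <= z <= 1 -> 0 <= z' <= 1 -> bm (A i k z z').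
  move=> z01 z'01; rewrite /A; case: (k < i)%N; last exact: bm_gf.
  by apply: bmD; [exact: bm_cst|apply: bmM; [exact: bm_cst|exact: bm_crosses]].
suff main i (z z' : nat -> R) : (i <= n)%N ->
    (forall k, 0 <= z k <= 1) -> (forall k, 0 <= z' k <= 1) ->
    Ex (fun w => \prod_(k < n) A i k (z k) (z' k) w) =
    \prod_(k < n) B i k (z k) (z' k).
  have := main n (cst 1) (cst 1) (leqnn _).
  rewrite /cst/= ler01 lexx => /(_ (fun=> isT) (fun=> isT)).
  rewrite (eq_bigr (fun k : 'I_n => 1 + y k * crossing_prob j k)); last first.
    by move=> k _; rewrite /B ltn_ord.
  move=> <-; apply: eq_Rintegral => w _; apply: eq_bigr => k _.
  by rewrite /A ltn_ord.
elim: i z z' => [|i IH] z z' le_in z01 z'01.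
  by rewrite -mean_prod_early_late.
pose i0 := Ordinal le_in.
pose W w := \prod_(k < n | k != i0) A i k (z k) (z' k) w.
pose C := \prod_(k < n | k != i0) B i k (z k) (z' k).
have bW : bm W by apply: bm_prod => k _; exact: bA.
have ki (k : 'I_n) : k != i0 -> ((k < i.+1) = (k < i))%N.
  by move=> k0; rewrite ltnS leq_eqVlt; case: eqP => // ki; case/eqP: k0; exact/val_inj.
have -> : \prod_(k < n) B i.+1 k (z k) (z' k) = C * (1 + y i * crossing_prob j i).
  rewrite (bigD1 i0)//= mulrC {2}/B ltnS leqnn; congr (_ * _).
  by apply: eq_bigr => k k0; rewrite /B ki.
have gf x x' : 0 <= x <= 1 -> 0 <= x' <= 1 ->
    Ex (fun w => W w * (x ^+ early i w * x' ^+ late i w)) =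
    C * (expR (- (p i * s i * (1 - x))) * expR (- (p i * (t i - s i) * (1 - x')))).
  move=> x01 x'01.
  pose zx k := if k == i then x else z k.
  pose zx' k := if k == i then x' else z' k.
  have := IH zx zx' (ltnW le_in); rewrite /zx /zx'.
  move=> /(_ (fun k => ltac:(by case: eqP)) (fun k => ltac:(by case: eqP))).
  have off (k : 'I_n) : k != i0 -> (k == i :> nat) = false.
    by move=> k0; apply: contraNF k0 => /eqP ki0; apply/eqP/val_inj.
  rewrite [RHS](bigD1 i0)//= {1}/B ltnn !eqxx.
  rewrite [in RHS]mulrC (eq_bigr (fun k : 'I_n => B i k (z k) (z' k))); last first.
    by move=> k /off ->.
  rewrite -/C => <-; apply: eq_Rintegral => w _.
  rewrite (bigD1 i0)//= {1}/A ltnn !eqxx mulrC; congr (_ * _).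
  by apply: eq_bigr => k /off ->.
have WC : Ex W = C.
  have := gf 1 1; rewrite ler01 lexx => /(_ isT isT).
  rewrite subrr !mulr0 oppr0 expR0 !mulr1 => <-.
  by apply: eq_Rintegral => w _; rewrite !expr1n !mulr1.
transitivity (Ex (fun w => W w + y i * (W w * (crosses j (early i w) (late i w))%:R))).
  apply: eq_Rintegral => w _; rewrite (bigD1 i0)//= {1}/A ltnS leqnn.
  rewrite (eq_bigr (fun k : 'I_n => A i k (z k) (z' k) w)); last first.
    by move=> k k0; rewrite /A ki.
  by rewrite -/(W w); ring.
have bWc : bm (fun w => W w * (crosses j (early i w) (late i w))%:R).
  by apply: bmM => //; exact: bm_crosses.
rewrite ExD//; last by apply: bmM => //; exact: bm_cst.
rewrite (ExZ P _ bWc) WC.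
rewrite (mean_weight_crosses (C := C) (lam := p i * s i) (mu := p i * (t i - s i)))//.
- have -> : p i * s i + p i * (t i - s i) = p i * t i by ring.
  by rewrite /crossing_prob; ring.
- by rewrite mulr_ge0// ?(box_prob_ge0 hXE)//; case/andP: (st i).
- by rewrite mulr_ge0// ?(box_prob_ge0 hXE)// subr_ge0; case/andP: (st i).
Qed.

End box_crossings.

Section occupancy_indicators.
Context d (T : measurableType d) (R : realType) (P : probability T R).
Variables (p : nat -> R) (X : nat -> {RV P >-> nat}) (E : nat -> {RV P >-> R}).
Hypothesis hXE : poissonized_karlin p X E.

Local Notation gaps := (gap_sum E).
Local Notation Ex f := (Rintegral P setT f).
Local Notation ball_count := (ball_count X E).
Local Notation lands_on := (lands X E).
Local Notation regular := (regular E).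

Definition occupied j k t w := (j <= ball_count k (-1) t w)%N.

Lemma regular_lands_from_start w k t n : regular w ->
  lands_on k (-1) t n w = (gaps n.+1 w <= t) && (X n w == k).
Proof.
move=> rw; rewrite /lands (_ : -1 < _ = true)//.
by rewrite (lt_le_trans (ltrN10 R))// sumr_ge0// => i _; exact: rw.1.
Qed.

Lemma ball_count_add w k s t : regular w -> -1 <= s <= t ->
  ball_count k (-1) t w = (ball_count k (-1) s w + ball_count k s t w)%N.
Proof.
move=> rw /andP[s1 st]; have [n tn] := rw.2 t.
rewrite !(ball_countE _ _ _ rw tn) (ball_countE _ _ _ rw (le_lt_trans st tn)) -big_split/=.
apply: eq_bigr => i _; rewrite !regular_lands_from_start// /lands.
case: (X i w == k); rewrite ?andbF// !andbT.
have [Gs|sG] := leP (gaps i.+1 w) s; last by [].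
by rewrite (le_trans Gs st).
Qed.

Lemma crossesE w j k s t : regular w -> -1 <= s <= t ->
  ((crosses j (ball_count k (-1) s w) (ball_count k s t w))%:R : R) =
  (occupied j k t w)%:R - (occupied j k s w)%:R.
Proof.
move=> rw st; rewrite /crosses /occupied -(ball_count_add k rw st).
have : (ball_count k (-1) s w <= ball_count k (-1) t w)%N.
  by rewrite (ball_count_add k rw st) leq_addr.
move=> le_st; rewrite ltnNge; case: (leqP j (ball_count k (-1) s w)) => js /=.
  by rewrite (leq_trans js le_st) subrr.
by rewrite subr0.
Qed.

Lemma occupied_homo w j k s t : regular w -> -1 <= s <= t ->
  occupied j k s w -> occupied j k t w.
Proof.
by move=> rw st /leq_trans; apply; rewrite (ball_count_add k rw st) leq_addr.
Qed.

Lemma box_contentE w k t : regular w ->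
  box_content X E k t w = ((ball_count k (-1) t w)%:R)%:E.
Proof.
move=> rw; have [n tn] := rw.2 t.
rewrite (ball_countE _ _ _ rw tn) -(series_lands X k (-1) rw tn) /box_content counting_dirac.
apply: eq_eseriesr => i _; rewrite /dirac indicE; congr ((_ : bool)%:R%:E).
rewrite regular_lands_from_start//; apply/idP/idP.
  by rewrite inE/= => -[-> tt]; rewrite eqxx andbT.
by move=> /andP[tt /eqP Xk]; rewrite inE.
Qed.

Lemma occupied_box_content w j k t : regular w ->
  ((j%:R%:E <= box_content X E k t w)%E : bool) = occupied j k t w.
Proof. by move=> rw; rewrite box_contentE// lee_fin ler_nat. Qed.

(** Only finitely many balls are thrown by the time [t], hence only finitely many
    boxes are occupied. *)
Lemma occupancy_series w j t : regular w -> (0 < j)%N ->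
  exists N, forall n, (N <= n)%N ->
    occupancy X E j t w = \sum_(k < n) (occupied j k t w)%:R.
Proof.
move=> rw j0; have [n0 tn0] := rw.2 t.
pose N := (\max_(i < n0) X i w).+1; exists N => n Nn.
have empty k : (n <= k)%N -> occupied j k t w = false.
  move=> nk; rewrite /occupied (ball_countE _ _ _ rw tn0) big1 ?leqn0 ?gtn_eqF//.
  move=> i _; rewrite regular_lands_from_start//.
  suff -> : (X i w == k) = false by rewrite andbF.
  apply/negbTE; rewrite neq_ltn (_ : (X i w < k)%N)//.
  apply: leq_trans nk; apply: leq_trans Nn; rewrite ltnS.
  exact: (leq_bigmax_cond (F := fun i : 'I_n0 => X i w)).
rewrite /occupancy counting_dirac.
rewrite (eq_eseriesr (g := fun k => ((occupied j k t w)%:R : R)%:E)); last first.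
  move=> k _; rewrite /dirac indicE; congr ((_ : bool)%:R%:E).
  rewrite -(occupied_box_content j k t rw); apply/idP/idP; by rewrite inE.
rewrite (nneseries_split 0 n)//.
rewrite add0n eseries0 ?adde0; last by move=> i ni _; rewrite empty.
by rewrite big_mkord sumEFin.
Qed.

Lemma occupancy_homo w j s t : regular w -> (0 < j)%N -> -1 <= s <= t ->
  occupancy X E j s w <= occupancy X E j t w.
Proof.
move=> rw j0 st; have [N hN] := occupancy_series s rw j0.
have [N' hN'] := occupancy_series t rw j0.
rewrite (hN (maxn N N')) ?leq_maxl// (hN' (maxn N N')) ?leq_maxr//.
apply: ler_sum => k _; rewrite ler_nat.
have := @occupied_homo w j k s t rw st.
by case: (occupied j k s w) => // ->.
Qed.

Lemma measurable_box_content k t : measurable_fun setT (box_content X E k t).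
Proof.
rewrite /box_content; under eq_fun do rewrite counting_dirac.
apply: ge0_emeasurable_sum => [n w _ _|n _]; first by rewrite lee_fin.
apply/measurable_EFinP.
rewrite (_ : (fun _ => _) = \1_((X n @^-1` [set k]) `&` (gaps n.+1 @^-1` `]-oo, t]%classic))).
  apply: measurable_indic; apply: measurableI; first exact: measurable_funPTI.
  by rewrite -[X in measurable X]setTI; exact: measurable_gap_sum.
by apply/funext => w; rewrite !indicE; congr (_%:R).
Qed.

Lemma measurable_occupancy j t : measurable_fun setT (occupancy X E j t).
Proof.
rewrite /occupancy; apply: (measurableT_comp (fine_measurable measurableT)).
under eq_fun do rewrite counting_dirac.
apply: ge0_emeasurable_sum => [n w _ _|n _]; first by rewrite lee_fin.
apply/measurable_EFinP.
rewrite (_ : (fun _ => _) = \1_(box_content X E n t @^-1` `[j%:R%:E, +oo[%classic)).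
  apply: measurable_indic; rewrite -[X in measurable X]setTI.
  by apply: measurable_box_content => //; exact: emeasurable_itv.
apply/funext => w; rewrite !indicE; congr ((_ : bool)%:R).
apply/idP/idP; rewrite !inE/= in_itv/= ?andbT//.
Qed.

End occupancy_indicators.

(** * Sums of independent indicators *)

Section bernoulli_mgf.
Context (R : realType).
Implicit Types q h : R.

(** The mean of [expR (h * (D - q))], where [D] is [1] with probability [q] and [0]
    otherwise. *)
Definition bernoulli_mgf q h := expR (- (h * q)) * (1 + (expR h - 1) * q).

Let bernoulli_mgfE q h :
  bernoulli_mgf q h = (1 - q) * expR (- (h * q)) + q * expR (h * (1 - q)).
Proof.
rewrite /bernoulli_mgf mulrBr mulr1 expRD; ring.
Qed.

Let bernoulli_mgf_second_order q h : 0 <= q <= 1 -> `|h| <= 1 ->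
  `|bernoulli_mgf q h - (1 + q * (1 - q) * h ^+ 2 / 2)| <=
  q * (1 - q) * h ^+ 2 / 2 * `|h|.
Proof.
move=> /andP[q0 q1] h1.
have r0 : 0 <= 1 - q by rewrite subr_ge0.
have bound c : 0 <= c <= 1 -> forall x, `|x| = `|h| * c ->
    `|expR x - (1 + x + x ^+ 2 / 2)| <= `|h| * x ^+ 2 / 2.
  move=> /andP[c0 c1] x xE.
  have xh : `|x| <= `|h| by rewrite xE ler_piMr.
  apply: (le_trans (expR_second_order (le_trans xh h1))).
  by rewrite ler_wpM2r ?invr_ge0// exprS real_normK ?num_real// ler_wpM2r ?sqr_ge0.
have b1 := bound q _ (- (h * q)); have b2 := bound (1 - q) _ (h * (1 - q)).
rewrite q0 q1 normrN normrM (ger0_norm q0) in b1; have {}b1 := b1 isT erefl.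
rewrite r0 lerBlDr lerDl q0 normrM (ger0_norm r0) in b2; have {}b2 := b2 isT erefl.
rewrite bernoulli_mgfE.
set e1 := expR _ in b1 *; set e2 := expR _ in b2 *.
have -> : (1 - q) * e1 + q * e2 - (1 + q * (1 - q) * h ^+ 2 / 2) =
    (1 - q) * (e1 - (1 + - (h * q) + (- (h * q)) ^+ 2 / 2)) +
    q * (e2 - (1 + h * (1 - q) + (h * (1 - q)) ^+ 2 / 2)) by field.
apply: (le_trans (ler_normD _ _)); rewrite !normrM (ger0_norm q0) (ger0_norm r0).
apply: (@le_trans _ _ ((1 - q) * (`|h| * (- (h * q)) ^+ 2 / 2) +
   q * (`|h| * (h * (1 - q)) ^+ 2 / 2))).
  by rewrite lerD// ler_wpM2l.
by rewrite le_eqVlt; apply/orP; left; apply/eqP; field.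
Qed.

Lemma bernoulli_mgf_le q h : 0 <= q <= 1 -> `|h| <= 1 ->
  bernoulli_mgf q h <= expR (q * (1 - q) * (h ^+ 2 / 2 * (1 + `|h|))).
Proof.
move=> q01 h1; have := bernoulli_mgf_second_order q01 h1.
rewrite ler_distl => /andP[_ /le_trans]; apply.
apply: le_trans (expR_ge1Dx _); rewrite -addrA lerD2l le_eqVlt; apply/orP; left.
by apply/eqP; field.
Qed.

Let expR_sub_sqr (y : R) : 0 <= y <= 1 -> expR (y - y ^+ 2) <= 1 + y.
Proof.
move=> /andP[y0 y1]; have u0 : 0 <= y - y ^+ 2 by rewrite subr_ge0 expr2 ler_piMl.
have u1 : y - y ^+ 2 <= 1 by rewrite lerBlDr (le_trans y1)// lerDl sqr_ge0.
have := @expR_second_order R (y - y ^+ 2); rewrite (ger0_norm u0) => /(_ u1).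
rewrite ler_distl => /andP[_ /le_trans]; apply.
set u := y - y ^+ 2; have uy : u <= y by rewrite lerBlDr lerDl sqr_ge0.
have u2y2 : u ^+ 2 <= y ^+ 2 by rewrite lerXn2r ?nnegrE.
have u3u2 : u ^+ 3 <= u ^+ 2 by rewrite exprS ler_piMl// sqr_ge0.
have : u = y - y ^+ 2 by []. lra.
Qed.

(** The upper bound is [1 + x <= expR x]; for the lower one the loss is absorbed by
    [expR (y - y ^+ 2) <= 1 + y]. *)
Lemma bernoulli_mgf_ge q h : 0 <= q <= 1 -> `|h| <= 1 ->
  expR (q * (1 - q) * (h ^+ 2 / 2 * (1 - 2 * `|h|))) <= bernoulli_mgf q h.
Proof.
move=> q01 h1; have := bernoulli_mgf_second_order q01 h1.
rewrite ler_distl => /andP[+ _]; apply: le_trans.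
have /andP[q0 q1] := q01.
set s := q * (1 - q) * h ^+ 2 / 2.
have v0 : 0 <= q * (1 - q) by rewrite mulr_ge0 ?subr_ge0.
have s0 : 0 <= s by rewrite divr_ge0// mulr_ge0 ?sqr_ge0.
have v1 : q * (1 - q) <= 1 by rewrite -[leRHS]mulr1 ler_pM ?subr_ge0// lerBlDr lerDl.
have h2 : h ^+ 2 <= `|h| by rewrite -real_normK ?num_real// expr2 ler_piMl.
have sh : s <= `|h|.
  rewrite /s ler_pdivrMr// (@le_trans _ _ (h ^+ 2))//; first by rewrite ler_piMl ?sqr_ge0.
  by rewrite (le_trans h2)// ler_peMr// ler1n.
have a0 : 0 <= 1 - `|h| by rewrite subr_ge0.
pose y := s * (1 - `|h|).
have y0 : 0 <= y by rewrite mulr_ge0.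
have ys : y <= s by rewrite ler_piMr// lerBlDr lerDl.
have yh : y <= `|h| by exact: le_trans sh.
have y1 : y <= 1 by exact: le_trans h1.
have -> : 1 + s - s * `|h| = 1 + y by rewrite /y; ring.
apply: le_trans (expR_sub_sqr _); last by rewrite y0 y1.
rewrite ler_expR (_ : _ * (_ * _) = s * (1 - 2 * `|h|)); last by rewrite /s; field.
have y2 : y ^+ 2 <= s * `|h| by rewrite expr2 ler_pM.
rewrite (_ : s * (1 - 2 * `|h|) = y - s * `|h|); last by rewrite /y; ring.
by rewrite lerD2l lerN2.
Qed.

End bernoulli_mgf.

Section independent_indicators.
Context d (T : measurableType d) (R : realType) (P : probability T R).
Local Notation Ex f := (Rintegral P setT f).
Local Notation bm := bounded_measurable.
Implicit Types (D : nat -> T -> R) (q : nat -> R).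

(** Every function of an indicator is affine, so that these identities are
    equivalent to independence; they have the form that generating functions
    deliver, and that exponential moments use. *)
Record independent_indicators D q : Prop := {
  indicator_measurable : forall k, measurable_fun setT (D k);
  indicator_bool : forall k w, D k w = 0 \/ D k w = 1;
  indicator_mean : forall n (y : nat -> R),
    Ex (fun w => \prod_(k < n) (1 + y k * D k w)) = \prod_(k < n) (1 + y k * q k)
}.

Section family.
Variables (D : nat -> T -> R) (q : nat -> R).
Hypothesis DqI : independent_indicators D q.

Lemma bm_indicator k : bm (D k).
Proof.
split; first exact: indicator_measurable DqI k.
by exists 1 => w; have [->|->] := indicator_bool DqI k w; rewrite ?normr0 ?normr1.
Qed.

Let prod_at n k (kn : (k < n)%N) (f : nat -> R) :
  \prod_(i < n) (1 + (i == k :> nat)%:R * f i) = 1 + f k.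
Proof.
rewrite (bigD1 (Ordinal kn))//= eqxx mul1r big1 ?mulr1// => i ik.
suff -> : (i == k :> nat) = false by rewrite mul0r addr0.
by apply: contraNF ik => /eqP e; apply/eqP/val_inj.
Qed.

(** Taking all the [y i] but one equal to [0]. *)
Lemma mean_indicator k : Ex (D k) = q k.
Proof.
have := indicator_mean DqI k.+1 (fun i => (i == k)%:R).
rewrite (prod_at (ltnSn k)) => h.
have : Ex (fun w => 1 + D k w) = 1 + q k.
  by rewrite -h; apply: eq_Rintegral => w _; rewrite (prod_at (ltnSn k) (D ^~ w)).
by rewrite (ExD P (bm_cst _ _) (bm_indicator k)) Ex_cst => /addrI.
Qed.

Lemma indicator_prob01 k : 0 <= q k <= 1.
Proof.
rewrite -mean_indicator Ex_ge0/=; last first.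
  by move=> w; have [->|->] := indicator_bool DqI k w.
rewrite -[leRHS](Ex_cst P); apply: le_Ex; [exact: bm_indicator|exact: bm_cst|].
by move=> w; have [->|->] := indicator_bool DqI k w.
Qed.

Lemma mean_indicator_pair k l : k != l -> Ex (fun w => D k w * D l w) = q k * q l.
Proof.
move=> kl.
pose n := (maxn k l).+1; have kn : (k < n)%N by rewrite ltnS leq_maxl.
have ln : (l < n)%N by rewrite ltnS leq_maxr.
have two (f : nat -> R) : \prod_(i < n) (1 + ((i == k :> nat) || (i == l :> nat))%:R * f i) =
    (1 + f k) * (1 + f l).
  rewrite -(prod_at kn f) -(prod_at ln f) -big_split/=; apply: eq_bigr => i _.
  have [ik|ik] /= := eqVneq (i : nat) k; last by rewrite mul0r addr0 mul1r.
  by rewrite ik (negbTE kl) mul0r addr0 mulr1.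
have := indicator_mean DqI n (fun i => ((i == k) || (i == l))%:R).
rewrite two => h.
have bk := bm_indicator k; have bl := bm_indicator l; have bkl := bmM bk bl.
have : Ex (fun w => (1 + D k w) + (D l w + D k w * D l w)) = (1 + q k) * (1 + q l).
  by rewrite -h; apply: eq_Rintegral => w _; rewrite (two (D ^~ w)); ring.
rewrite (ExD P (bmD (bm_cst _ _) bk) (bmD bl bkl)) (ExD P (bm_cst _ _) bk) (ExD P bl bkl).
rewrite Ex_cst !mean_indicator => e.
have : Ex (fun w => D k w * D l w) = (1 + q k) * (1 + q l) - (1 + q k) - q l.
  by rewrite -e; ring.
by move=> ->; ring.
Qed.

Definition centered n w := \sum_(k < n) (D k w - q k).
Definition variance_sum n := \sum_(k < n) q k * (1 - q k).

Lemma bm_centered n : bm (centered n).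
Proof. by apply: bm_sum => k _; apply: bmB; [exact: bm_indicator|exact: bm_cst]. Qed.

Let Dsq k w : D k w * D k w = D k w.
Proof. by have [->|->] := indicator_bool DqI k w; rewrite ?mulr0 ?mulr1. Qed.

Lemma mean_centered_sqr n : Ex (fun w => centered n w ^+ 2) = variance_sum n.
Proof.
have bc k : bm (fun w => D k w - q k) by apply: bmB; [exact: bm_indicator|exact: bm_cst].
have cov k l : Ex (fun w => (D k w - q k) * (D l w - q l)) =
    if k == l then q k * (1 - q k) else 0.
  have bk := bm_indicator k; have bl := bm_indicator l; have bkl := bmM bk bl.
  have e : Ex (fun w => (D k w - q k) * (D l w - q l)) =
      Ex (fun w => D k w * D l w) - q k * q l.
    transitivity (Ex (fun w => (D k w * D l w - q l * D k w) - (q k * D l w - q k * q l))).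
      by apply: eq_Rintegral => w _; ring.
    have blk := bmM (bm_cst T (q l)) bk; have bkl' := bmM (bm_cst T (q k)) bl.
    rewrite (ExB P (bmB bkl blk) (bmB bkl' (bm_cst _ _))) (ExB P bkl blk).
    by rewrite (ExB P bkl' (bm_cst _ _)) (ExZ P _ bk) (ExZ P _ bl) Ex_cst !mean_indicator; ring.
  rewrite e; have [<-|kl] := eqVneq k l.
    by under eq_Rintegral do rewrite Dsq; rewrite mean_indicator; ring.
  by rewrite mean_indicator_pair// subrr.
have -> : Ex (fun w => centered n w ^+ 2) =
    Ex (fun w => \sum_(k < n) \sum_(l < n) (D k w - q k) * (D l w - q l)).
  apply: eq_Rintegral => w _; rewrite expr2 /centered mulr_suml.
  by apply: eq_bigr => k _; rewrite mulr_sumr.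
rewrite Ex_sum; last by move=> k; apply: bm_sum => l _; exact: bmM.
apply: eq_bigr => k _; rewrite Ex_sum; last by move=> l; exact: bmM.
under eq_bigr do rewrite cov.
rewrite (bigD1 k)//= eqxx big1 ?addr0// => i ik.
by rewrite eq_sym (negbTE (_ : (i : nat) != k)).
Qed.

(** Each factor [expR (h * (D k - q k))] is affine in the indicator, with a positive
    constant term that is factored out. *)
Lemma mean_exp_centered n h :
  Ex (fun w => expR (h * centered n w)) = \prod_(k < n) bernoulli_mgf (q k) h.
Proof.
pose c := \prod_(k < n) expR (- (h * q k)).
transitivity (Ex (fun w => c * \prod_(k < n) (1 + (expR h - 1) * D k w))).
  apply: eq_Rintegral => w _; rewrite /centered mulr_sumr expR_sum -big_split/=.
  apply: eq_bigr => k _; rewrite mulrBr expRD mulrC; congr (_ * _).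
  by have [->|->] := indicator_bool DqI k w; rewrite ?mulr0 ?expR0 ?mulr1; ring.
rewrite ExZ.
  by rewrite (indicator_mean DqI n (fun=> expR h - 1)) -big_split.
apply: bm_prod => k _; apply: bmD; first exact: bm_cst.
by apply: bmM; [exact: bm_cst|exact: bm_indicator].
Qed.

Lemma mean_exp_centered_le n h : `|h| <= 1 ->
  Ex (fun w => expR (h * centered n w)) <=
  expR (variance_sum n * (h ^+ 2 / 2 * (1 + `|h|))).
Proof.
move=> h1; rewrite mean_exp_centered /variance_sum mulr_suml expR_sum.
apply: ler_prod => k _; have q01 := indicator_prob01 k.
rewrite (bernoulli_mgf_le q01 h1) andbT.
by apply: le_trans (bernoulli_mgf_ge q01 h1); exact: expR_ge0.
Qed.

Lemma mean_exp_centered_ge n h : `|h| <= 1 ->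
  expR (variance_sum n * (h ^+ 2 / 2 * (1 - 2 * `|h|))) <=
  Ex (fun w => expR (h * centered n w)).
Proof.
move=> h1; rewrite mean_exp_centered /variance_sum mulr_suml expR_sum.
apply: ler_prod => k _; have q01 := indicator_prob01 k.
by rewrite expR_ge0/=; exact: bernoulli_mgf_ge.
Qed.

End family.

Lemma independent_indicators_restrict D q (I : pred nat) :
  independent_indicators D q ->
  independent_indicators (fun k w => (I k)%:R * D k w) (fun k => (I k)%:R * q k).
Proof.
move=> [mD D01 Dmean]; split.
- by move=> k; exact: measurable_funM.
- by move=> k w; case: (I k); rewrite ?mul1r ?mul0r//; left.
- move=> n y; have := Dmean n (fun k => y k * (I k)%:R).
  under [in X in _ = X -> _]eq_bigr do rewrite -mulrA.
  move=> <-; apply: eq_Rintegral => w _; apply: eq_bigr => k _.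
  by rewrite mulrA.
Qed.

End independent_indicators.

Section indicator_series.
Context d (T : measurableType d) (R : realType) (P : probability T R).
Local Notation Ex f := (Rintegral P setT f).
Local Notation bm := bounded_measurable.
Variables (D : nat -> T -> R) (q : nat -> R) (S : T -> R) (a v : R).
Hypothesis DqI : independent_indicators P D q.
Hypothesis mS : measurable_fun setT S.
Hypothesis DS : {ae P, forall w, \sum_(k < n) D k w @[n --> \oo] --> S w}.
Hypothesis qa : \sum_(k < n) q k @[n --> \oo] --> a.
Hypothesis qv : variance_sum q n @[n --> \oo] --> v.

Let D0 k w : 0 <= D k w.
Proof. by have [->|->] := indicator_bool DqI k w. Qed.

Let q0 k : 0 <= q k. Proof. by case/andP: (indicator_prob01 DqI k). Qed.

Let pq0 k : 0 <= q k * (1 - q k).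
Proof. by rewrite mulr_ge0 ?q0// subr_ge0; case/andP: (indicator_prob01 DqI k). Qed.

Lemma variance_sum_le n : variance_sum q n <= v.
Proof.
have nd : nondecreasing_seq (variance_sum q).
  by apply/nondecreasing_seqP => k; rewrite /variance_sum big_ord_recr/= lerDl.
rewrite -(cvg_lim (@Rhausdorff R) qv); apply: nondecreasing_cvgn_le => //.
by apply/cvg_ex; exists v.
Qed.

Let cD n w := \sum_(k < n) D k w.
Let cq n := \sum_(k < n) q k.

Let centeredE n w : centered D q n w = cD n w - cq n.
Proof. by rewrite /centered sumrB. Qed.

Let mcD n : measurable_fun setT (cD n).
Proof. by apply: measurable_sum => k; exact: indicator_measurable DqI k. Qed.

Let bcD n : bm (cD n).
Proof. by apply: bm_sum => k _; exact: (bm_indicator DqI). Qed.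

(** Fatou's lemma over the partial sums, where independence gives the bound. *)
Lemma mean_exp_series_le h : `|h| <= 1 ->
  (\int[P]_w (expR (h * (S w - a)))%:E <=
   (expR (v * (h ^+ 2 / 2 * (1 + `|h|))))%:E)%E.
Proof.
move=> h1.
pose f n w := (expR (h * centered D q n w))%:E.
have mf n : measurable_fun setT (f n).
  apply/measurable_EFinP; apply: measurableT_comp => //; apply: measurable_funM => //.
  by case: (bm_centered DqI n).
have mexp : measurable_fun setT (fun w => (expR (h * (S w - a)))%:E).
  by apply/measurable_EFinP; apply: measurableT_comp => //; apply: measurable_funM => //; apply: measurable_funB.
have -> : (\int[P]_w (expR (h * (S w - a)))%:E = \int[P]_w limn_einf (f ^~ w))%E.
  apply: ae_eq_integral => //.
    by apply: (measurableT_comp (f := -%E)) => //; apply: measurable_fun_limn_esup => n; exact: measurableT_comp.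
  apply: filterS DS => w Dw _ /=.
  have cv : f n w @[n --> \oo] --> (expR (h * (S w - a)))%:E.
    apply: cvg_EFin; first exact: nearW.
    have cc : h * centered D q n w @[n --> \oo] --> h * (S w - a).
      apply: cvgM; first exact: cvg_cst.
      under eq_fun do rewrite centeredE.
      exact: cvgB.
    exact: (cvg_comp _ _ cc (@continuous_expR R _)).
  rewrite is_cvg_limn_einfE; first by apply/esym/cvg_lim.
  by apply/cvg_ex; eexists; exact: cv.
apply: (le_trans (fatou _ _ _ _)) => //.
  by move=> n w _; rewrite lee_fin expR_ge0.
have bound n : (\int[P]_w f n w <= (expR (v * (h ^+ 2 / 2 * (1 + `|h|))))%:E)%E.
  have be : bm (fun w => expR (h * centered D q n w)).
    split; first by apply/measurable_EFinP; exact: mf.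
    have [M hM] := (bm_centered DqI n).2.
    exists (expR M) => w; rewrite ger0_norm ?expR_ge0// ler_expR.
    rewrite (le_trans (ler_norm _))// normrM (le_trans _ (hM w))// ler_piMl//.
  rewrite -(EFin_Ex P be) lee_fin (le_trans (mean_exp_centered_le DqI n h1))//.
  rewrite ler_expR ler_wpM2r ?variance_sum_le// mulr_ge0 ?divr_ge0 ?sqr_ge0//.
rewrite limn_einf_lim; apply: lime_le; first exact: is_cvg_einfs.
apply: nearW => n; apply: (le_trans _ (bound n)).
by apply: ereal_inf_lbound; exists n => /=.
Qed.

Let cq_ge0 n : 0 <= cq n. Proof. exact: sumr_ge0. Qed.

Let a_ge0 : 0 <= a.
Proof.
rewrite -(cvg_lim (@Rhausdorff R) qa); apply: limr_ge; first by apply/cvg_ex; exists a.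
exact: nearW.
Qed.

Let S0 : {ae P, forall w, 0 <= S w}.
Proof.
apply: filterS DS => w Dw; rewrite -(cvg_lim (@Rhausdorff R) Dw).
apply: limr_ge; first by apply/cvg_ex; exists (S w).
by apply: nearW => n; exact: sumr_ge0.
Qed.

(** Monotone convergence, the partial sums being nondecreasing. *)
Let limD (g : R -> R) : {in Num.nneg &, {homo g : x y / x <= y}} ->
  (forall x, 0 <= x -> 0 <= g x) -> continuous g -> measurable_fun setT g ->
  (fun n => (Ex (fun w => g (cD n w)))%:E) @ \oo --> (\int[P]_w (g (S w))%:E)%E.
Proof.
move=> gh g0 gc mg.
pose f n w := (g (cD n w))%:E.
have mf n : measurable_fun setT (f n).
  by apply/measurable_EFinP; exact: (measurableT_comp mg (mcD n)).
have f0 n w : (0 <= f n w)%E by rewrite lee_fin g0// sumr_ge0.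
have nd w : nondecreasing_seq (f ^~ w).
  apply/nondecreasing_seqP => n; rewrite lee_fin gh ?nnegrE ?sumr_ge0//.
  by rewrite /cD big_ord_recr/= lerDl.
have -> : (\int[P]_w (g (S w))%:E = \int[P]_w limn (f ^~ w))%E.
  apply: ae_eq_integral => //.
    by apply/measurable_EFinP; exact: (measurableT_comp mg mS).
    by apply: (emeasurable_fun_cvg f) => // w _; apply: ereal_nondecreasing_is_cvgn; exact: nd.
  apply: filterS DS => w Dw _ /=; apply/esym/cvg_lim => //.
  apply: cvg_EFin; first exact: nearW.
  exact: (cvg_comp _ _ Dw (gc (S w))).
have bg n : bm (fun w => g (cD n w)).
  split; first by apply/measurable_EFinP; exact: mf.
  have [M hM] := (bcD n).2; exists (g `|M|) => w.
  rewrite ger0_norm ?g0 ?sumr_ge0// gh ?nnegrE ?sumr_ge0//.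
  by rewrite (le_trans (ler_norm _))// (le_trans (hM w))// ler_norm.
under eq_fun do rewrite (EFin_Ex P (bg _)).
by apply: cvg_monotone_convergence => // w _; exact: nd.
Qed.

Lemma mean_series : (\int[P]_w (S w)%:E = a%:E)%E.
Proof.
have h := @limD id (fun _ _ _ _ => id) (fun _ => id) (fun x => cvg_id) (@measurable_id _ _ _).
apply: (cvg_unique _ h) => //.
apply: cvg_EFin; first exact: nearW.
rewrite (_ : (_ \o _) = cq)//; apply/funext => n /=.
rewrite Ex_sum; last by move=> k; exact: (bm_indicator DqI).
by apply: eq_bigr => k _; rewrite (mean_indicator DqI).
Qed.

Let mean_sqr : (\int[P]_w (S w ^+ 2)%:E = (v + a ^+ 2)%:E)%E.
Proof.
have h := @limD (fun x => x ^+ 2).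
have {}h : (fun n => (Ex (fun w => cD n w ^+ 2))%:E) @ \oo --> (\int[P]_w (S w ^+ 2)%:E)%E.
  apply: h.
  - by move=> x y x0 y0 xy; rewrite lerXn2r.
  - by move=> x _; rewrite sqr_ge0.
  - exact: exprn_continuous.
  - exact: exprn_measurable.
apply: (cvg_unique _ h) => //; apply: cvg_EFin; first exact: nearW.
rewrite (_ : (_ \o _) = fun n => variance_sum q n + cq n ^+ 2).
  apply: cvgD => //; rewrite expr2; under eq_fun do rewrite expr2.
  exact: cvgM.
apply/funext => n /=.
have bc := bm_centered DqI n; have bc2 := bmM bc bc.
have b2 := bmM (bm_cst T (2 * cq n)) bc.
transitivity (Ex (fun w => centered D q n w * centered D q n w +
    (2 * cq n * centered D q n w + cq n ^+ 2))).
  by apply: eq_Rintegral => w _; rewrite centeredE; ring.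
rewrite (ExD P bc2 (bmD b2 (bm_cst _ _))) (ExD P b2 (bm_cst _ _)) (ExZ P _ bc) Ex_cst.
under eq_Rintegral do rewrite -expr2.
rewrite (mean_centered_sqr DqI).
have -> : Ex (centered D q n) = 0.
  rewrite /centered Ex_sum; last by move=> k; apply: bmB; [exact: (bm_indicator DqI)|exact: bm_cst].
  apply: big1 => k _; rewrite (ExB P (bm_indicator DqI k) (bm_cst _ _)) Ex_cst.
  by rewrite (mean_indicator DqI) subrr.
by rewrite mulr0 add0r.
Qed.

Lemma expectation_series : ('E_P[S] = a%:E)%E.
Proof. by rewrite unlock mean_series. Qed.

Lemma variance_series : ('V_P[S] = v%:E)%E.
Proof.
rewrite /variance covariance.unlock expectation_series/= expectation.unlock.
have -> : (\int[P]_w (((S \- cst a) * (S \- cst a))%R w)%:E =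
    \int[P]_w ((S w - a) ^+ 2)%:E)%E.
  by apply: eq_integral => w _; rewrite expr2.
have mS2 : measurable_fun setT (fun w => (S w ^+ 2)%:E).
  by apply/measurable_EFinP; exact: measurable_funX.
have mSa : measurable_fun setT (fun w => ((S w - a) ^+ 2)%:E).
  by apply/measurable_EFinP; apply: measurable_funX; apply: measurable_funB.
have mA : measurable_fun setT (fun w => `|S w|) by exact: measurableT_comp.
have absS : {ae P, forall w, `|S w| = S w}.
  by apply: filterS S0 => w; exact: ger0_norm.
have eA : (\int[P]_w `|S w|%:E = a%:E)%E.
  rewrite -mean_series; apply: ae_eq_integral => //; [exact/measurable_EFinP|exact/measurable_EFinP|].
  by apply: filterS absS => w -> _.
have m2A : measurable_fun setT (fun w => (2 * a * `|S w|)%:E).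
  by apply/measurable_EFinP; exact: measurable_funM.
have e2A : (\int[P]_w (2 * a * `|S w|)%:E = (2 * a ^+ 2)%:E)%E.
  under eq_integral do rewrite EFinM.
  rewrite ge0_integralZl//.
  - by rewrite eA -EFinM; congr EFin; ring.
  - exact/measurable_EFinP.
  - by rewrite lee_fin mulr_ge0.
have key : (\int[P]_w ((S w - a) ^+ 2)%:E + (2 * a ^+ 2)%:E = (v + 2 * a ^+ 2)%:E)%E.
  rewrite -e2A.
  rewrite -ge0_integralD//; last 2 first.
  - by move=> w _; rewrite lee_fin sqr_ge0.
  - by move=> w _; rewrite lee_fin !mulr_ge0.
  transitivity (\int[P]_w ((S w ^+ 2)%:E + (a ^+ 2)%:E))%E.
    apply: ae_eq_integral => //.
    - exact: emeasurable_funD.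
    - exact: emeasurable_funD.
    - by apply: filterS absS => w -> _; rewrite -!EFinD; congr EFin; ring.
  rewrite ge0_integralD//; last 2 first.
  - by move=> w _; rewrite lee_fin sqr_ge0.
  - by move=> w _; rewrite lee_fin sqr_ge0.
  rewrite mean_sqr -(EFin_Ex P (bm_cst _ _)) Ex_cst -EFinD; congr EFin; ring.
have : (\int[P]_w ((S w - a) ^+ 2)%:E = (v + 2 * a ^+ 2)%:E - (2 * a ^+ 2)%:E)%E.
  by rewrite -key addeK.
by move=> ->; rewrite -EFinB addrK.
Qed.

End indicator_series.

(** * Gamma integrals *)

Section antiderivative.
Context (R : realType).
Notation mu := (@lebesgue_measure R).
Implicit Types (g G : R -> R) (a b x y : R).

Lemma integral_antiderivative g G a b : a <= b -> continuous g ->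
  (forall x, is_derive x (1 : R) G (g x)) ->
  (\int[mu]_(x in `[a, b]) (g x)%:E = (G b - G a)%:E)%E.
Proof.
move=> ab cg dG; move: ab; rewrite le_eqVlt => /predU1P[->|ab].
  by rewrite set_itv1 integral_set1 subrr.
have cG : continuous G.
  by move=> x; apply: differentiable_continuous; apply/derivable1_diffP; exact: ex_derive.
rewrite (@continuous_FTC2 _ g G)//.
- exact: continuous_subspaceT.
- split => //.
  + by apply: cvg_at_right_filter; exact: cG.
  + by apply: cvg_at_left_filter; exact: cG.
- by move=> x _; rewrite derive1E; exact: derive_val.
Qed.

Lemma integral_antiderivative0 g G x : 0 <= x -> continuous g ->
  (forall x, is_derive x (1 : R) G (g x)) -> G 0 = 0 ->
  (\int[mu]_(y in `]0%R, x]) (g y)%:E = (G x)%:E)%E.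
Proof.
move=> x0 cg dG G0.
rewrite integral_itv_obnd_cbnd; last first.
  by apply/measurable_EFinP/measurable_funTS; exact: continuous_measurable_fun.
by rewrite (integral_antiderivative x0 cg dG) G0 subr0.
Qed.

(* The half-line is exhausted by closed rays, where a change of variables holds. *)
Let pos_bigcup : `]0%R, +oo[%classic = \bigcup_n `[((n.+1%:R^-1)%R : R), +oo[%classic.
Proof.
apply/seteqP; split => x /=; rewrite ?in_itv/= ?andbT.
  move=> x0; exists (Num.truncn x^-1) => //=; rewrite in_itv/= andbT.
  rewrite -[leRHS]invrK lef_pV2 ?posrE ?invr_gt0//.
  exact/ltW/truncnS_gt.
by move=> [n _ /=]; rewrite in_itv/= andbT; apply: lt_le_trans.
Qed.

Let pos_nd : nondecreasing_seq (fun n => `[((n.+1%:R^-1)%R : R), +oo[%classic).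
Proof.
move=> m n mn; apply/subsetPset => x /=; rewrite !in_itv/= !andbT.
by apply: le_trans; rewrite lef_pV2 ?posrE// ler_nat.
Qed.

Lemma integral_double (G : R -> R) : {in `]0, +oo[, continuous G} ->
  (forall x, 0 < x -> 0 <= G x) -> measurable_fun (`]0, +oo[%classic : set R) G ->
  (\int[mu]_(x in `]0%R, +oo[) (G x)%:E =
   \int[mu]_(x in `]0%R, +oo[) (G (2 * x) * 2)%:E)%E.
Proof.
move=> cG G0 mG.
have sub n : `[((n.+1%:R^-1)%R : R), +oo[%classic `<=` `]0%R, +oo[%classic.
  by move=> x /=; rewrite !in_itv/= !andbT; apply: lt_le_trans.
have m2 : measurable_fun (`]0, +oo[%classic : set R) (fun x => G (2 * x) * 2).
  apply: measurable_funM => //.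
  apply: (measurable_comp (F := `]0, +oo[%classic : set R)) => //.
    move=> _ [x /= + <-]; rewrite !in_itv/= !andbT => x0; exact: mulr_gt0.
have h1 : (\int[mu]_(x in `[((n.+1%:R^-1 * 2)%R : R), +oo[) (G x)%:E)%E @[n --> \oo] -->
    (\int[mu]_(x in `]0%R, +oo[) (G x)%:E)%E.
  have -> : `]0%R, +oo[%classic = \bigcup_n `[((n.+1%:R^-1 * 2)%R : R), +oo[%classic.
    apply/seteqP; split => x /=; rewrite ?in_itv/= ?andbT.
      move=> x0; have : `]0%R, +oo[%classic (x / 2) by rewrite /= in_itv/= andbT divr_gt0.
      rewrite pos_bigcup => -[n _ /=]; rewrite in_itv/= andbT => nx.
      by exists n => //=; rewrite in_itv/= andbT -ler_pdivlMr.
    by move=> [n _ /=]; rewrite in_itv/= andbT; apply: lt_le_trans; rewrite mulr_gt0.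
  apply: ge0_nondecreasing_set_cvg_integral => //.
  - move=> m n mn; apply/subsetPset => x /=; rewrite !in_itv/= !andbT.
    by apply: le_trans; rewrite ler_pM2r// lef_pV2 ?posrE// ler_nat.
  - move=> n; apply/measurable_EFinP; apply: measurable_funS mG => // x /=.
    by rewrite !in_itv/= !andbT; apply: lt_le_trans; rewrite mulr_gt0.
  - move=> n x /=; rewrite in_itv/= andbT => nx; rewrite lee_fin G0//.
    by apply: lt_le_trans nx; rewrite mulr_gt0.
have h2 : (\int[mu]_(x in `[((n.+1%:R^-1)%R : R), +oo[) (G (2 * x) * 2)%:E)%E @[n --> \oo] -->
    (\int[mu]_(x in `]0%R, +oo[) (G (2 * x) * 2)%:E)%E.
  rewrite pos_bigcup; apply: ge0_nondecreasing_set_cvg_integral => //.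
  - move=> n; apply/measurable_EFinP; apply: measurable_funS m2 => //; exact: sub.
  - move=> n x /=; rewrite in_itv/= andbT => nx; rewrite lee_fin mulr_ge0// G0//.
    by rewrite mulr_gt0//; apply: lt_le_trans nx.
suff e n : (\int[mu]_(x in `[((n.+1%:R^-1 * 2)%R : R), +oo[) (G x)%:E =
    \int[mu]_(x in `[((n.+1%:R^-1)%R : R), +oo[) (G (2 * x) * 2)%:E)%E.
  apply: (cvg_unique _ h1) => //.
  rewrite (_ : (fun _ => _) = (fun n => \int[mu]_(x in `[((n.+1%:R^-1)%R : R), +oo[) (G (2 * x) * 2)%:E)%E)//.
  by apply/funext => n; exact: e.
pose F x : R := 2 * x.
have dF (x : R) : is_derive x (1 : R) F 2.
  by apply: is_derive_eq; rewrite /GRing.scale/= mulr1.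
have F'E : derive1 F = cst 2 by apply/funext => x; rewrite derive1E; exact: derive_val.
have := @increasing_ge0_integration_by_substitutiony R F G n.+1%:R^-1.
have -> : ((n.+1%:R^-1 * 2)%R = F n.+1%:R^-1)%R by rewrite /F mulrC.
rewrite F'E => ->.
- by apply: eq_integral => x _.
- by move=> x y _ _ xy; rewrite /F ltr_pM2l.
- by move=> x _; exact: cvg_cst.
- exact: is_cvg_cst.
- exact: is_cvg_cst.
- split => //; apply: cvg_at_right_filter; apply: cvgM; [exact: cvg_cst|exact: cvg_id].
- apply/cvgryPge => A; exists (A / 2); split; first by rewrite num_real.
  by move=> x; rewrite ltr_pdivrMr// /F mulrC => /ltW.
- apply/continuous_within_itvcyP; split.
    move=> x; rewrite in_itv/= andbT => nx; apply: cG.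
    by rewrite in_itv/= andbT; apply: lt_trans nx; rewrite /F mulr_gt0.
  apply: cvg_at_right_filter; apply: cG.
  by rewrite in_itv/= andbT /F mulr_gt0.
- move=> x; rewrite in_itv/= andbT => nx; apply: G0.
  by apply: lt_trans nx; rewrite /F mulr_gt0.
Qed.

Lemma continuous_powR_pos (s : R) : {in `]0, +oo[, continuous (fun x : R => x `^ s)}.
Proof.
move=> x; rewrite in_itv/= andbT => x0.
apply: differentiable_continuous; apply/derivable1_diffP.
by apply: derivable_powR; rewrite in_itv/= andbT.
Qed.

Lemma integral_powR_expR_lty (s : R) : 0 < s ->
  (\int[mu]_(x in `]0%R, +oo[) (x `^ (s - 1) * expR (- x))%:E < +oo)%E.
Proof.
move=> s0.
have mf (D : set R) : measurable D -> measurable_fun D (fun x : R => x `^ (s - 1) * expR (- x)).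
  move=> mD; apply: measurable_funTS; apply: measurable_funM.
    exact: measurable_powR.
  by do 2 apply: measurableT_comp => //.
have f0 (x : R) : 0 <= x `^ (s - 1) * expR (- x) by rewrite mulr_ge0 ?powR_ge0 ?expR_ge0.
have -> : `]0%R, +oo[%classic = `]0%R, 1]%classic `|` `]1, +oo[%classic :> set R.
  by rewrite -itv_bndbnd_setU ?bnd_simp.
rewrite ge0_integral_setU//=; last first.
- apply/disj_setPS => x [/=]; rewrite !in_itv/= andbT => /andP[_ x1] x1'.
  by have := le_lt_trans x1 x1'; rewrite ltxx.
- by move=> x _; rewrite lee_fin.
- by apply/measurable_EFinP; apply: mf; apply: measurableU.
apply: lte_add_pinfty.
- (* near 0 the antiderivative x `^ s / s is bounded *)
  have -> : `]0%R, 1]%classic = \bigcup_n `[((n.+1%:R^-1)%R : R), 1]%classic :> set R.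
    apply/seteqP; split => x /=; rewrite ?in_itv/=.
      move=> /andP[x0 x1]; exists (Num.truncn x^-1) => //=; rewrite in_itv/= x1 andbT.
      rewrite -[leRHS]invrK lef_pV2 ?posrE ?invr_gt0//.
      exact/ltW/truncnS_gt.
    by move=> [n _ /=]; rewrite !in_itv/= => /andP[nx ->]; rewrite andbT; apply: lt_le_trans nx.
  have nd : nondecreasing_seq (fun n => `[((n.+1%:R^-1)%R : R), 1]%classic).
    move=> m n mn; apply/subsetPset => x /=; rewrite !in_itv/= => /andP[mx ->]; rewrite andbT.
    by apply: le_trans mx; rewrite lef_pV2 ?posrE// ler_nat.
  have h : (\int[mu]_(x in `[((n.+1%:R^-1)%R : R), 1%R]%classic) (x `^ (s - 1) * expR (- x))%:E)%E
      @[n --> \oo] --> (\int[mu]_(x in \bigcup_n `[((n.+1%:R^-1)%R : R), 1%R]%classic)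
        (x `^ (s - 1) * expR (- x))%:E)%E.
    apply: ge0_nondecreasing_set_cvg_integral => //.
    - by move=> n; apply/measurable_EFinP; exact: mf.
    - by move=> n x _; rewrite lee_fin.
  apply: (@le_lt_trans _ _ (s^-1)%:E); last exact: ltry.
  rewrite -(cvg_lim _ h)//; apply: lime_le; first by apply/cvg_ex; eexists; exact: h.
  apply: nearW => n; set a : R := n.+1%:R^-1.
  have a0 : 0 < a by rewrite /a invr_gt0.
  have [a1|a1] := leP 1 a.
    have -> : a = 1 by apply/eqP; rewrite eq_le a1 andbT /a invf_le1// ler1n.
    by rewrite set_itv1 integral_set1 lee_fin invr_ge0 ltW.
  apply: (@le_trans _ _ (\int[mu]_(x in `[a, 1%R]) (x `^ (s - 1))%:E)%E).
    apply: ge0_le_integral => //.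
    - by move=> x _; rewrite lee_fin.
    - by apply/measurable_EFinP; exact: mf.
    - by apply/measurable_EFinP/measurable_funTS; exact: measurable_powR.
    - move=> x; rewrite /= in_itv/= => /andP[ax _]; rewrite lee_fin ler_piMr ?powR_ge0//.
      by rewrite expR_le1 oppr_le0 (le_trans (ltW a0)).
  pose F x : R := x `^ s / s.
  have dF (x : R) : 0 < x -> is_derive x (1 : R) F (x `^ (s - 1)).
    move=> x0.
    have h1 : is_derive x (1 : R) (fun y : R => y `^ s) (s * x `^ (s - 1)) by exact: is_derive1_powR.
    apply: is_derive_eq; rewrite /GRing.scale/= mulr0 add0r mulrA mulVf ?mul1r//.
    by rewrite gt_eqF.
  rewrite (@continuous_FTC2 _ _ F)//.
  + rewrite -EFinB lee_fin /F powR1/= lerBlDr div1r lerDl.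
    by rewrite divr_ge0 ?powR_ge0// ltW.
  + apply: continuous_in_subspaceT => x; rewrite inE/= in_itv/= => /andP[ax _].
    by apply: continuous_powR_pos; rewrite in_itv/= andbT (lt_le_trans a0).
  + have cF x : 0 < x -> {for x, continuous F}.
      move=> x0; apply: differentiable_continuous; apply/derivable1_diffP.
      by have dFx := dF x x0; exact: ex_derive.
    split.
    * move=> x; rewrite in_itv/= => /andP[ax _].
      by have dFx := dF x (lt_trans a0 ax); exact: ex_derive.
    * by apply: cvg_at_right_filter; exact: cF.
    * by apply: cvg_at_left_filter; apply: cF.
  + move=> x; rewrite in_itv/= => /andP[ax _]; rewrite derive1E.
    by have dFx := dF x (lt_trans a0 ax); exact: derive_val.
- (* away from 0 the powers are dominated by half of the exponential *)
  pose n := (Num.truncn s).+1; pose C : R := n`!%:R * 2 ^+ n.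
  have pow x : 1 <= x -> x `^ (s - 1) * expR (- x) <= C * expR (- (x / 2)).
    move=> x1; have x0 : 0 <= x by exact: le_trans x1.
    have h1 : x `^ (s - 1) <= x ^+ n.
      rewrite -powR_mulrn// ler_powR// (le_trans _ (ltW (truncnS_gt s)))//.
      by rewrite lerBlDr lerDl.
    have h2 : x ^+ n <= C * expR (x / 2).
      have := expR_series_le n.+1 (_ : 0 <= x / 2); rewrite divr_ge0// => /(_ isT).
      rewrite /series/= big_nat_recr//= => h.
      have : (x / 2) ^+ n / n`!%:R <= expR (x / 2).
        apply: le_trans h; rewrite lerDr sumr_ge0// => i _.
        by rewrite exp_coeff_ge0// divr_ge0.
      rewrite ler_pdivrMr ?ltr0n ?fact_gt0// expr_div_n ler_pdivrMr ?exprn_gt0// => h'.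
      by rewrite /C mulrAC [_`!%:R * _]mulrC.
    rewrite (_ : - (x / 2) = x / 2 - x); last by field.
    rewrite expRD mulrA ler_wpM2r ?expR_ge0//; exact: le_trans h2.
  apply: (@le_lt_trans _ _ (\int[mu]_(x in `]1%R, +oo[) ((2 * C)%:E * (exponential_pdf 2^-1 x)%:E))%E).
    apply: ge0_le_integral => //.
    - by move=> x _; rewrite lee_fin.
    - by apply/measurable_EFinP; exact: mf.
    - apply: measurable_funeM; apply/measurable_EFinP/measurable_funTS.
      exact: measurable_exponential_pdf.
    - move=> x; rewrite /= in_itv/= andbT => x1; rewrite lee_fin.
      rewrite exponential_pdfE ?(le_trans ler01 (ltW x1))// (le_trans (pow x (ltW x1)))//.
      by rewrite mulrA [2 * C]mulrC mulfK// mulNr [2^-1 * x]mulrC.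
  rewrite ge0_integralZl//.
  + apply: lte_mul_pinfty => //; first by rewrite lee_fin !mulr_ge0// exprn_ge0.
    apply: (@le_lt_trans _ _ 1%E); last exact: ltry.
    rewrite -(@integral_exponential_pdf R 2^-1)//.
    apply: ge0_subset_integral => //.
    * by apply/measurable_EFinP; exact: measurable_exponential_pdf.
    * by move=> x _; rewrite lee_fin exponential_pdf_ge0.
  + by apply/measurable_EFinP/measurable_funTS; exact: measurable_exponential_pdf.
  + by move=> x _; rewrite lee_fin exponential_pdf_ge0.
  + by rewrite lee_fin !mulr_ge0// exprn_ge0.
Qed.

End antiderivative.

Section poisson_tail_calculus.
Context (R : realType).
Notation mu := (@lebesgue_measure R).
Implicit Types x y : R.

Definition gamma_density n x : R := x ^+ n / n`!%:R * expR (- x).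

Lemma poisson_tailS n x : poisson_tail n.+1 x = poisson_tail n x - gamma_density n x.
Proof. by rewrite /poisson_tail big_ord_recr/= /gamma_density; ring. Qed.

Lemma gamma_density_ge0 n x : 0 <= x -> 0 <= gamma_density n x.
Proof. by move=> x0; rewrite /gamma_density !mulr_ge0 ?expR_ge0 ?exprn_ge0 ?invr_ge0. Qed.

Lemma is_derive_poisson_tail n x :
  is_derive x (1 : R) (poisson_tail n.+1) (gamma_density n x).
Proof.
elim: n => [|n IH].
  rewrite (_ : poisson_tail 1 = fun y => 1 - expR (- y)); last first.
    by apply/funext => y; rewrite /poisson_tail big_ord_recl big_ord0 expr0 fact0 /=; field.
  by apply: is_derive_eq; rewrite /gamma_density /GRing.scale/= expr0 fact0; field.
rewrite (_ : poisson_tail n.+2 = fun y => poisson_tail n.+1 y -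
    (n.+1)`!%:R^-1 * (y ^+ n.+1 * expR (- y))); last first.
  by apply/funext => y; rewrite poisson_tailS /gamma_density; ring.
have hX : is_derive x (1 : R) (fun y : R => y ^+ n.+1) (n.+1%:R * x ^+ n).
  by apply: DeriveDef; [exact: exprn_derivable|rewrite exp_derive /GRing.scale/= mulr1].
apply: is_derive_eq; rewrite /gamma_density /GRing.scale/= factS natrM exprS; field.
by rewrite pnatr_eq0 -lt0n fact_gt0 addrC natr1 pnatr_eq0.
Qed.

Lemma poisson_tail0 n : poisson_tail n.+1 (0 : R) = 0.
Proof.
rewrite /poisson_tail big_ord_recl big1 => [|i _]; last by rewrite expr0n/= mul0r mulr0.
by rewrite oppr0 expR0 expr0 fact0 /=; field.
Qed.

Lemma poisson_tail_ge0 n x : 0 <= x -> 0 <= poisson_tail n x.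
Proof.
move=> x0; rewrite /poisson_tail -mulr_sumr subr_ge0.
have := expR_series_le n x0; rewrite /series/= big_mkord => h.
rewrite -[leRHS](expRxMexpNx_1 x) mulrC ler_wpM2r ?expR_ge0//.
Qed.

Lemma poisson_tail_le1 n x : 0 <= x -> poisson_tail n x <= 1.
Proof.
move=> x0; rewrite lerBlDr lerDl; apply: sumr_ge0 => i _.
by rewrite mulr_ge0 ?expR_ge0// divr_ge0// exprn_ge0.
Qed.

End poisson_tail_calculus.

(** * The counting function *)

Section counting_function.
Context (R : realType) (p : nat -> R).
Notation mu := (@lebesgue_measure R).
Hypothesis hp : discrete_distribution p.
Implicit Types s t y : R.

Let p0 k : 0 <= p k. Proof. exact: hp.1. Qed.

Lemma rho_series t : 0 < t ->
  ((rho p t)%:E = \sum_(0 <= k <oo) (((1 <= p k * t)%R : bool)%:R : R)%:E)%E.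
Proof.
move=> t0; rewrite /rho.
have -> : [set k | 0 < p k /\ (p k)^-1 <= t] = [set k | 1 <= p k * t].
  apply/seteqP; split => k /=.
    by move=> [pk]; rewrite -[_^-1]mulr1 ler_pdivrMl.
  move=> h; have pk : 0 < p k.
    rewrite lt_neqAle p0 andbT; apply: contraTneq h => <-.
    by rewrite mul0r ler10.
  by split => //; move: h; rewrite -ler_pdivrMl// mulr1.
have e : (counting [set k | (1 <= p k * t)%R] =
    \sum_(0 <= k <oo) (((1 <= p k * t)%R : bool)%:R : R)%:E)%E.
  rewrite counting_dirac; apply: eq_eseriesr => k _; rewrite /dirac indicE.
  by congr ((_ : bool)%:R%:E); apply/idP/idP; rewrite inE.
rewrite e fineK//; rewrite ge0_fin_numE; last exact: nneseries_ge0.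
apply: (@le_lt_trans _ _ t%:E); last exact: ltry.
rewrite -[leRHS]mule1 -hp.2 -nneseriesZl//; last by move=> k _; rewrite lee_fin.
apply: lee_nneseries => // k _; rewrite -EFinM lee_fin [leRHS]mulrC.
by case: (leP 1 (p k * t)) => // _; rewrite mulr_ge0// ltW.
Qed.

Lemma rho_ge0 t : 0 <= rho p t.
Proof. exact: fine_ge0. Qed.

Lemma rho_homo s t : 0 < s -> s <= t -> rho p s <= rho p t.
Proof.
move=> s0 st; rewrite -lee_fin !rho_series// ?(lt_le_trans s0)//.
apply: lee_nneseries => // k _; rewrite lee_fin ler_nat.
by case: (leP 1 (p k * s)) => // h; rewrite (le_trans h)// ler_wpM2l.
Qed.

Lemma rho_unbounded : infinite_set [set k | 0 < p k] ->
  rho p t @[t --> +oo] --> +oo.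
Proof.
move=> hinf; apply/cvgryPge => A.
have [m Am] : exists m, A <= m%:R.
  by exists (Num.truncn A).+1; exact/ltW/truncnS_gt.
have [f finj fp] : exists2 f : nat -> nat, injective f & forall i, 0 < p (f i).
  have /infiniteP/pcard_leP/injfunPex[/= f ff finj] := hinf.
  exists f; last by move=> i; exact: ff.
  by move=> i j fij; apply: finj => //; rewrite inE.
pose t0 := \sum_(i < m) (p (f i))^-1.
near=> t; rewrite (le_trans Am)//.
have t00 : 0 < t by near: t; exact: nbhs_pinfty_gt.
have t0t : t0 <= t by near: t; apply: nbhs_pinfty_ge; rewrite num_real.
rewrite -lee_fin rho_series//.
pose K := (\max_(i < m) f i).+1.
apply: le_trans (nneseries_lim_ge K _) => //.
rewrite sumEFin lee_fin -natr_sum ler_nat big_mkord.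
have -> : m = #|'I_m| by rewrite card_ord.
have fK (i : 'I_m) : (f i < K)%N.
  by rewrite ltnS; exact: (leq_bigmax_cond (F := fun i : 'I_m => f i)).
pose h (i : 'I_m) : 'I_K := Ordinal (fK i).
have hinj : injective h by move=> i j [/finj] /val_inj.
rewrite -(card_imset _ hinj) -sum1_card.
rewrite [leqRHS](bigID (fun k => k \in [set h i | i : 'I_m]%SET))/=.
apply: leq_trans (leq_addr _ _); apply: leq_sum => _ /imsetP[i _ ->] /=.
rewrite (_ : (1 <= _)%R = true)// -ler_pdivrMl// mulr1 (le_trans _ t0t)//.
by rewrite /t0 (bigD1 i)//= lerDl sumr_ge0// => j _; rewrite invr_ge0.
Unshelve. all: by end_near. Qed.

(** Tonelli's theorem: [G (p k * t)] is the integral of [g] over [y <= p k * t], and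
    [rho p (t / y)] counts the boxes [k] with this property. *)
Lemma series_integral_rho (g G : R -> R) t : 0 < t ->
  measurable_fun setT g -> (forall y, 0 <= y -> 0 <= g y) ->
  (forall x, 0 <= x -> (\int[mu]_(y in `]0%R, x]) (g y)%:E = (G x)%:E)%E) ->
  (\sum_(0 <= k <oo) (G (p k * t))%:E =
   \int[mu]_(y in `]0%R, +oo[) (g y * rho p (t / y))%:E)%E.
Proof.
move=> t0 mg g0 gG.
transitivity (\sum_(0 <= k <oo) \int[mu]_(y in `]0%R, +oo[)
    (g y * ((y <= p k * t)%R : bool)%:R)%:E)%E.
  apply: eq_eseriesr => k _; have pt : 0 <= p k * t by rewrite mulr_ge0// ltW.
  rewrite -(gG _ pt) [LHS]integral_mkcond [RHS]integral_mkcond/=.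
  apply: eq_integral => y _; rewrite !patchE.
  have -> : (y \in `]0%R, p k * t]%classic) = (0 < y <= p k * t).
    by apply/idP/idP; rewrite inE/= in_itv.
  have -> : (y \in `]0%R, +oo[%classic) = (0 < y).
    by apply/idP/idP; rewrite inE/= in_itv/= andbT.
  by case: (0 < y) => //=; case: (y <= _); rewrite ?mulr1 ?mulr0.
rewrite -integral_nneseries//.
- apply: eq_integral => y; rewrite inE/= in_itv/= andbT => y0.
  have ty : 0 < t / y by rewrite divr_gt0.
  rewrite EFinM rho_series// -nneseriesZl//.
  + apply: eq_eseriesr => k _; rewrite -EFinM.
    by rewrite mulrA ler_pdivlMr// mul1r.
- move=> k; apply/measurable_EFinP/measurable_funTS; apply: measurable_funM => //.
  rewrite (_ : (fun _ => _) = \1_(`]-oo, p k * t]%classic)); first exact: measurable_indic.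
  by apply/funext => y; rewrite indicE; congr ((_ : bool)%:R); apply/idP/idP; rewrite inE/= in_itv.
- move=> k y; rewrite /= in_itv/= andbT => y0.
  by rewrite lee_fin mulr_ge0// g0// ltW.
Qed.

Lemma measurable_rho : measurable_fun (`]0, +oo[%classic : set R) (rho p).
Proof.
apply/measurable_EFinP.
apply: (eq_measurable_fun (fun t => \sum_(0 <= k <oo) (((1 <= p k * t)%R : bool)%:R : R)%:E)%E).
  by move=> t; rewrite inE/= in_itv/= andbT => t0; rewrite -rho_series.
apply: measurable_funTS; apply: ge0_emeasurable_sum => [k t _ _|k _]; first by rewrite lee_fin.
apply/measurable_EFinP; apply: (measurableT_comp (f := fun b : bool => b%:R : R)) => //.
by apply: measurable_fun_ler => //; exact: measurable_funM.
Qed.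

Section regular_variation.
Variables (alpha : R) (alpha01 : 0 < alpha < 1).
Hypothesis rv : forall l, 0 < l -> rho p (l * t) / rho p t @[t --> +oo] --> l `^ alpha.

Lemma rho_gt0_near : \forall t \near +oo, 0 < rho p t.
Proof.
have /cvgrPdist_lt/(_ _ ltr01) := rv ltr01.
apply: filterS => t; rewrite powR1 mul1r => h; rewrite lt_neqAle rho_ge0 andbT.
by apply: contraTneq h => <-; rewrite invr0 mulr0 subr0 normr1 ltxx.
Qed.

(** Potter's bound. Since the counting function is monotone, it is enough to iterate
    the inequality [rho p (2 * t) <= 2 `^ b * rho p t], valid for large [t]; for
    [1 <= y] monotonicity alone gives the constant 1. *)
Lemma potter : exists b t0, [/\ alpha < b < 1, 0 < t0 & forall t y, t0 <= t -> 0 < y ->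
  0 < rho p t /\ rho p (t / y) <= (1 + 2 `^ b * y `^ (- b)) * rho p t].
Proof.
have /andP[a0 a1] := alpha01.
pose b := (alpha + 1) / 2; have ab : alpha < b by rewrite /b; lra.
have b1 : b < 1 by rewrite /b; lra.
have pab : 2 `^ alpha < 2 `^ b :> R.
  by rewrite /powR gt_eqF// ltr_expR ltr_pM2r// ln_gt0// ltr1n.
have := rv (ltr0n R 2) => /cvgrPdist_lt/(_ _ (_ : 0 < 2 `^ b - 2 `^ alpha)).
rewrite subr_gt0 => /(_ pab) h.
have := filterI h rho_gt0_near => -[M [Mr hM]].
pose t0 := Num.max 1 (M + 1).
have t00 : 0 < t0 by rewrite lt_max ltr01.
have big t : t0 <= t -> 0 < rho p t /\ rho p (2 * t) <= 2 `^ b * rho p t.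
  move=> t0t; have [h1 r0] : `|2 `^ alpha - rho p (2 * t) / rho p t| < 2 `^ b - 2 `^ alpha /\ 0 < rho p t.
    apply: hM; apply: lt_le_trans t0t; rewrite lt_max.
    by apply/orP; right; rewrite ltrDl.
  split => //; rewrite -ler_pdivrMr//; move: h1; rewrite ltr_distl => /andP[+ _].
  by rewrite ltrBlDr; lra.
have step n t y : t0 <= t -> 2 ^- n <= y -> y <= 1 ->
    rho p (t / y) <= 2 `^ b * y `^ (- b) * rho p t.
  elim: n t y => [|n IH] t y t0t ny y1.
    move: ny; rewrite expr0 invr1 => ny; have -> : y = 1 by apply/eqP; rewrite eq_le y1.
    by rewrite divr1 powR1 mulr1 ler_peMl ?rho_ge0// -[leLHS](powRr0 2) ler_powR ?ler1n// (ltW (lt_trans a0 ab)).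
  have y0 : 0 < y by apply: lt_le_trans ny; rewrite invr_gt0 exprn_gt0.
  have [r0 r2] := big t t0t.
  have tt : 0 < t by exact: lt_le_trans t0t.
  have [y2|y2] := leP 1 (2 * y).
    apply: (@le_trans _ _ (rho p (2 * t))).
      apply: rho_homo; first by rewrite divr_gt0.
      by rewrite ler_pdivrMr// mulrAC ler_peMl// ltW.
    rewrite (le_trans r2)// ler_wpM2r ?rho_ge0// ler_peMr ?powR_ge0//.
    rewrite powRN -invf_le1 ?invrK ?invr_gt0 ?powR_gt0//.
    by rewrite /powR gt_eqF// expR_le1 pmulr_rle0 ?(lt_trans a0 ab)// ln_le0.
  have := IH (2 * t) (2 * y).
  have -> : 2 * t / (2 * y) = t / y by rewrite -mulf_div divff// mul1r.
  have c1 : t0 <= 2 * t by rewrite (le_trans t0t)// ler_peMl ?(ltW tt)// ler1n.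
  have c2 : 2 ^- n <= 2 * y by move: ny; rewrite exprS invfM ler_pdivrMl.
  move=> /(_ c1 c2 (ltW y2))/le_trans; apply.
  rewrite powRM ?(ltW y0)// -!mulrA ler_wpM2l ?powR_ge0// mulrCA ler_wpM2l ?powR_ge0//.
  by rewrite powRN ler_pdivrMl ?powR_gt0.
exists b, t0; split => //; first by rewrite ab.
move=> t y t0t y0; have [r0 _] := big t t0t; split => //.
have tt : 0 < t by exact: lt_le_trans t0t.
have [y1|y1] := leP y 1.
  have [n ny] : exists n, 2 ^- n <= y.
    exists (Num.truncn y^-1).+1; rewrite -[leRHS]invrK lef_pV2 ?posrE ?invr_gt0 ?exprn_gt0//.
    apply: (le_trans (ltW (truncnS_gt _))); rewrite -natrX ler_nat ltnW//.
    exact: ltn_expl.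
  rewrite (le_trans (step n t y t0t ny y1))// ler_wpM2r ?rho_ge0// lerDr.
  exact: ler01.
apply: (@le_trans _ _ (rho p t)).
  apply: rho_homo; first by rewrite divr_gt0.
  by rewrite ler_pdivrMr// ler_peMr ?ltW.
by rewrite ler_peMl ?rho_ge0// lerDl mulr_ge0 ?powR_ge0.
Qed.

Let C_ge0 (C : R) n g : (forall y, 0 < y -> 0 <= g y <= C * gamma_density n y) -> 0 <= C.
Proof.
move=> gC; have /andP[h1 h2] := gC 1 ltr01.
have := le_trans h1 h2; rewrite pmulr_lge0//.
by rewrite /gamma_density expr1n div1r mulr_gt0 ?expR_gt0// invr_gt0 ltr0n fact_gt0.
Qed.

Lemma integral_gamma_density_powR_lty n b : b < 1 ->
  (\int[mu]_(y in `]0%R, +oo[) (gamma_density n y * y `^ (- b))%:E < +oo)%E.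
Proof.
move=> b1.
apply: (@le_lt_trans _ _ ((n`!%:R^-1)%:E *
   \int[mu]_(y in `]0%R, +oo[) (y `^ ((n%:R + 1 - b) - 1) * expR (- y))%:E)%E).
  rewrite -ge0_integralZl//.
  - apply: ge0_le_integral => //.
    + move=> y; rewrite /= in_itv/= andbT => y0.
      by rewrite lee_fin mulr_ge0 ?powR_ge0// gamma_density_ge0// ltW.
    + apply/measurable_EFinP/measurable_funTS; apply: measurable_funM; last exact: measurable_powR.
      apply: measurable_funM; last by do 2 apply: measurableT_comp => //.
      by apply: measurable_funM => //; exact: exprn_measurable.
    + apply: measurable_funeM; apply/measurable_EFinP/measurable_funTS; apply: measurable_funM.
        exact: measurable_powR.
      by do 2 apply: measurableT_comp => //.
    + move=> y; rewrite /= in_itv/= andbT => y0; rewrite -EFinM lee_fin le_eqVlt; apply/orP; left; apply/eqP.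
      rewrite (_ : n%:R + 1 - b - 1 = n%:R - b); last by ring.
      rewrite powRD; last by rewrite (gt_eqF y0) implybT.
      by rewrite powR_mulrn ?(ltW y0)// /gamma_density; ring.
  - apply/measurable_EFinP/measurable_funTS; apply: measurable_funM.
      exact: measurable_powR.
    by do 2 apply: measurableT_comp => //.
  - by move=> y _; rewrite lee_fin mulr_ge0 ?powR_ge0 ?expR_ge0.
apply: lte_mul_pinfty; first by rewrite lee_fin invr_ge0.
  by [].
by apply: integral_powR_expR_lty; rewrite -addrA ltr_wpDl// subr_gt0.
Qed.

(** Karlin's asymptotics. By regular variation [rho p (t / y) / rho p t] tends to
    [y `^ (- alpha)], and Potter's bound dominates it by a power that the density,
    at most a multiple of a gamma density, makes integrable. *)
Lemma integral_rho_asymptotics (g A : R -> R) (C : R) n :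
  measurable_fun setT g -> (forall y, 0 < y -> 0 <= g y <= C * gamma_density n y) ->
  (forall t, 0 < t ->
    ((A t)%:E = \int[mu]_(y in `]0%R, +oo[) (g y * rho p (t / y))%:E)%E) ->
  A t / rho p t @[t --> +oo] -->
    fine (\int[mu]_(y in `]0%R, +oo[) (g y * y `^ (- alpha))%:E)%E.
Proof.
move=> mg gC AE; have [b [t0 [/andP[ab b1] t00 pot]]] := potter.
have C0 := C_ge0 gC.
have b0 : 0 < b by apply: lt_trans ab; case/andP: alpha01.
pose B : R := 1 + 2 `^ b.
pose dom y := (C * gamma_density n y) * (1 + 2 `^ b * y `^ (- b)).
have D0 : measurable (`]0, +oo[%classic : set R) by exact: measurable_itv.
have mpow c : measurable_fun (`]0, +oo[%classic : set R) (fun y : R => y `^ c).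
  by apply: measurable_funTS; exact: measurable_powR.
have mV : measurable_fun (`]0, +oo[%classic : set R) (fun y : R => y^-1).
  apply: (eq_measurable_fun (fun y : R => y `^ (-1))); last exact: mpow.
  by move=> y; rewrite inE/= in_itv/= andbT => /ltW/powR_inv1.
have mgam : measurable_fun (setT : set R) (gamma_density n).
  apply: measurable_funM; last by do 2 apply: measurableT_comp => //.
  by apply: measurable_funM => //; exact: exprn_measurable.
have mdom : measurable_fun (`]0, +oo[%classic : set R) dom.
  apply: measurable_funM; first by apply: measurable_funTS; exact: measurable_funM.
  by apply: measurable_funD => //; exact: measurable_funM.
have intdom : mu.-integrable `]0, +oo[ (EFin \o dom).
  apply/integrableP; split; first exact/measurable_EFinP.
  have g0 y : 0 < y -> 0 <= gamma_density n y by move=> /ltW; exact: gamma_density_ge0.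
  apply: (@le_lt_trans _ _ (C%:E * \int[mu]_(y in `]0%R, +oo[) (gamma_density n y * y `^ (- 0))%:E +
     (C * 2 `^ b)%:E * \int[mu]_(y in `]0%R, +oo[) (gamma_density n y * y `^ (- b))%:E)%E); last first.
    apply: lte_add_pinfty; apply: lte_mul_pinfty => //.
    - exact: integral_gamma_density_powR_lty.
    - by rewrite lee_fin mulr_ge0 ?powR_ge0.
    - exact: integral_gamma_density_powR_lty.
  have mgp c : measurable_fun (`]0, +oo[%classic : set R) (fun y => (gamma_density n y * y `^ c)%:E).
    by apply/measurable_EFinP; apply: measurable_funM => //; exact: measurable_funTS.
  have gp0 c y : `]0%R, +oo[%classic y -> (0 <= (gamma_density n y * y `^ c)%:E)%E.
    by rewrite /= in_itv/= andbT => y0; rewrite lee_fin mulr_ge0 ?powR_ge0 ?g0.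
  have Z k c : 0 <= k -> (k%:E * \int[mu]_(y in `]0%R, +oo[) (gamma_density n y * y `^ c)%:E =
      \int[mu]_(y in `]0%R, +oo[) (k%:E * (gamma_density n y * y `^ c)%:E))%E.
    move=> k0; rewrite ge0_integralZl//.
      exact: mgp.
    by move=> y; exact: gp0.
  have Zm k c : measurable_fun (`]0, +oo[%classic : set R) (fun y => k%:E * (gamma_density n y * y `^ c)%:E)%E.
    exact: measurable_funeM.
  have Zp k c y : 0 <= k -> `]0%R, +oo[%classic y -> (0 <= k%:E * (gamma_density n y * y `^ c)%:E)%E.
    by move=> k0 /(gp0 c) h; rewrite mule_ge0.
  have Cb0 : 0 <= C * 2 `^ b by rewrite mulr_ge0 ?powR_ge0.
  rewrite !Z// -ge0_integralD//; try by [exact: Zm|move=> y; exact: Zp].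
  apply: ge0_le_integral => //.
  - by apply: measurableT_comp => //; exact/measurable_EFinP.
  - by apply: emeasurable_funD; exact: Zm.
  - move=> y; rewrite /= in_itv/= andbT => y0; rewrite lee_fin ger0_norm.
      by rewrite /dom oppr0 powRr0 le_eqVlt; apply/orP; left; apply/eqP; ring.
    by apply: mulr_ge0; [rewrite mulr_ge0 ?g0|rewrite addr_ge0// mulr_ge0 ?powR_ge0].
apply/cvg_pinftyP => u uoo.
pose f m y := (if t0 <= u m then g y * rho p (u m / y) / rho p (u m) else 0)%:E.
have uge : \forall m \near \oo, t0 <= u m.
  by move/cvgryPge : uoo; apply.
have mf m : measurable_fun (`]0, +oo[%classic : set R) (f m).
  apply/measurable_EFinP; case: (leP t0 (u m)) => um; last exact: measurable_cst.
  apply: measurable_funM => //; apply: measurable_funM; first exact: measurable_funTS.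
  apply: (measurable_comp (F := `]0, +oo[%classic : set R)) => //.
  - move=> _ [y /= + <-]; rewrite !in_itv/= !andbT => y0.
    by rewrite divr_gt0// (lt_le_trans t00).
  - exact: measurable_rho.
  - exact: measurable_funM.
have [||//|intg _ cvgint] := @dominated_convergence _ _ _ mu _ D0 f
    (fun y => (g y * y `^ (- alpha))%:E) (EFin \o dom) mf _ _ intdom.
  - by apply/measurable_EFinP; apply: measurable_funM; [exact: measurable_funTS|exact: mpow].
  - apply: aeW => y; rewrite /= in_itv/= andbT => y0.
    apply: cvg_EFin; first exact: nearW.
    have h1 : rho p (y^-1 * u m) / rho p (u m) @[m --> \oo] --> y^-1 `^ alpha.
      have := rv (_ : 0 < y^-1); rewrite invr_gt0 => /(_ y0)/cvg_pinftyP; exact.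
    have -> : y `^ (- alpha) = y^-1 `^ alpha.
      by rewrite -powR_inv1 ?(ltW y0)// -powRrM mulN1r.
    have : g y * (rho p (y^-1 * u m) / rho p (u m)) @[m --> \oo] --> g y * y^-1 `^ alpha.
      by apply: cvgM => //; exact: cvg_cst.
    apply: cvg_trans; apply: near_eq_cvg; near=> m; rewrite /f/=.
    have -> : (t0 <= u m) = true by near: m.
    by rewrite mulrA [y^-1 * _]mulrC.
  - apply: aeW => y m; rewrite /= in_itv/= andbT => y0; rewrite lee_fin.
    have /andP[gy0 gyC] := gC y y0.
    have d0 : 0 <= dom y.
      by apply: mulr_ge0; [exact: le_trans gy0 gyC|rewrite addr_ge0// mulr_ge0 ?powR_ge0].
    rewrite /f; case: (leP t0 (u m)) => um; last by rewrite normr0.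
    have [r0 rle] := pot (u m) y um y0.
    rewrite ger0_norm; last by rewrite !mulr_ge0 ?invr_ge0 ?rho_ge0.
    rewrite /dom -mulrA ler_pM//; first by rewrite divr_ge0 ?rho_ge0.
    by rewrite ler_pdivrMr.
have Ifin := @integrable_fin_num _ _ _ mu _ D0 _ intg.
rewrite -(fineK Ifin) in cvgint.
apply: cvg_trans (fine_cvg cvgint); apply: near_eq_cvg; near=> m => /=.
have tum : t0 <= u m by near: m.
have um0 : 0 < u m by exact: lt_le_trans tum.
transitivity (fine ((rho p (u m))^-1%:E *
    \int[mu]_(y in `]0%R, +oo[) (g y * rho p (u m / y))%:E)%E).
  rewrite -ge0_integralZl//.
  - congr fine; apply: eq_integral => y _.
    by rewrite /f tum -EFinM; congr EFin; ring.
  - apply/measurable_EFinP; apply: measurable_funM; first exact: measurable_funTS.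
    apply: (measurable_comp (F := `]0, +oo[%classic : set R)) => //.
    + move=> _ [y /= + <-]; rewrite !in_itv/= !andbT => y0.
      by rewrite divr_gt0.
    + exact: measurable_rho.
    + exact: measurable_funM.
  - move=> y; rewrite /= in_itv/= andbT => y0.
    by rewrite lee_fin mulr_ge0 ?rho_ge0//; case/andP: (gC y y0).
  - by rewrite lee_fin invr_ge0 rho_ge0.
by rewrite -AE//= mulrC.
Unshelve. all: by end_near. Qed.

End regular_variation.

End counting_function.

(** * Moments of the occupancy *)

Section poisson_tail_bounds.
Context (R : realType).
Implicit Types x y : R.

Lemma continuous_gamma_density n : continuous (@gamma_density R n).
Proof.
move=> x; apply: cvgM; first by apply: cvgM; [exact: exprn_continuous|exact: cvg_cst].
by apply: (@continuous_comp _ _ _ -%R expR); [exact: opp_continuous|exact: continuous_expR].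
Qed.

Lemma continuous_poisson_tail n : continuous (@poisson_tail R n.+1).
Proof.
move=> x; apply: differentiable_continuous; apply/derivable1_diffP.
by have [] := is_derive_poisson_tail n x.
Qed.

Lemma gamma_density_le1 n x : 0 <= x -> gamma_density n x <= 1.
Proof.
move=> x0; rewrite /gamma_density expRN ler_pdivrMr ?expR_gt0// mul1r.
apply: le_trans (expR_series_le n.+1 x0); rewrite /series/= big_mkord big_ord_recr/=.
by rewrite lerDr sumr_ge0// => i _; rewrite divr_ge0// exprn_ge0.
Qed.

(** The derivative, a gamma density, is at most 1. *)
Lemma poisson_tail_incr n x y : 0 <= x -> x <= y ->
  0 <= poisson_tail n.+1 y - poisson_tail n.+1 x <= y - x.
Proof.
move=> x0 xy.
have [|c] := @MVT_segment _ (poisson_tail n.+1) (gamma_density n) _ _ xy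
    (fun z _ => is_derive_poisson_tail n z).
  by apply: continuous_subspaceT; exact: continuous_poisson_tail.
rewrite in_itv/= => /andP[xc cy] ->; have c0 := le_trans x0 xc.
have yx : 0 <= y - x by rewrite subr_ge0.
by rewrite mulr_ge0 ?gamma_density_ge0//= ler_piMl// gamma_density_le1.
Qed.

Lemma poisson_tail_le_id n x : 0 <= x -> poisson_tail n.+1 x <= x.
Proof.
by move=> x0; have /andP[_] := poisson_tail_incr n (lexx 0) x0; rewrite poisson_tail0 !subr0.
Qed.

Lemma poisson_tail_gt0 n x : 0 < x -> 0 < poisson_tail n.+1 x.
Proof.
move=> x0; have [|c] := @MVT _ (poisson_tail n.+1) (gamma_density n) _ _ x0
    (fun z _ => is_derive_poisson_tail n z).
  by apply: continuous_subspaceT; exact: continuous_poisson_tail.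
rewrite in_itv/= poisson_tail0 !subr0 => /andP[c0 _] ->.
by rewrite /gamma_density !mulr_gt0 ?expR_gt0 ?exprn_gt0 ?invr_gt0// ltr0n fact_gt0.
Qed.

Lemma poisson_tail_compl n x : 0 <= x -> expR (- x) <= 1 - poisson_tail n.+1 x.
Proof.
move=> x0; rewrite /poisson_tail opprB addrCA subrr addr0 big_ord_recl/= expr0 fact0 divr1 mulr1.
by rewrite lerDl sumr_ge0// => i _; rewrite mulr_ge0 ?expR_ge0 ?divr_ge0 ?exprn_ge0.
Qed.

End poisson_tail_bounds.

Lemma nneseries_cvg (R : realType) (f : nat -> R) (K : R) : (forall k, 0 <= f k) ->
  (forall n, \sum_(k < n) f k <= K) ->
  [/\ ((fine (\sum_(0 <= k <oo) (f k)%:E))%:E = \sum_(0 <= k <oo) (f k)%:E)%E,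
   \sum_(k < n) f k @[n --> \oo] --> fine (\sum_(0 <= k <oo) (f k)%:E)%E,
   fine (\sum_(0 <= k <oo) (f k)%:E)%E <= K &
   forall n, \sum_(k < n) f k <= fine (\sum_(0 <= k <oo) (f k)%:E)%E].
Proof.
move=> f0 fK.
have f0' k : (0 <= (f k)%:E)%E by rewrite lee_fin.
have le : (\sum_(0 <= k <oo) (f k)%:E <= K%:E)%E.
  apply: lime_le; first exact: is_cvg_nneseries.
  by apply: nearW => n; rewrite /= sumEFin lee_fin big_mkord.
have fin : (\sum_(0 <= k <oo) (f k)%:E)%E \is a fin_num.
  rewrite ge0_fin_numE; first exact: le_lt_trans le (ltry _).
  exact: nneseries_ge0.
have e := fineK fin; split => //.
- have h : (\sum_(0 <= k < n) (f k)%:E)%E @[n --> \oo] --> (fine (\sum_(0 <= k <oo) (f k)%:E)%E)%:E.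
    by rewrite e; exact: is_cvg_nneseries.
  apply: cvg_trans (fine_cvg h); apply: near_eq_cvg; apply: nearW => n /=.
  by rewrite sumEFin/= big_mkord.
- by rewrite -lee_fin e.
- move=> n; rewrite -lee_fin e; apply: le_trans (nneseries_lim_ge n _) => //.
  by rewrite sumEFin big_mkord.
Qed.

Section occupancy_moments.
Context (R : realType) (p : nat -> R).
Notation mu := (@lebesgue_measure R).
Hypothesis hp : discrete_distribution p.
Implicit Types s t : R.

Let p0 k : 0 <= p k. Proof. exact: hp.1. Qed.

Definition mean_occ j t := fine (\sum_(0 <= k <oo) (poisson_tail j (p k * t))%:E)%E.
Definition var_occ j t := fine (\sum_(0 <= k <oo)
  (poisson_tail j (p k * t) * (1 - poisson_tail j (p k * t)))%:E)%E.

Lemma sum_prob_le1 n : \sum_(k < n) p k <= 1.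
Proof.
rewrite -lee_fin -hp.2; apply: le_trans (nneseries_lim_ge n _) => //; last by move=> k _; rewrite lee_fin.
by rewrite sumEFin big_mkord.
Qed.

Let tail01 n k t : 0 <= t -> 0 <= poisson_tail n (p k * t) <= 1.
Proof. by move=> t0; rewrite poisson_tail_ge0 ?poisson_tail_le1 ?mulr_ge0. Qed.

Let sum_le n t m : 0 <= t -> \sum_(k < m) poisson_tail n.+1 (p k * t) <= t.
Proof.
move=> t0; apply: (@le_trans _ _ (\sum_(k < m) p k * t)).
  by apply: ler_sum => k _; rewrite poisson_tail_le_id// mulr_ge0.
by rewrite -mulr_suml ler_piMl// sum_prob_le1.
Qed.

Lemma mean_occ_cvg n t : 0 <= t ->
  \sum_(k < m) poisson_tail n.+1 (p k * t) @[m --> \oo] --> mean_occ n.+1 t.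
Proof.
move=> t0; have [//||_ + _ _] := @nneseries_cvg _ (fun k => poisson_tail n.+1 (p k * t)) t.
- by move=> k; case/andP: (tail01 n.+1 k t0).
- by move=> m; exact: sum_le.
- exact.
Qed.

Lemma mean_occE n t : 0 <= t ->
  ((mean_occ n.+1 t)%:E = \sum_(0 <= k <oo) (poisson_tail n.+1 (p k * t))%:E)%E.
Proof.
move=> t0; have [//||+ _ _ _] := @nneseries_cvg _ (fun k => poisson_tail n.+1 (p k * t)) t.
- by move=> k; case/andP: (tail01 n.+1 k t0).
- by move=> m; exact: sum_le.
- exact.
Qed.

Lemma mean_occ_le n t : 0 <= t -> mean_occ n.+1 t <= t.
Proof.
move=> t0; have [//||_ _ + _] := @nneseries_cvg _ (fun k => poisson_tail n.+1 (p k * t)) t.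
- by move=> k; case/andP: (tail01 n.+1 k t0).
- by move=> m; exact: sum_le.
- exact.
Qed.

Let var_sum_le n t m : 0 <= t ->
  \sum_(k < m) poisson_tail n.+1 (p k * t) * (1 - poisson_tail n.+1 (p k * t)) <= mean_occ n.+1 t.
Proof.
move=> t0; have [//||_ _ _ +] := @nneseries_cvg _ (fun k => poisson_tail n.+1 (p k * t)) t.
- by move=> k; case/andP: (tail01 n.+1 k t0).
- by move=> m'; exact: sum_le.
- move=> /(_ m); apply: le_trans; apply: ler_sum => k _.
  by have /andP[h1 h2] := tail01 n.+1 k t0; rewrite ler_piMr// lerBlDr lerDl.
Qed.

Let var0 n k t : 0 <= t -> 0 <= poisson_tail n (p k * t) * (1 - poisson_tail n (p k * t)).
Proof. by move=> t0; have /andP[h1 h2] := tail01 n k t0; rewrite mulr_ge0// subr_ge0. Qed.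

Lemma var_occ_cvg n t : 0 <= t ->
  \sum_(k < m) poisson_tail n.+1 (p k * t) * (1 - poisson_tail n.+1 (p k * t)) @[m --> \oo]
    --> var_occ n.+1 t.
Proof.
move=> t0; have [||_ + _ _] := @nneseries_cvg _ (fun k =>
  poisson_tail n.+1 (p k * t) * (1 - poisson_tail n.+1 (p k * t))) (mean_occ n.+1 t).
- by move=> k; exact: var0.
- by move=> m; exact: var_sum_le.
- exact.
Qed.

Lemma var_occ_ge_sum n t m : 0 <= t ->
  \sum_(k < m) poisson_tail n.+1 (p k * t) * (1 - poisson_tail n.+1 (p k * t)) <= var_occ n.+1 t.
Proof.
move=> t0; have [||_ _ _ +] := @nneseries_cvg _ (fun k =>
  poisson_tail n.+1 (p k * t) * (1 - poisson_tail n.+1 (p k * t))) (mean_occ n.+1 t).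
- by move=> k; exact: var0.
- by move=> m'; exact: var_sum_le.
- exact.
Qed.

Lemma var_occ_le n t : 0 <= t -> var_occ n.+1 t <= mean_occ n.+1 t.
Proof.
move=> t0; have [||_ _ + _] := @nneseries_cvg _ (fun k =>
  poisson_tail n.+1 (p k * t) * (1 - poisson_tail n.+1 (p k * t))) (mean_occ n.+1 t).
- by move=> k; exact: var0.
- by move=> m; exact: var_sum_le.
- exact.
Qed.

Lemma var_occ_ge0 n t : 0 <= t -> 0 <= var_occ n.+1 t.
Proof. by move=> t0; have := var_occ_ge_sum n 0 t0; rewrite big_ord0. Qed.

(** The clock [mean_occ] is slower than time, because the probabilities of the
    boxes sum to 1. *)
Lemma mean_occ_incr n s t : 0 <= s -> s <= t ->
  0 <= mean_occ n.+1 t - mean_occ n.+1 s <= t - s.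
Proof.
move=> s0 st; have t0 := le_trans s0 st.
have c : \sum_(k < m) (poisson_tail n.+1 (p k * t) - poisson_tail n.+1 (p k * s)) @[m --> \oo]
    --> mean_occ n.+1 t - mean_occ n.+1 s.
  under eq_fun do rewrite sumrB.
  by apply: cvgB; exact: mean_occ_cvg.
have h k : 0 <= poisson_tail n.+1 (p k * t) - poisson_tail n.+1 (p k * s) <= p k * (t - s).
  by rewrite mulrBr poisson_tail_incr ?mulr_ge0// ler_wpM2l.
apply/andP; split.
  rewrite -(cvg_lim _ c)//; apply: limr_ge; first by apply/cvg_ex; exists (mean_occ n.+1 t - mean_occ n.+1 s).
  by apply: nearW => m; rewrite sumr_ge0// => k _; case/andP: (h k).
rewrite -(cvg_lim _ c)//; apply: limr_le; first by apply/cvg_ex; exists (mean_occ n.+1 t - mean_occ n.+1 s).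
apply: nearW => m; apply: (@le_trans _ _ (\sum_(k < m) p k * (t - s))).
  by apply: ler_sum => k _; case/andP: (h k).
by rewrite -mulr_suml ler_piMl ?sum_prob_le1// subr_ge0.
Qed.

Lemma mean_occ0 n : mean_occ n.+1 0 = 0.
Proof. by rewrite /mean_occ eseries0// => k _ _; rewrite mulr0 poisson_tail0. Qed.

End occupancy_moments.

Section gamma_integrals.
Context (R : realType).
Notation mu := (@lebesgue_measure R).
Implicit Types s c y : R.

Let D0 : measurable (`]0, +oo[%classic : set R). Proof. exact: measurable_itv. Qed.

Let w s c y := y `^ (s - 1) * expR (- (c * y)).

Let mw s c : measurable_fun (`]0, +oo[%classic : set R) (w s c).
Proof.
apply: measurable_funTS; apply: measurable_funM; first exact: measurable_powR.
by do 2 apply: measurableT_comp => //; exact: measurable_funM.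
Qed.

Let w0 s c y : 0 <= w s c y. Proof. by rewrite mulr_ge0 ?powR_ge0 ?expR_ge0. Qed.

Let w1 s : (\int[mu]_(y in `]0%R, +oo[) (w s 1 y)%:E =
  \int[mu]_(y in `]0%R, +oo[) (y `^ (s - 1) * expR (- y))%:E)%E.
Proof. by apply: eq_integral => y _; rewrite /w mul1r. Qed.

Let w_double s : (\int[mu]_(y in `]0%R, +oo[) (w s 1 y)%:E =
  (2 `^ s)%:E * \int[mu]_(y in `]0%R, +oo[) (w s 2 y)%:E)%E.
Proof.
rewrite (integral_double (G := w s 1))//.
- rewrite -ge0_integralZl//; last 2 first.
  + by apply/measurable_EFinP; exact: mw.
  + by move=> y _; rewrite lee_fin.
  apply: eq_integral => y; rewrite inE/= in_itv/= andbT => y0.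
  rewrite -EFinM; congr EFin; rewrite /w mul1r powRM ?(ltW y0)//.
  have -> : (2 : R) `^ s = 2 `^ (s - 1) * 2.
    by rewrite -{3}(powRr1 (ler0n R 2)) -powRD ?subrK// pnatr_eq0 implybT.
  by ring.
- move=> y y0; apply: cvgM; first exact: continuous_powR_pos.
  apply: (@continuous_comp _ _ _ (fun y => - (1 * y)) expR); last exact: continuous_expR.
  by apply: cvgN; apply: cvgM; [exact: cvg_cst|exact: cvg_id].
Qed.

Let iw s c : 0 < s -> c = 1 \/ c = 2 -> mu.-integrable (`]0, +oo[%classic : set R) (EFin \o w s c).
Proof.
move=> s0 c12; apply/integrableP; split; first by apply/measurable_EFinP; exact: mw.
have e c' : (\int[mu]_(y in `]0%R, +oo[) `|(EFin \o w s c') y| =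
    \int[mu]_(y in `]0%R, +oo[) (w s c' y)%:E)%E.
  by apply: eq_integral => y _ /=; rewrite ger0_norm.
have l1 : (\int[mu]_(y in `]0%R, +oo[) (w s 1 y)%:E < +oo)%E by rewrite w1 integral_powR_expR_lty.
rewrite e; case: c12 => ->//; rewrite ltNge; apply: contraTN l1.
rewrite leye_eq => /eqP h; rewrite w_double h gt0_muley ?ltxx// lte_fin powR_gt0//.
Qed.

Let Gammaw s : Gamma s = \int[mu]_(y in `]0, +oo[) w s 1 y.
Proof. by rewrite /Gamma /Rintegral -w1. Qed.

Let Gammaw2 s : 0 < s -> \int[mu]_(y in `]0, +oo[) w s 2 y = Gamma s / 2 `^ s.
Proof.
move=> s0; rewrite Gammaw /Rintegral w_double fineM//=.
  by rewrite mulrAC divff ?mul1r// gt_eqF// powR_gt0.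
exact: (@integrable_fin_num _ _ _ mu _ D0 _ (iw s0 (or_intror erefl))).
Qed.

Lemma integral_gamma_density_powR n a : a < 1 ->
  \int[mu]_(y in `]0, +oo[) (gamma_density n y * y `^ (- a)) =
  Gamma (n.+1%:R - a) / n`!%:R.
Proof.
move=> a1; have s0 : 0 < n.+1%:R - a.
  by rewrite subr_gt0 (lt_le_trans a1)// ler1n.
rewrite mulrC Gammaw -RintegralZl//; last by apply: iw => //; left.
apply: eq_Rintegral => y; rewrite inE/= in_itv/= andbT => y0.
rewrite /gamma_density /w mul1r -addrAC -natr1 addrK powRD ?(gt_eqF y0) ?implybT//.
by rewrite powR_mulrn ?(ltW y0)//; ring.
Qed.

(** The density is the derivative of the square of [poisson_tail]. It is a sum of
    products of two exponentials, and rescaling [expR (- (2 * y))] to [expR (- y)]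
    produces the powers of 2 in [var_coef]. *)
Lemma integral_tail_gamma_density_powR n a : a < 1 ->
  \int[mu]_(y in `]0, +oo[) (2 * poisson_tail n.+1 y * gamma_density n y * y `^ (- a)) =
  Gamma (n.+1%:R - a) / n`!%:R - var_coef a n.+1.
Proof.
move=> a1; have s0 i : 0 < i%:R + n.+1%:R - a.
  by rewrite -addrA ltr_wpDl// subr_gt0 (lt_le_trans a1)// ler1n.
have Rsum (m : nat) : (\int[mu]_(y in `]0, +oo[)
      (\sum_(i < m) 2 / (i`!%:R * n`!%:R) * w (i%:R + n.+1%:R - a) 2 y) =
    \sum_(i < m) 2 / (i`!%:R * n`!%:R) * (Gamma (i%:R + n.+1%:R - a) / 2 `^ (i%:R + n.+1%:R - a)))
  /\ mu.-integrable (`]0, +oo[%classic : set R)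
     (EFin \o (fun y => \sum_(i < m) 2 / (i`!%:R * n`!%:R) * w (i%:R + n.+1%:R - a) 2 y)).
  have i1 i : mu.-integrable (`]0, +oo[%classic : set R)
      (EFin \o (fun y => 2 / (i`!%:R * n`!%:R) * w (i%:R + n.+1%:R - a) 2 y)).
    have := @integrableZl _ _ _ mu _ D0 (2 / (i`!%:R * n`!%:R)) _ (iw (s0 i) (or_intror erefl)).
    exact.
  elim: m => [|m [IH1 IH2]].
    split.
      by rewrite big_ord0 /Rintegral integral0_eq// => y _; rewrite big_ord0.
    rewrite (_ : EFin \o _ = cst 0%E); first exact: integrable0.
    by apply/funext => y /=; rewrite big_ord0.
  split; last first.
    apply: (@eq_integrable _ _ _ mu _ D0 _ _ _ (@integrableD _ _ _ mu _ D0 _ _ IH2 (i1 m))).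
    by move=> y _ /=; rewrite big_ord_recr.
  rewrite big_ord_recr/= -IH1 -Gammaw2// -RintegralZl//; last by apply: iw => //; right.
  by rewrite -RintegralD//; apply: eq_Rintegral => y _; rewrite big_ord_recr.
have [S1 S2] := Rsum n.+1.
have iG : mu.-integrable (`]0, +oo[%classic : set R) (EFin \o (fun y => 2 / n`!%:R * w (n.+1%:R - a) 1 y)).
  have s1 : 0 < n.+1%:R - a by have := s0 0%N; rewrite add0r.
  have := @integrableZl _ _ _ mu _ D0 (2 / n`!%:R) _ (iw s1 (or_introl erefl)).
  exact.
transitivity (\int[mu]_(y in `]0, +oo[) (2 / n`!%:R * w (n.+1%:R - a) 1 y -
    \sum_(i < n.+1) 2 / (i`!%:R * n`!%:R) * w (i%:R + n.+1%:R - a) 2 y)).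
  apply: eq_Rintegral => y; rewrite inE/= in_itv/= andbT => y0.
  have yn : y `^ (n.+1%:R - a - 1) = y ^+ n * y `^ (- a).
    by rewrite -addrAC -natr1 addrK powRD ?(gt_eqF y0) ?implybT// powR_mulrn ?(ltW y0).
  have yi (i : nat) : y `^ (i%:R + n.+1%:R - a - 1) = y ^+ i * (y ^+ n * y `^ (- a)).
    by rewrite -!addrA powRD ?(gt_eqF y0) ?implybT// powR_mulrn ?(ltW y0)// addrA yn.
  have e2 : expR (- (2 * y)) = expR (- y) * expR (- y) by rewrite -expRD; congr expR; ring.
  rewrite /w yn mul1r /poisson_tail mulrBr mulr1 !mulrBl; congr (_ - _).
    by rewrite /gamma_density; ring.
  rewrite mulr_sumr !mulr_suml; apply: eq_bigr => i _.
  rewrite yi e2 /gamma_density; field.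
  by rewrite !pnatr_eq0 -!lt0n !fact_gt0.
rewrite RintegralB// S1 RintegralZl//; last first.
  by apply: iw; [have := s0 0%N; rewrite add0r|left].
rewrite -Gammaw /var_coef /= (_ : \sum_(i < n.+1) _ = n`!%:R^-1 *
  ((2 `^ (n.+1%:R - 1 - a))^-1 * \sum_(i < n.+1) Gamma (i%:R + n.+1%:R - a) / (i`!%:R * 2 ^+ i))).
  by ring.
rewrite !mulr_sumr; apply: eq_bigr => i _.
have -> : (2 : R) `^ (i%:R + n.+1%:R - a) = 2 ^+ i * 2 `^ (n.+1%:R - 1 - a) * 2.
  rewrite -addrA powRD ?pnatr_eq0 ?implybT// powR_mulrn// -mulrA; congr (_ * _).
  rewrite -{3}(powRr1 (ler0n R 2)) -powRD ?pnatr_eq0 ?implybT//; congr powR; ring.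
field.
by rewrite !pnatr_eq0 -!lt0n !fact_gt0 expf_neq0 ?pnatr_eq0//= gt_eqF ?powR_gt0.
Qed.

End gamma_integrals.

Lemma regular_variation_rho (R : realType) (p : nat -> R) (alpha : R) (L : R -> R) :
  slowly_varying L -> asymp_equiv (rho p) (fun t => t `^ alpha * L t) ->
  forall l, 0 < l -> rho p (l * t) / rho p t @[t --> +oo] --> l `^ alpha.
Proof.
move=> [[a [L0 _]] sv] hrho l l0.
have lt_oo : l * t @[t --> +oo] --> +oo.
  apply/cvgryPge => A.
  have h : \forall t \near +oo, l^-1 * A <= t by apply: nbhs_pinfty_ge; rewrite num_real.
  by apply: filterS h => t; rewrite ler_pdivrMl.
have h1 : rho p (l * t) / ((l * t) `^ alpha * L (l * t)) @[t --> +oo] --> (1 : R).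
  exact: (@cvg_comp _ _ _ (fun t => l * t) (fun t => rho p t / (t `^ alpha * L t)) _ _ _ lt_oo hrho).
have h2 : (rho p t / (t `^ alpha * L t))^-1 @[t --> +oo] --> (1 : R).
  by rewrite -[X in _ --> X]invr1; apply: cvgV => //; exact: oner_neq0.
have h : rho p (l * t) / ((l * t) `^ alpha * L (l * t)) * (l `^ alpha * (L (l * t) / L t)) *
    (rho p t / (t `^ alpha * L t))^-1 @[t --> +oo] --> l `^ alpha.
  rewrite -[X in _ --> X]mulr1; apply: cvgM => //; rewrite -[X in _ --> X]mul1r; apply: cvgM => //.
  by rewrite -[X in _ --> X]mulr1; apply: cvgM; [exact: cvg_cst|exact: sv].
apply: cvg_trans h; apply: near_eq_cvg; near=> t => /=.
have t0 : 0 < t by near: t; exact: nbhs_pinfty_gt.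
have Lt : 0 < L t by apply: L0; near: t; apply: nbhs_pinfty_gt; rewrite num_real.
have Llt : 0 < L (l * t).
  apply: L0; rewrite -ltr_pdivrMl//; near: t; apply: nbhs_pinfty_gt.
  by rewrite num_real.
rewrite powRM ?(ltW l0) ?(ltW t0)// invf_div.
move: (rho p t)^-1 => r; field.
by rewrite !gt_eqF ?powR_gt0//=.
Unshelve. all: by end_near. Qed.

Lemma nneseries_lim (R : realType) (f : nat -> R) (l : R) : (forall k, 0 <= f k) ->
  \sum_(k < n) f k @[n --> \oo] --> l -> (\sum_(0 <= k <oo) (f k)%:E = l%:E)%E.
Proof.
move=> f0 fl; apply/cvg_lim => //; apply: cvg_EFin.
  by apply: nearW => n; rewrite sumEFin.
apply: cvg_trans fl; apply: near_eq_cvg; apply: nearW => n /=.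
by rewrite sumEFin/= big_mkord.
Qed.

Lemma ler_lim_le (R : realType) (u v : nat -> R) (a b : R) :
  u n @[n --> \oo] --> a -> v n @[n --> \oo] --> b -> (forall n, u n <= v n) -> a <= b.
Proof.
move=> ua vb uv; rewrite -(cvg_lim _ ua)// -(cvg_lim _ vb)//; apply: ler_lim.
- by apply/cvg_ex; exists a.
- by apply/cvg_ex; exists b.
- exact: nearW.
Qed.

Section moment_asymptotics.
Context (R : realType) (p : nat -> R) (alpha : R).
Notation mu := (@lebesgue_measure R).
Hypothesis hp : discrete_distribution p.
Hypothesis alpha01 : 0 < alpha < 1.
Hypothesis rv : forall l, 0 < l -> rho p (l * t) / rho p t @[t --> +oo] --> l `^ alpha.
Implicit Types s t : R.

Let p0 k : 0 <= p k. Proof. exact: hp.1. Qed.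
Let a1 : alpha < 1. Proof. by case/andP: alpha01. Qed.

Lemma rho_cvg t : 0 < t ->
  \sum_(k < m) ((1 <= p k * t)%R : bool)%:R @[m --> \oo] --> rho p t.
Proof.
move=> t0; have [//||e + _ _] := @nneseries_cvg _ (fun k => ((1 <= p k * t)%R : bool)%:R) (rho p t).
- move=> m; rewrite -lee_fin rho_series//; apply: le_trans (nneseries_lim_ge m _) => //.
  by rewrite sumEFin big_mkord.
- by rewrite -rho_series.
Qed.

(** The density of [poisson_tail] is a gamma density. *)
Lemma mean_occ_rho n : mean_occ p n.+1 t / rho p t @[t --> +oo] -->
  Gamma (n.+1%:R - alpha) / n`!%:R.
Proof.
rewrite -(integral_gamma_density_powR n a1).
apply: (integral_rho_asymptotics hp alpha01 rv (C := 1) (n := n)) => //.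
- by apply: continuous_measurable_fun; exact: continuous_gamma_density.
- by move=> y y0; rewrite mul1r lexx gamma_density_ge0// ltW.
- move=> t t0; rewrite mean_occE ?(ltW t0)//.
  apply: (@series_integral_rho _ p hp (gamma_density n)) => //.
  + by apply: continuous_measurable_fun; exact: continuous_gamma_density.
  + by move=> y y0; rewrite gamma_density_ge0.
  + move=> x x0; apply: integral_antiderivative0 => //.
    * exact: continuous_gamma_density.
    * by move=> z; exact: is_derive_poisson_tail.
    * exact: poisson_tail0.
Qed.

(** The variance is the mean minus the sum of the squares of the probabilities. *)
Lemma var_occ_rho n : var_occ p n.+1 t / rho p t @[t --> +oo] --> var_coef alpha n.+1.
Proof.
pose g y := 2 * poisson_tail n.+1 y * gamma_density n y : R.
have cg : continuous g.
  move=> y; apply: cvgM; last exact: continuous_gamma_density.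
  by apply: cvgM; [exact: cvg_cst|exact: continuous_poisson_tail].
have key : (mean_occ p n.+1 t - var_occ p n.+1 t) / rho p t @[t --> +oo] -->
    Gamma (n.+1%:R - alpha) / n`!%:R - var_coef alpha n.+1.
  rewrite -(integral_tail_gamma_density_powR n a1).
  apply: (integral_rho_asymptotics hp alpha01 rv (C := 2) (n := n) (g := g)) => //.
  - exact: continuous_measurable_fun.
  - move=> y y0; rewrite /g -mulrA mulr_ge0//=; last first.
      by rewrite mulr_ge0 ?poisson_tail_ge0 ?gamma_density_ge0// ltW.
    by rewrite ler_wpM2l// ler_piMl ?poisson_tail_le1 ?gamma_density_ge0// ltW.
  - move=> t t0; rewrite -(@series_integral_rho _ p hp g (fun x => poisson_tail n.+1 x ^+ 2))//.
    + have c : \sum_(k < m) poisson_tail n.+1 (p k * t) ^+ 2 @[m --> \oo] -->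
          mean_occ p n.+1 t - var_occ p n.+1 t.
        have h : \sum_(k < m) poisson_tail n.+1 (p k * t) -
            \sum_(k < m) poisson_tail n.+1 (p k * t) * (1 - poisson_tail n.+1 (p k * t)) @[m --> \oo]
            --> mean_occ p n.+1 t - var_occ p n.+1 t.
          by apply: cvgB; [exact/mean_occ_cvg/ltW|exact/var_occ_cvg/ltW].
        apply: cvg_trans h; apply: near_eq_cvg; apply: nearW => m /=.
        by rewrite -sumrB; apply: eq_bigr => k _; ring.
      by rewrite (nneseries_lim _ c)// => k; rewrite sqr_ge0.
    + exact: continuous_measurable_fun.
    + by move=> y y0; have h1 := poisson_tail_ge0 n.+1 y0; have h2 := gamma_density_ge0 n y0; do 2 apply: mulr_ge0 => //.
    + move=> x x0; apply: (@integral_antiderivative0 _ g (fun x => poisson_tail n.+1 x ^+ 2)) => //.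
      * move=> z; have := is_derive_poisson_tail n z => dz.
        by apply: is_derive_eq; rewrite /g /GRing.scale/=; ring.
      * by rewrite poisson_tail0 expr0n.
have h : mean_occ p n.+1 t / rho p t - (mean_occ p n.+1 t - var_occ p n.+1 t) / rho p t
    @[t --> +oo] --> Gamma (n.+1%:R - alpha) / n`!%:R -
      (Gamma (n.+1%:R - alpha) / n`!%:R - var_coef alpha n.+1).
  by apply: cvgB key; exact: mean_occ_rho.
rewrite opprB addrCA subrr addr0 in h.
apply: cvg_trans h; apply: near_eq_cvg; apply: nearW => t /=.
by rewrite -mulrBl opprB addrCA subrr addr0.
Qed.

Let rho_le_mean n t : 0 < t -> poisson_tail n.+1 1 * rho p t <= mean_occ p n.+1 t.
Proof.
move=> t0.
rewrite -lee_fin mean_occE ?(ltW t0)// EFinM rho_series// -nneseriesZl//.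
apply: lee_nneseries => [k _|k _]; first by rewrite -EFinM lee_fin mulr_ge0// poisson_tail_ge0.
rewrite -EFinM lee_fin; case: (leP 1 (p k * t)) => h; last by rewrite mulr0 poisson_tail_ge0// mulr_ge0// ltW.
by rewrite mulr1 -subr_ge0; case/andP: (poisson_tail_incr n (ler01 : 0 <= 1 :> R) h).
Qed.

(** A box with [1 <= p k * t] reaches the level with a probability bounded below. *)
Lemma mean_coef_gt0 n : 0 < Gamma (n.+1%:R - alpha) / n`!%:R :> R.
Proof.
apply: lt_le_trans (@poisson_tail_gt0 R n 1 ltr01) _.
have h : mean_occ p n.+1 t / rho p t @[t --> +oo] --> Gamma (n.+1%:R - alpha) / n`!%:R
  by exact: mean_occ_rho.
rewrite -(cvg_lim _ h)//; apply: limr_ge; first by apply/cvg_ex; eexists; exact: h.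
near=> t; rewrite ler_pdivlMr.
  by apply: rho_le_mean; near: t; exact: nbhs_pinfty_gt.
by near: t; exact: (rho_gt0_near rv).
Unshelve. all: by end_near. Qed.

(** A box with [1 <= p k * t < 2] contributes at least a positive constant to the
    variance, and the number of these boxes is of the order of [rho p t] since
    [2 `^ alpha > 1]. *)
Lemma var_coef_gt0 n : 0 < var_coef alpha n.+1.
Proof.
pose m := poisson_tail n.+1 1 * expR (- 2) : R.
have m0 : 0 < m by rewrite mulr_gt0 ?poisson_tail_gt0 ?expR_gt0.
have lb t : 0 < t -> m * (rho p t - rho p (t / 2)) <= var_occ p n.+1 t.
  move=> t0; have t20 : 0 < t / 2 by rewrite divr_gt0.
  apply: (ler_lim_le (cvgM (@cvg_cst _ m _ \oo _) (cvgB (rho_cvg t0) (rho_cvg t20))) (@var_occ_cvg _ _ hp n _ (ltW t0))) => i /=.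
  rewrite !fctE -sumrB mulr_sumr; apply: ler_sum => k _.
  have pt0 : 0 <= p k * t by rewrite mulr_ge0// ltW.
  have h0 := poisson_tail_ge0 n.+1 pt0; have h1 := poisson_tail_le1 n.+1 pt0.
  have v0 : 0 <= poisson_tail n.+1 (p k * t) * (1 - poisson_tail n.+1 (p k * t)).
    by rewrite mulr_ge0// subr_ge0.
  rewrite mulrA ler_pdivlMr// mul1r.
  case: (leP 2 (p k * t)) => [pt2|pt2]; first by rewrite (le_trans _ pt2) ?ler1n// subrr mulr0.
  case: (leP 1 (p k * t)) => [pt1|pt1]; last by rewrite subrr mulr0.
  rewrite subr0 mulr1 ler_pM ?expR_ge0 ?poisson_tail_ge0//.
    by rewrite -subr_ge0; case/andP: (poisson_tail_incr n (ler01 : 0 <= 1 :> R) pt1).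
  by apply: le_trans (poisson_tail_compl n pt0); rewrite ler_expR lerN2 ltW.
have h : var_occ p n.+1 t / rho p t @[t --> +oo] --> var_coef alpha n.+1 by exact: var_occ_rho.
have h2 : m * (1 - rho p (2^-1 * t) / rho p t) @[t --> +oo] --> m * (1 - 2^-1 `^ alpha).
  by apply: cvgM; [exact: cvg_cst|apply: cvgB; [exact: cvg_cst|apply: rv; rewrite invr_gt0]].
apply: (@lt_le_trans _ _ (m * (1 - 2^-1 `^ alpha))).
  rewrite mulr_gt0// subr_gt0 -powR_inv1// -powRrM mulN1r powRN invf_lt1 ?powR_gt0//.
  by rewrite /powR pnatr_eq0/= expR_gt1 mulr_gt0 ?ln_gt0 ?ltr1n//; case/andP: alpha01.
rewrite -(cvg_lim _ h)// -(cvg_lim _ h2)//; apply: ler_lim.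
- by apply/cvg_ex; eexists; exact: h2.
- by apply/cvg_ex; eexists; exact: h.
near=> t.
have r0 : 0 < rho p t by near: t; exact: (rho_gt0_near rv).
rewrite ler_pdivlMr// -mulrA mulrBl mul1r mulfVK ?gt_eqF// mulrC [2^-1 * _]mulrC mulrC.
by apply: lb; near: t; exact: nbhs_pinfty_gt.
Unshelve. all: by end_near. Qed.

End moment_asymptotics.

Section window_remainder.
Context (R : realType) (p : nat -> R) (alpha : R).
Notation mu := (@lebesgue_measure R).
Hypothesis hp : discrete_distribution p.
Hypothesis alpha01 : 0 < alpha < 1.
Hypothesis rv : forall l, 0 < l -> rho p (l * t) / rho p t @[t --> +oo] --> l `^ alpha.
Implicit Types s t : R.

Let p0 k : 0 <= p k. Proof. exact: hp.1. Qed.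
Let a0 : 0 < alpha. Proof. by case/andP: alpha01. Qed.
Let a1 : alpha < 1. Proof. by case/andP: alpha01. Qed.

(** The gamma density cut off beyond [de], which sees the boxes with [p k * t <= de];
    its primitive is [poisson_tail] stopped at [de]. *)
Let gd n (de y : R) := gamma_density n y * ((y <= de)%R : bool)%:R.

Let mle (de : R) : measurable_fun setT (fun y : R => ((y <= de)%R : bool)%:R : R).
Proof.
rewrite (_ : (fun _ => _) = \1_(`]-oo, de]%classic)); first exact: measurable_indic.
by apply/funext => y; rewrite indicE; congr ((_ : bool)%:R); apply/idP/idP; rewrite inE/= in_itv.
Qed.

Let mgam n : measurable_fun (setT : set R) (gamma_density n).
Proof. by apply: continuous_measurable_fun; exact: continuous_gamma_density. Qed.

Let mgd n de : measurable_fun (setT : set R) (gd n de).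
Proof. exact: measurable_funM. Qed.

Let integral_gd n de x : 0 < de -> 0 <= x ->
  (\int[mu]_(y in `]0%R, x]) (gd n de y)%:E = (poisson_tail n.+1 (Num.min x de))%:E)%E.
Proof.
move=> de0 x0; transitivity (\int[mu]_(y in `]0%R, Num.min x de]) (gamma_density n y)%:E)%E.
  rewrite [LHS]integral_mkcond [RHS]integral_mkcond/=; apply: eq_integral => y _; rewrite !patchE.
  have -> : (y \in `]0%R, x]%classic) = (0 < y <= x) by apply/idP/idP; rewrite inE/= in_itv.
  have -> : (y \in `]0%R, Num.min x de]%classic) = (0 < y <= Num.min x de).
    by apply/idP/idP; rewrite inE/= in_itv.
  rewrite /gd le_min; case: (0 < y) => //=; case: (y <= x) => //=.
  by case: (y <= de); rewrite ?mulr1 ?mulr0.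
apply: integral_antiderivative0.
- by rewrite le_min x0 ltW.
- exact: continuous_gamma_density.
- by move=> z; exact: is_derive_poisson_tail.
- exact: poisson_tail0.
Qed.

Let D0 : measurable (`]0, +oo[%classic : set R). Proof. exact: measurable_itv. Qed.

Let small_mass n e : 0 < e -> exists2 de, 0 < de &
  \int[mu]_(y in `]0, +oo[) (gd n de y * y `^ (- alpha)) < e.
Proof.
move=> e0.
pose f (m : nat) y := (gd n m.+1%:R^-1 y * y `^ (- alpha))%:E.
have mf m : measurable_fun (`]0, +oo[%classic : set R) (f m).
  by apply/measurable_EFinP/measurable_funTS; apply: measurable_funM; [exact: mgd|exact: measurable_powR].
have g0 y : 0 < y -> 0 <= gamma_density n y * y `^ (- alpha).
  by move=> y0; rewrite mulr_ge0 ?powR_ge0// gamma_density_ge0// ltW.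
have idom : mu.-integrable (`]0, +oo[%classic : set R)
    (EFin \o (fun y => gamma_density n y * y `^ (- alpha))).
  apply/integrableP; split.
    by apply/measurable_EFinP/measurable_funTS; apply: measurable_funM; [exact: mgam|exact: measurable_powR].
  apply: le_lt_trans (integral_gamma_density_powR_lty n a1).
  rewrite le_eqVlt; apply/orP; left; apply/eqP; apply: eq_integral => y.
  by rewrite inE/= in_itv/= andbT => y0; rewrite ger0_norm// g0.
have [||//|intg _ cvgint] := @dominated_convergence _ _ _ mu _ D0 f
    (cst 0%E) _ mf _ _ idom.
- exact: measurable_cst.
- apply: aeW => y; rewrite /= in_itv/= andbT => y0.
  apply: cvg_near_cst; near=> m; rewrite /f /gd.
  suff -> : (y <= m.+1%:R^-1) = false by rewrite mulr0 mul0r.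
  apply/negbTE; rewrite -ltNge; near: m.
  exact: (near_infty_natSinv_lt (PosNum y0)).
- apply: aeW => y m; rewrite /= in_itv/= andbT => y0; rewrite lee_fin /gd.
  have := g0 y y0; case: (y <= m.+1%:R^-1); rewrite ?mulr1 ?mulr0 ?mul0r ?normr0// => h.
  by rewrite ger0_norm.
rewrite integral0 in cvgint.
have hc : \int[mu]_(y in `]0, +oo[) (gd n m.+1%:R^-1 y * y `^ (- alpha)) @[m --> \oo] --> (0 : R).
  exact: (@fine_cvg _ _ _ _ _ 0 cvgint).
have /cvgrPdist_lt/(_ _ e0)[m _ /(_ m (leqnn m))] := hc.
rewrite /= sub0r normrN => h.
exists m.+1%:R^-1; first by rewrite invr_gt0.
by apply: le_lt_trans h; rewrite ler_norm.
Unshelve. all: by end_near. Qed.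

Definition in_window B t k := (1 <= p k * t * B) && (p k * t < B).

(** The boxes with a small [p k * t] contribute little, as the density has a small
    mass near [0]; those with [B <= p k * t] are at most [rho p (t / B)], about
    [B `^ (- alpha) * rho p t], in number. *)
Lemma window_remainder n de : 0 < de -> exists2 B, 2 <= B &
  \forall t \near +oo, forall m,
    \sum_(k < m) (~~ in_window B t k)%:R *
      (poisson_tail n.+1 (p k * t) * (1 - poisson_tail n.+1 (p k * t))) <= de * var_occ p n.+1 t.
Proof.
move=> de0; pose c := var_coef alpha n.+1.
have c0 : 0 < c by exact: (var_coef_gt0 hp alpha01 rv).
pose e := de * c / 8; have e0 : 0 < e by rewrite /e divr_gt0// mulr_gt0.
have [eta eta0 small] := small_mass n e0.
(* the two bounds give half of the desired remainder each *)
pose B := Num.max 2 (Num.max eta^-1 ((e^-1) `^ alpha^-1)).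
have B2 : 2 <= B by rewrite le_max lexx.
have B0 : 0 < B by exact: lt_le_trans B2.
have Beta : B^-1 <= eta.
  by rewrite -[leRHS]invrK lef_pV2 ?posrE ?invr_gt0// /B !le_max lexx !orbT.
have Bal : B^-1 `^ alpha <= e.
  rewrite -powR_inv1 ?(ltW B0)// -powRrM mulN1r powRN -[leRHS]invrK.
  rewrite lef_pV2 ?posrE ?invr_gt0 ?powR_gt0//.
  have -> : e^-1 = ((e^-1) `^ alpha^-1) `^ alpha.
    by rewrite -powRrM mulVf ?gt_eqF// powRr1// invr_ge0 ltW.
  by apply: ge0_ler_powR; rewrite ?nnegrE ?powR_ge0 ?(ltW a0) ?(ltW B0)// /B !le_max lexx !orbT.
exists B => //.
have ser t : 0 <= t -> [/\
    ((fine (\sum_(0 <= k <oo) (poisson_tail n.+1 (Num.min (p k * t) eta))%:E))%:E =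
      \sum_(0 <= k <oo) (poisson_tail n.+1 (Num.min (p k * t) eta))%:E)%E &
    forall m, \sum_(k < m) poisson_tail n.+1 (Num.min (p k * t) eta) <=
      fine (\sum_(0 <= k <oo) (poisson_tail n.+1 (Num.min (p k * t) eta))%:E)%E].
  move=> t0; have h k : 0 <= Num.min (p k * t) eta by rewrite le_min mulr_ge0// ltW.
  have [||//] := @nneseries_cvg _ (fun k => poisson_tail n.+1 (Num.min (p k * t) eta)) t.
  - by move=> k; rewrite poisson_tail_ge0.
  - move=> m; apply: (@le_trans _ _ (\sum_(k < m) p k * t)).
      by apply: ler_sum => k _; rewrite (le_trans (poisson_tail_le_id n (h k)))// ge_min lexx.
    by rewrite -mulr_suml ler_piMl// sum_prob_le1.
pose A t := fine (\sum_(0 <= k <oo) (poisson_tail n.+1 (Num.min (p k * t) eta))%:E)%E.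
have cA : A t / rho p t @[t --> +oo] -->
    \int[mu]_(y in `]0, +oo[) (gd n eta y * y `^ (- alpha)).
  apply: (integral_rho_asymptotics hp alpha01 rv (C := 1) (n := n)) => //.
  - move=> y y0; have h := gamma_density_ge0 n (ltW y0).
    by rewrite mul1r /gd; case: (y <= eta); rewrite ?mulr1 ?mulr0 ?h lexx.
  - move=> t t0; rewrite /A (ser t (ltW t0)).1.
    apply: (@series_integral_rho _ p hp (gd n eta) (fun x => poisson_tail n.+1 (Num.min x eta))) => //.
    + by move=> y y0; rewrite /gd mulr_ge0// gamma_density_ge0.
    + by move=> x x0; exact: integral_gd.
have B1 : 0 < B^-1 by rewrite invr_gt0.
near=> t => m.
have t0 : 0 < t by near: t; exact: nbhs_pinfty_gt.
have r0 : 0 < rho p t by near: t; exact: (rho_gt0_near rv).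
have hA : A t <= 2 * e * rho p t.
  rewrite -ler_pdivrMr//; near: t.
  have /cvgrPdist_lt/(_ _ e0) := cA; apply: filterS => t.
  by rewrite ltr_distlC => /andP[_ /ltW/le_trans]; apply; rewrite mulr_natl mulr2n lerD2r ltW.
have hB : rho p (B^-1 * t) <= 2 * e * rho p t.
  rewrite -ler_pdivrMr//; near: t.
  have /cvgrPdist_lt/(_ _ e0) := rv B1; apply: filterS => t.
  by rewrite ltr_distlC => /andP[_ /ltW/le_trans]; apply; rewrite mulr_natl mulr2n lerD2r.
have hV : c / 2 * rho p t <= var_occ p n.+1 t.
  rewrite -ler_pdivlMr//; near: t.
  have c20 : 0 < c / 2 by rewrite divr_gt0.
  have /cvgrPdist_lt/(_ _ c20) : var_occ p n.+1 t / rho p t @[t --> +oo] --> c by exact: var_occ_rho.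
  by apply: filterS => t; rewrite ltr_distlC => /andP[/ltW h _]; apply: le_trans h; rewrite -/c; lra.
apply: (@le_trans _ _ (de * (c / 2 * rho p t))); last by rewrite ler_wpM2l// ltW.
have -> : de * (c / 2 * rho p t) = 2 * e * rho p t + 2 * e * rho p t by rewrite /e; field.
apply: (@le_trans _ _ (A t + rho p (B^-1 * t))); last exact: lerD.
have Bt0 : 0 < B^-1 * t by exact: mulr_gt0.
apply: (@le_trans _ _ (\sum_(k < m) poisson_tail n.+1 (Num.min (p k * t) eta) +
    \sum_(k < m) ((1 <= p k * (B^-1 * t))%R : bool)%:R)); last first.
  apply: lerD; first by have [_] := ser t (ltW t0); exact.
  rewrite -lee_fin rho_series//; apply: le_trans (nneseries_lim_ge m _) => //.
  by rewrite sumEFin big_mkord.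
rewrite -big_split/=; apply: ler_sum => k _.
have pt0 : 0 <= p k * t by rewrite mulr_ge0// ltW.
have h0 := poisson_tail_ge0 n.+1 pt0; have h1 := poisson_tail_le1 n.+1 pt0.
have m0 : 0 <= poisson_tail n.+1 (Num.min (p k * t) eta).
  by rewrite poisson_tail_ge0// le_min pt0 ltW.
rewrite /in_window negb_and -!ltNge -leNgt.
have [lo|lo] /= := ltP (p k * t * B) 1.
  rewrite mul1r (min_idPl _); last by rewrite (le_trans _ Beta)// -[B^-1]mul1r ler_pdivlMr// ltW.
  by rewrite (@le_trans _ _ (poisson_tail n.+1 (p k * t)))// ?lerDl// ler_piMr// lerBlDr lerDl.
have [hi|hi] := leP B (p k * t); last by rewrite mul0r addr_ge0.
have -> : (1 <= p k * (B^-1 * t))%R by rewrite mulrCA mulrC ler_pdivlMr// mul1r.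
rewrite mul1r (@le_trans _ _ 1)// ?lerDr//.
by rewrite mulr_ile1// ?subr_ge0// lerBlDr lerDl.
Unshelve. all: by end_near. Qed.

End window_remainder.

(** * Increments of the occupancy *)

Section occupancy_increments.
Context d (T : measurableType d) (R : realType) (P : probability T R).
Variables (p : nat -> R) (X : nat -> {RV P >-> nat}) (E : nat -> {RV P >-> R}).
Hypothesis hp : discrete_distribution p.
Hypothesis hXE : poissonized_karlin p X E.

Local Notation ball_count := (ball_count X E).
Local Notation occ := (occupied X E).
Local Notation regular := (regular E).

(** The times depend on the box so that each box can be observed over an interval
    of its own. *)
Definition arrival j (s t : nat -> R) k w : R :=
  (crosses j (ball_count k (-1) (s k) w) (ball_count k (s k) (t k) w))%:R.

Lemma arrival_independent j s t : (forall k, 0 <= s k <= t k) ->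
  independent_indicators P (arrival j s t) (crossing_prob p s t j).
Proof.
move=> st; split.
- by move=> k; case: (bm_crosses X E s t j k).
- by move=> k w; rewrite /arrival; case: crosses; [right|left].
- by move=> n y; exact: (mean_prod_crosses hXE st).
Qed.

(** So that almost surely no ball is thrown at the time [0]: an arrival after [0] then
    only says that the level is reached. *)
Lemma ae_first_gap_gt0 : {ae P, forall w, 0 < E 0%N w}.
Proof.
exists (E 0%N @^-1` `]-oo, 0]%classic); split.
- exact: measurable_funPTI.
- rewrite (increment_law hXE)// /exponential_prob.
  rewrite -(integral_itv_bndo_bndc (r := 0)); last first.
    by apply/measurable_EFinP; apply: measurable_funTS; exact: measurable_exponential_pdf.
  rewrite integral0_eq// => x /=.
  by rewrite in_itv/= => x0; rewrite lt0_exponential_pdf.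
- by move=> w /= /negP; rewrite -leNgt in_itv.
Qed.

Lemma ball_count_start w k : regular w -> 0 < E 0%N w -> ball_count k (-1) 0 w = 0%N.
Proof.
move=> rw E0; have [n tn] := rw.2 0.
rewrite (ball_countE _ _ _ rw tn) big1// => i _; rewrite regular_lands_from_start//.
suff -> : (gap_sum E i.+1 w <= 0) = false by [].
apply/negbTE; rewrite -ltNge /gap_sum big_ord_recl ltr_wpDr// sumr_ge0// => l _.
exact: rw.1.
Qed.

Section increment.
Variables (n : nat) (s t : R).
Hypotheses (s0 : 0 <= s) (st : s <= t).
Let K := occupancy X E n.+1.

Let stk (k : nat) : 0 <= cst s k <= cst t k. Proof. by rewrite /= s0 st. Qed.
Let t0 : 0 <= t. Proof. exact: le_trans st. Qed.

Lemma arrival_series : {ae P, forall w,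
  \sum_(k < m) arrival n.+1 (cst s) (cst t) k w @[m --> \oo] --> K t w - K s w}.
Proof.
apply: filterS (ae_regular hXE) => w rw.
have [N hN] := occupancy_series X s rw (ltn0Sn n).
have [N' hN'] := occupancy_series X t rw (ltn0Sn n).
apply: cvg_near_cst; near=> m.
have Nm : (N <= m)%N by near: m; exact: nbhs_infty_ge.
have N'm : (N' <= m)%N by near: m; exact: nbhs_infty_ge.
rewrite /K (hN m Nm) (hN' m N'm) -sumrB; apply: eq_bigr => k _.
by rewrite /arrival crossesE// st andbT (le_trans _ s0)// lerN10.
Unshelve. all: by end_near. Qed.

Lemma crossing_prob_series :
  \sum_(k < m) crossing_prob p (cst s) (cst t) n.+1 k @[m --> \oo] -->
    mean_occ p n.+1 t - mean_occ p n.+1 s.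
Proof.
rewrite /crossing_prob; under eq_fun do rewrite sumrB.
by apply: cvgB; exact: mean_occ_cvg.
Qed.

(** The variance of an increment is at most its mean, and [1 + `|h| <= 2]. *)
Lemma mean_exp_increment h : `|h| <= 1 ->
  (\int[P]_w (expR (h * ((K t w - K s w) - (mean_occ p n.+1 t - mean_occ p n.+1 s))))%:E <=
   (expR ((mean_occ p n.+1 t - mean_occ p n.+1 s) * h ^+ 2))%:E)%E.
Proof.
move=> h1; have DqI := arrival_independent n.+1 stk.
set a := mean_occ p n.+1 t - mean_occ p n.+1 s.
pose q := crossing_prob p (cst s) (cst t) n.+1.
have q01 k : 0 <= q k <= 1 := indicator_prob01 DqI k.
have qa : \sum_(k < m) q k @[m --> \oo] --> a by exact: crossing_prob_series.
have vle m : variance_sum q m <= a.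
  apply: (@le_trans _ _ (\sum_(k < m) q k)).
    apply: ler_sum => k _; have /andP[h2 h3] := q01 k.
    by rewrite ler_piMr// lerBlDr lerDl.
  rewrite -(cvg_lim _ qa)//; apply: nondecreasing_cvgn_le.
    apply/nondecreasing_seqP => m'; rewrite big_ord_recr/= lerDl.
    by case/andP: (q01 m').
  by apply/cvg_ex; exists a; exact: qa.
have vc : cvgn (variance_sum q).
  apply: nondecreasing_is_cvgn.
    apply/nondecreasing_seqP => m; rewrite /variance_sum big_ord_recr/= lerDl.
    by have /andP[h2 h3] := q01 m; rewrite mulr_ge0// subr_ge0.
  by exists a => _ [m _ <-].
have mS : measurable_fun setT (fun w => K t w - K s w).
  by apply: measurable_funB; exact: measurable_occupancy.
have := mean_exp_series_le DqI mS arrival_series crossing_prob_series vc h1.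
move=> /le_trans; apply; rewrite lee_fin ler_expR.
apply: (@le_trans _ _ (a * (h ^+ 2 / 2 * (1 + `|h|)))).
  rewrite ler_wpM2r//; first by rewrite mulr_ge0 ?addr_ge0 ?divr_ge0 ?sqr_ge0.
  by apply: limr_le => //; exact: nearW.
have a0 : 0 <= a by case/andP: (mean_occ_incr hp n s0 st).
rewrite ler_wpM2l// -[leRHS](_ : h ^+ 2 / 2 * 2 = _); last by field.
by rewrite ler_wpM2l ?divr_ge0 ?sqr_ge0//; lra.
Qed.

End increment.

Section from_start.
Variables (n : nat) (t : R).
Hypotheses (t0 : 0 <= t).
Let K := occupancy X E n.+1.

Let stk (k : nat) : 0 <= cst (0 : R) k <= cst t k. Proof. by rewrite /= lexx t0. Qed.

Let q := crossing_prob p (cst 0) (cst t) n.+1.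

Let qE k : q k = poisson_tail n.+1 (p k * t).
Proof. by rewrite /q /crossing_prob /= mulr0 poisson_tail0 subr0. Qed.

Lemma arrival_series_from_start : {ae P, forall w, \sum_(k < m) arrival n.+1 (cst 0) (cst t) k w @[m --> \oo] --> K t w}.
Proof.
apply: filterS3 (ae_regular hXE) ae_first_gap_gt0 (arrival_series n (lexx 0) t0) => w rw E0.
suff -> : occupancy X E n.+1 0 w = 0 by rewrite subr0.
have [N /(_ N (leqnn N)) ->] := occupancy_series X 0 rw (ltn0Sn n).
by rewrite big1// => k _; rewrite /occupied ball_count_start.
Qed.

Let qa : \sum_(k < m) q k @[m --> \oo] --> mean_occ p n.+1 t.
Proof. by under eq_fun do under eq_bigr do rewrite qE; exact: mean_occ_cvg. Qed.

Let qv : variance_sum q m @[m --> \oo] --> var_occ p n.+1 t.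
Proof. by rewrite /variance_sum; under eq_fun do under eq_bigr do rewrite qE; exact: var_occ_cvg. Qed.

Let DqI := arrival_independent n.+1 stk.

Let mK : measurable_fun setT (K t). Proof. exact: measurable_occupancy. Qed.

Lemma mean_exp_occupancy h : `|h| <= 1 ->
  (\int[P]_w (expR (h * (K t w - mean_occ p n.+1 t)))%:E <=
   (expR (var_occ p n.+1 t * (h ^+ 2 / 2 * (1 + `|h|))))%:E)%E.
Proof. exact: (mean_exp_series_le DqI mK arrival_series_from_start qa qv). Qed.

Lemma expectation_occupancy : ('E_P[K t] = (mean_occ p n.+1 t)%:E)%E.
Proof. exact: (expectation_series DqI mK arrival_series_from_start qa). Qed.

Lemma variance_occupancy : ('V_P[K t] = (var_occ p n.+1 t)%:E)%E.
Proof. exact: (variance_series DqI mK arrival_series_from_start qa qv). Qed.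

End from_start.

End occupancy_increments.

(** * The upper bound *)

Section tail_bounds.
Context d (T : measurableType d) (R : realType) (P : probability T R).

Lemma chernoff_bound (Z : T -> R) (h c x : R) : measurable_fun setT Z -> 0 <= h ->
  (\int[P]_w (expR (h * Z w))%:E <= (expR c)%:E)%E ->
  (P [set w | (x <= Z w)%R] <= (expR (c - h * x))%:E)%E.
Proof.
move=> mZ h0 hc.
have mA : measurable [set w | x <= Z w].
  rewrite (_ : [set w | _] = Z @^-1` `[x, +oo[%classic).
    by rewrite -[X in measurable X]setTI; exact: mZ.
  by apply/seteqP; split => w; rewrite /= in_itv/= andbT.
have mexp : measurable_fun setT (fun w => (expR (h * Z w))%:E).
  by apply/measurable_EFinP; apply: measurableT_comp => //; exact: measurable_funM.
rewrite expRD mulrC EFinM; apply: (@le_trans _ _ ((expR (- (h * x)))%:E *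
    \int[P]_w (expR (h * Z w))%:E)%E); last first.
  by rewrite lee_wpmul2l// lee_fin expR_ge0.
rewrite -ge0_integralZl//.
have -> : P [set w | x <= Z w] = (\int[P]_w (\1_[set w | x <= Z w] w)%:E)%E.
  by rewrite integral_indic// setIT.
apply: ge0_le_integral => //.
- by apply/measurable_EFinP; exact: measurable_indic.
- exact: measurable_funeM.
- move=> w _; rewrite -EFinM lee_fin indicE -expRD.
  case: (boolP (w \in _)) => [|_]; last exact: expR_ge0.
  by rewrite inE/= => xZ; rewrite -expR0 ler_expR addrC subr_ge0 ler_wpM2l.
Qed.

(** The term is at most [e^-1] times the decrease of the power of exponent [- e] from
    the previous index, and these decreases telescope. *)
Lemma riemann_sum_le (e : R) n : 0 < e ->
  \sum_(k < n) expR (- ((1 + e) * ln k.+1%:R)) <= 1 + e^-1.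
Proof.
move=> e0; case: n => [|n]; first by rewrite big_ord0 addr_ge0// invr_ge0 ltW.
rewrite big_ord_recl/= ln1 mulr0 oppr0 expR0 lerD2l.
have step k : expR (- ((1 + e) * ln k.+2%:R)) <=
    e^-1 * (expR (- (e * ln k.+1%:R)) - expR (- (e * ln (k.+2%:R : R)))).
  rewrite -[leRHS]mulrC ler_pdivlMr// mulrC.
  have k2 : (0 : R) < k.+2%:R by rewrite ltr0n.
  have -> : expR (- ((1 + e) * ln k.+2%:R)) = expR (- (e * ln k.+2%:R)) / k.+2%:R.
    by rewrite mulrDl mul1r opprD expRD mulrC; congr (_ * _); rewrite expRN lnK// posrE.
  have -> : expR (- (e * ln (k.+1%:R : R))) =
      expR (- (e * ln k.+2%:R)) * expR (e * (ln k.+2%:R - ln k.+1%:R)).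
    by rewrite -expRD; congr expR; ring.
  rewrite -[X in _ - X]mulr1 -mulrBr mulrCA ler_wpM2l ?expR_ge0//.
  rewrite lerBrDl; apply: le_trans (expR_ge1Dx _); rewrite lerD2l ler_wpM2l ?(ltW e0)//.
  rewrite lerBrDl -lerBrDr.
  have -> : (k.+1%:R : R) = k.+2%:R * (1 - k.+2%:R^-1).
    by rewrite mulrBr mulr1 divff ?gt_eqF// -[in RHS]natr1 addrK.
  have k1 : (0 : R) < 1 - k.+2%:R^-1 by rewrite subr_gt0 invf_lt1// ltr1n.
  rewrite lnM ?posrE// lerD2l; apply: le_ln1Dx.
  by rewrite ltrNl opprK invf_lt1// ltr1n.
apply: (@le_trans _ _ (\sum_(k < n) e^-1 *
    (expR (- (e * ln k.+1%:R)) - expR (- (e * ln (k.+2%:R : R)))))).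
  by apply: ler_sum => k _; exact: step.
rewrite -mulr_sumr -[leRHS]mulr1 ler_wpM2l ?invr_ge0 ?(ltW e0)//.
have -> : \sum_(k < n) (expR (- (e * ln k.+1%:R)) - expR (- (e * ln (k.+2%:R : R)))) =
    1 - expR (- (e * ln (n.+1%:R : R))).
  elim: n {step} => [|n IH]; first by rewrite big_ord0 ln1 mulr0 oppr0 expR0 subrr.
  by rewrite big_ord_recr/= IH; ring.
by rewrite lerBlDr lerDl expR_ge0.
Qed.

(** The first Borel-Cantelli lemma; the bound is the term of a Riemann series with
    exponent [1 + e], in the form in which Chernoff bounds deliver it. *)
Lemma eventually_not (F : (set T)^nat) (C e : R) N : 0 < e -> 0 <= C ->
  (forall m, measurable (F m)) ->
  (forall m, (N <= m)%N -> (P (F m) <= (C * expR (- ((1 + e) * ln m.+1%:R)))%:E)%E) ->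
  {ae P, forall w, exists M, forall m, (M <= m)%N -> ~ F m w}.
Proof.
move=> e0 C0 mF PF.
pose G m := if (N <= m)%N then F m else set0.
have mG m : measurable (G m) by rewrite /G; case: ifP.
have PG m : (P (G m) <= (C * expR (- ((1 + e) * ln m.+1%:R)))%:E)%E.
  rewrite /G; case: ifPn => [/PF//|_].
  by rewrite measure0 lee_fin mulr_ge0 ?expR_ge0.
have sG : (\sum_(m <oo) P (G m) < +oo)%E.
  apply: (@le_lt_trans _ _ (C * (1 + e^-1))%:E); last exact: ltry.
  apply: lime_le; first by apply: is_cvg_nneseries.
  apply: nearW => n; apply: (@le_trans _ _ (\sum_(0 <= m < n)
      (C * expR (- ((1 + e) * ln m.+1%:R)))%:E)%E).
    by apply: lee_sum => m _.
  by rewrite sumEFin lee_fin -mulr_sumr ler_wpM2l// big_mkord riemann_sum_le.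
exists (lim_sup_set G); split.
- by apply: bigcapT_measurable => n; apply: bigcup_measurable => k _.
- exact: lim_sup_set_cvg0.
- move=> w /= h n _; apply: contrapT => hn; apply: h.
  exists (maxn n N) => m; rewrite geq_max => /andP[nm Nm] Fm; apply: hn.
  by exists m => //; rewrite /G Nm.
Qed.

End tail_bounds.

(** If the increments of [g] over the dyadic intervals of level [i] are at most
    [x i], then [g] grows by at most the sum of the [x i] on the dyadic grid: a
    point of level [i.+1] is a point of level [i] or the right neighbour of one. *)
Lemma dyadic_chaining (R : realFieldType) (g : R -> R) (y0 D : R) (x : nat -> R) I :
  (forall i, 0 <= x i) ->
  (forall i l, (i <= I)%N -> (l < 2 ^ i)%N ->
    g (y0 + D * l.+1%:R / 2 ^+ i) - g (y0 + D * l%:R / 2 ^+ i) <= x i) ->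
  forall l, (l <= 2 ^ I)%N -> g (y0 + D * l%:R / 2 ^+ I) <= g y0 + \sum_(i < I.+1) x i.
Proof.
move=> x0; elim: I => [|I IH] inc l lI.
  have [->|l1] : l = 0%N \/ l = 1%N by case: l lI => [|[|]]//; [left|right].
    by rewrite mulr0 mul0r addr0 lerDl sumr_ge0.
  have := inc 0%N 0%N (leqnn _) isT; rewrite l1 big_ord1 expr0 !divr1 mulr0 addr0.
  by rewrite lerBlDl.
have {}IH : forall l, (l <= 2 ^ I)%N -> g (y0 + D * l%:R / 2 ^+ I) <= g y0 + \sum_(i < I.+1) x i.
  by apply: IH => i l' iI; apply: inc; exact: leqW.
have half k : y0 + D * (k.*2)%:R / 2 ^+ I.+1 = y0 + D * k%:R / 2 ^+ I.
  by rewrite -muln2 natrM exprS; field; rewrite expf_neq0.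
rewrite big_ord_recr/= addrA.
rewrite -(odd_double_half l) in lI *; case: (odd l) lI => /= lI; last first.
  rewrite add0n half; apply: (@le_trans _ _ (g y0 + \sum_(i < I.+1) x i)); last by rewrite lerDl.
  by apply: IH; move: lI; rewrite add0n expnS mul2n leq_double.
have lI' : (l./2 < 2 ^ I)%N by move: lI; rewrite add1n expnS mul2n ltn_double.
rewrite add1n -lerBlDr; apply: le_trans (IH l./2 (ltnW lI')); rewrite -half.
rewrite lerBlDr -lerBlDl; apply: inc => //.
Qed.

Section logarithmic_growth.
Context (R : realType).

Lemma near_ln (A : R) : \forall m \near \oo, A <= ln (m.+1%:R : R).
Proof.
near=> m.
rewrite -ler_expR lnK ?posrE// (@le_trans _ _ (m%:R))//; last by rewrite ler_nat.
by near: m; exact: nbhs_infty_ger.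
Unshelve. all: by end_near. Qed.

Lemma near_pow (C ga : R) : 1 < ga -> \forall m \near \oo, C * ln (m.+1%:R : R) <= ga ^+ m.
Proof.
move=> ga1; have L0 : 0 < ln ga by rewrite ln_gt0.
near=> m.
apply: (@le_trans _ _ (`|C| * m%:R)).
  apply: (@le_trans _ _ (`|C| * ln (m.+1%:R : R))).
    by rewrite ler_wpM2r ?ln_ge0 ?ler1n// ler_norm.
  rewrite ler_wpM2l// -natr1 addrC; apply: le_ln1Dx.
  by rewrite (lt_le_trans (ltrN10 R)).
have -> : ga ^+ m = expR (m%:R * ln ga) by rewrite expRM_natl lnK// posrE (lt_trans ltr01).
have m0 : 0 <= m%:R * ln ga by rewrite mulr_ge0// ltW.
apply: le_trans (expR_series_le 3 m0).
rewrite /series/= big_mkord big_ord_recr/=.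
apply: (@le_trans _ _ ((m%:R * ln ga) ^+ 2 / 2)); last first.
  by rewrite lerDr sumr_ge0// => i _; rewrite divr_ge0// exprn_ge0.
have -> : (m%:R * ln ga) ^+ 2 / 2 = m%:R * ln ga ^+ 2 / 2 * m%:R by field.
rewrite ler_wpM2r// ler_pdivlMr// -ler_pdivrMr ?exprn_gt0//.
by near: m; exact: nbhs_infty_ger.
Unshelve. all: by end_near. Qed.

(** At the time of the [m]th block the logarithm of the variance is close to
    [m * L + c], so that its iterated logarithm is at least [(1 - eta) * ln m.+1]. *)
Lemma near_loglog (eta L c : R) : 0 < eta -> 0 < L ->
  \forall m \near \oo, expR ((1 - eta) * ln (m.+1%:R : R)) <= m%:R * L + c.
Proof.
move=> eta0 L0; near=> m.
have -> : expR ((1 - eta) * ln (m.+1%:R : R)) = m.+1%:R * expR (- (eta * ln m.+1%:R)).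
  by rewrite mulrBl mul1r expRD lnK// posrE.
apply: (@le_trans _ _ (m.+1%:R * (L / 2))).
  rewrite ler_wpM2l// -[leRHS]lnK ?posrE ?divr_gt0// ler_expR lerNl.
  rewrite -ler_pdivrMl//; near: m; exact: near_ln.
have : (1 - 2 * c / L) * (L / 2) <= m%:R * (L / 2).
  by rewrite ler_pM2r ?divr_gt0//; near: m; exact: nbhs_infty_ger.
have -> : (1 - 2 * c / L) * (L / 2) = L / 2 - c by field; rewrite gt_eqF.
by rewrite -[m.+1%:R]natr1 mulrDl mul1r; lra.
Unshelve. all: by end_near. Qed.

End logarithmic_growth.

Section dyadic_sums.
Context (R : realType).

Lemma geometric_sum_le (r : R) n : 0 <= r -> r < 1 -> \sum_(i < n) r ^+ i <= (1 - r)^-1.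
Proof.
move=> r0 r1; have r10 : 0 < 1 - r by rewrite subr_gt0.
rewrite -[leRHS]mul1r ler_pdivlMr// mulrC.
have -> : (1 - r) * \sum_(i < n) r ^+ i = 1 - r ^+ n.
  have := subrX1 r n => /(congr1 -%R); rewrite opprB => ->; ring.
by rewrite lerBlDr lerDl exprn_ge0.
Qed.

(** By Bernoulli's inequality [(9 / 8) ^+ i >= 1 + i / 8], so that the [i]th term is
    at most [expR (- (2 * l)) * 2^-1 ^+ i]. *)
Lemma chaining_series (l : R) I : expR (- (l / 4)) <= 4^-1 -> 0 <= l ->
  \sum_(i < I.+1) 2 ^+ i * expR (- (2 * l * (9 / 8) ^+ i)) <= 2 * expR (- (2 * l)).
Proof.
move=> l4 l0; apply: (@le_trans _ _ (\sum_(i < I.+1) expR (- (2 * l)) * 2^-1 ^+ i)).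
  apply: ler_sum => i _.
  apply: (@le_trans _ _ (2 ^+ i * (expR (- (2 * l)) * expR (- (l / 4)) ^+ i))).
    rewrite ler_wpM2l ?exprn_ge0// -expRM_natl -expRD ler_expR mulrN -opprD lerN2.
    have b : 1 + (1 / 8) *+ i <= (9 / 8) ^+ i :> R.
      have -> : 9 / 8 = 1 + 1 / 8 :> R by field.
      elim: (val i) => [|k IH]; first by rewrite mulr0n addr0 expr0.
      rewrite exprS mulrS; apply: (@le_trans _ _ ((1 + 1 / 8) * (1 + (1 / 8) *+ k))); last by rewrite ler_wpM2l// addr_ge0.
      have h : 0 <= (1 / 8) *+ k :> R by rewrite mulrn_wge0.
      by rewrite mulrDl mul1r mulrDr mulr1; lra.
    apply: (@le_trans _ _ (2 * l * (1 + (1 / 8) *+ i))); last by rewrite ler_wpM2l// mulr_ge0.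
    rewrite le_eqVlt; apply/orP; left; apply/eqP.
    by rewrite -[(1 / 8) *+ i]mulr_natl; field.
  rewrite mulrCA ler_wpM2l ?expR_ge0// -exprMn_comm; last exact: mulrC.
  apply: lerXn2r; rewrite ?nnegrE ?mulr_ge0 ?expR_ge0//.
  by rewrite -ler_pdivlMl//; apply: le_trans l4 _; rewrite -invfM -natrM.
rewrite -mulr_sumr mulrC ler_wpM2r ?expR_ge0//.
apply: le_trans (geometric_sum_le _ _ _) _ => //; rewrite ?invr_ge0// ?invf_lt1 ?ltr1n//.
have -> : 1 - 2^-1 = 2^-1 :> R by field.
by rewrite invrK.
Qed.

End dyadic_sums.

Section lil_upper_bound.
Context d (T : measurableType d) (R : realType) (P : probability T R).
Variables (K : R -> T -> R) (a v : R -> R) (kappa : R).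
Hypothesis mK : forall t, measurable_fun setT (K t).
Hypothesis a_incr : forall s t, 0 <= s -> s <= t -> 0 <= a t - a s <= t - s.
Hypothesis a0 : a 0 = 0.
Hypothesis a_oo : a t @[t --> +oo] --> +oo.
Hypothesis mgf_incr : forall s t h, 0 <= s -> s <= t -> `|h| <= 1 ->
  (\int[P]_w (expR (h * ((K t w - K s w) - (a t - a s))))%:E <=
   (expR ((a t - a s) * h ^+ 2))%:E)%E.
Hypothesis mgf : forall t h, 0 <= t -> `|h| <= 1 ->
  (\int[P]_w (expR (h * (K t w - a t)))%:E <=
   (expR (v t * (h ^+ 2 / 2 * (1 + `|h|))))%:E)%E.
Hypothesis kappa0 : 0 < kappa.
Hypothesis va : v t / a t @[t --> +oo] --> kappa.

Let a_ge0 t : 0 <= t -> 0 <= a t.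
Proof. by move=> t0; have /andP[] := a_incr (lexx 0) t0; rewrite a0 subr0. Qed.

Let a_le t : 0 <= t -> a t <= t.
Proof. by move=> t0; have /andP[_] := a_incr (lexx 0) t0; rewrite a0 !subr0. Qed.

(** The clock [a] is continuous, being 1-Lipschitz. *)
Lemma clock_onto y : 0 <= y -> exists2 t, 0 <= t & a t = y.
Proof.
move=> y0; have /cvgryPge/(_ y) := a_oo.
case=> M [Mr hM]; pose b := Num.max 0 (M + 1).
have b0 : 0 <= b by rewrite le_max lexx.
have ab : y <= a b by apply: hM; rewrite lt_max ltrDl ltr01 orbT.
pose a' t := a (Num.max t 0).
have ca' : continuous a'.
  have lip s t : s <= t -> `|a' t - a' s| <= t - s.
    move=> st; have st' : Num.max s 0 <= Num.max t 0 by rewrite ge_max !le_max st lexx orbT.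
    have s0 : 0 <= Num.max s 0 by rewrite le_max lexx orbT.
    have /andP[h1 h2] := a_incr s0 st'; rewrite /a' ger0_norm//.
    apply: le_trans h2 _; rewrite lerBlDr -lerBlDl.
    by case: (leP s 0) => s'; case: (leP t 0) => t'; lra.
  move=> x; apply/cvgrPdist_lt => e e0; near=> z.
  have : `|x - z| < e by near: z; exact: (@cvgr_dist_lt _ _ _ (nbhs x) _ id x cvg_id e e0).
  apply: le_lt_trans; case: (leP x z) => xz.
    by rewrite distrC [leRHS]distrC (ger0_norm (_ : 0 <= z - x)) ?subr_ge0// lip.
  by rewrite (ger0_norm (_ : 0 <= x - z)) ?subr_ge0 ?(ltW xz)// lip// ltW.
have e0 : a' 0 = 0 by rewrite /a' maxxx a0.
have eb : a' b = a b by rewrite /a' max_l.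
have [] := @IVT _ a' 0 b y b0 (continuous_subspaceT ca').
  by rewrite e0 eb ge_min le_max y0 ab orbT.
move=> c; rewrite in_itv/= => /andP[c0 _] hc; exists c => //.
by rewrite -hc /a' max_l.
Unshelve. all: by end_near. Qed.

Let tau y := if pselect (0 <= y) is left y0 then sval (cid2 (clock_onto y0)) else 0.

Let tau_ge0 y : 0 <= y -> 0 <= tau y.
Proof. by move=> y0; rewrite /tau; case: pselect => // h; case: cid2. Qed.

Let a_tau y : 0 <= y -> a (tau y) = y.
Proof. by move=> y0; rewrite /tau; case: pselect => // h; case: cid2. Qed.

Let tau_ge y : 0 <= y -> y <= tau y.
Proof. by move=> y0; rewrite -{1}(a_tau y0) a_le// tau_ge0. Qed.

Let before_tau y t : 0 <= t -> 0 <= y -> a t < y -> t <= tau y.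
Proof.
move=> t0 y0 aty; rewrite leNgt; apply/negP => /ltW yt.
have := a_incr (tau_ge0 y0) yt; rewrite a_tau// => /andP[+ _].
by rewrite subr_ge0 leNgt aty.
Qed.

(* The deviation, as a process in the time of the clock. *)
Let G y w := K (tau y) w - y.

Let mG y : measurable_fun setT (G y).
Proof. exact: measurable_funB. Qed.

Let increment_tail y z h x : 0 <= y -> y <= z -> 0 <= h -> h <= 1 ->
  (P [set w | (x <= G z w - G y w)%R] <= (expR ((z - y) * h ^+ 2 - h * x))%:E)%E.
Proof.
move=> y0 yz h0 h1; have z0 : 0 <= z by exact: le_trans yz.
have yz' : tau y <= tau z.
  case: (ltrgtP y z) yz => // [yz|->]// _; apply: before_tau => //; first exact: tau_ge0.
  by rewrite a_tau.
apply: chernoff_bound => //; first exact: measurable_funB.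
have := mgf_incr (tau_ge0 y0) yz' (_ : `|h| <= 1); rewrite ger0_norm// => /(_ h1).
rewrite !a_tau//; apply: le_trans.
by rewrite le_eqVlt; apply/orP; left; apply/eqP; apply: eq_integral => w _; congr (expR (_ * _))%:E; rewrite /G; ring.
Qed.

(** Chaining over the dyadic intervals of the levels up to [I], where [X * 2 ^+ I] is
    of the order of [D]: the drift of the clock over an interval of the last level
    is then at most [X], and this bounds the deviation at all the other times as the
    occupancy is monotone. Allowing [X * (3 / 4) ^+ i] at the level [i] costs [4 * X]
    in total. *)
Let block y0 D X l : 0 <= y0 -> 0 < D -> 0 < X -> X <= D -> 0 <= l ->
  X ^+ 2 = 8 * D * l -> expR (- (l / 4)) <= 4^-1 ->
  exists B : set T, [/\ measurable B, (P B <= (2 * expR (- (2 * l)))%:E)%E &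
    forall w, (forall s t, 0 <= s -> s <= t -> K s w <= K t w) -> ~ B w ->
      forall t, 0 <= t -> y0 <= a t < y0 + D -> K t w - a t <= G y0 w + 5 * X].
Proof.
move=> y00 D0 X0 XD l0 X2 l4.
have [I [XI DI]] : exists I, X * 2 ^+ I <= 2 * D /\ D <= X * 2 ^+ I.
  have ex : exists I : nat, D <= X * 2 ^+ I.
    exists (Num.truncn (D / X)).+1; rewrite -ler_pdivrMl// mulrC.
    apply: (le_trans (ltW (truncnS_gt _))); rewrite -natrX ler_nat ltnW//.
    exact: ltn_expl.
  case: (ex_minnP ex) => I hI minI; exists I; split => //.
  case: I hI minI => [|I] hI minI.
    by rewrite expr0 mulr1 (le_trans XD)// ler_peMl ?ler1n// ltW.
  rewrite exprS mulrCA ler_pM2l// ltW// ltNge; apply/negP => /minI.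
  by rewrite ltnn.
pose x i := X * (3 / 4) ^+ i.
(* the optimal parameter of the exponential bound at the level [i]; the
   exponent becomes [- (2 * l * (9 / 8) ^+ i)], which beats the number [2 ^+ i] of
   intervals *)
pose h i := X * (3 / 2) ^+ i / (2 * D).
pose pt i l' := y0 + D * l'%:R / 2 ^+ i.
have pt_ge0 i l' : 0 <= pt i l' by rewrite /pt addr_ge0// divr_ge0 ?exprn_ge0// mulr_ge0 ?(ltW D0).
pose A i l' := [set w | x i <= G (pt i l'.+1) w - G (pt i l') w].
have mA i l' : measurable (A i l').
  rewrite (_ : A i l' = (fun w => G (pt i l'.+1) w - G (pt i l') w) @^-1` `[x i, +oo[%classic).
    by rewrite -[X in measurable X]setTI; apply: measurable_funB.
  by apply/seteqP; split => w; rewrite /A /= in_itv/= andbT.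
have PA i l' : (i <= I)%N -> (P (A i l') <= (expR (- (2 * l * (9 / 8) ^+ i)))%:E)%E.
  move=> iI; have h0 : 0 <= h i.
    by rewrite /h divr_ge0 ?mulr_ge0 ?exprn_ge0 ?divr_ge0// ltW.
  have h1 : h i <= 1.
    rewrite /h ler_pdivrMr ?mulr_gt0// mul1r; apply: le_trans XI; rewrite ler_pM2l//.
    apply: (@le_trans _ _ (2 ^+ i)).
      by apply: lerXn2r; rewrite ?nnegrE ?divr_ge0// ler_pdivrMr//; lra.
    by rewrite ler_eXn2l// ltr1n.
  have ptle : pt i l' <= pt i l'.+1.
    by rewrite /pt lerD2l ler_wpM2r ?invr_ge0 ?exprn_ge0// ler_wpM2l ?(ltW D0)// ler_nat.
  have := @increment_tail _ _ _ (x i) (pt_ge0 i l') ptle h0 h1.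
  move=> /le_trans; apply; rewrite lee_fin ler_expR.
  have -> : pt i l'.+1 - pt i l' = D / 2 ^+ i.
    rewrite /pt -natr1; field; rewrite expf_neq0//.
  have -> : D / 2 ^+ i * h i ^+ 2 - h i * x i = - (X ^+ 2 * (9 / 8) ^+ i / (4 * D)).
    have e1 : (3 / 2) ^+ i ^+ 2 = 2 ^+ i * (9 / 8) ^+ i :> R.
      by rewrite -!exprM mulnC exprM -exprMn; congr (_ ^+ _); field.
    have e2 : (3 / 2) ^+ i * (3 / 4) ^+ i = (9 / 8) ^+ i :> R.
      by rewrite -exprMn; congr (_ ^+ _); field.
    have n2 : 2 ^+ i != 0 :> R by rewrite expf_neq0.
    rewrite /h /x; move: e1 e2 n2.
    set b := (3 / 2) ^+ i; set c := 2 ^+ i; set e := (9 / 8) ^+ i; set f := (3 / 4) ^+ i => e1 e2 n2.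
    have -> : D / c * (X * b / (2 * D)) ^+ 2 - X * b / (2 * D) * (X * f) =
        X ^+ 2 * (b ^+ 2) / (4 * D * c) - X ^+ 2 * (b * f) / (2 * D).
      by field; rewrite n2 gt_eqF.
    by rewrite e1 e2; field; rewrite n2 gt_eqF.
  rewrite X2 lerN2 le_eqVlt; apply/orP; left; apply/eqP; field.
  by rewrite gt_eqF.
pose B := \big[setU/set0]_(i < I.+1) \big[setU/set0]_(l' < 2 ^ i) A i l'.
have mB i : measurable (\big[setU/set0]_(l' < 2 ^ i) A i l') by apply: bigsetU_measurable.
exists B; split.
- exact: bigsetU_measurable.
- apply: (@le_trans _ _ (\sum_(i < I.+1) (2 ^+ i * expR (- (2 * l * (9 / 8) ^+ i)))%:E)%E); last first.
    by rewrite sumEFin lee_fin chaining_series.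
  apply: (le_trans (@Boole_inequality _ _ _ P (fun i => \big[setU/set0]_(l' < 2 ^ i) A i l') I.+1 (fun i _ => mB i))).
  apply: lee_sum => i _.
  apply: (le_trans (@Boole_inequality _ _ _ P (A i) (2 ^ i)%N (fun l' _ => mA i l'))).
  apply: (@le_trans _ _ (\sum_(l' < 2 ^ i) (expR (- (2 * l * (9 / 8) ^+ i)))%:E)%E).
    by apply: lee_sum => l' _; apply: PA; rewrite -ltnS.
  by rewrite sumEFin lee_fin sumr_const card_ord -[leLHS]mulr_natl natrX.
- move=> w Kmono nB t t0 /andP[yt ty].
  have inc i l' : (i <= I)%N -> (l' < 2 ^ i)%N -> G (pt i l'.+1) w - G (pt i l') w <= x i.
    move=> iI li; rewrite leNgt; apply/negP => /ltW xG; apply: nB.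
    rewrite /B -(bigcup_mkord I.+1 (fun i => \big[setU/set0]_(l' < 2 ^ i) A i l')); exists i => //=.
    by rewrite -(bigcup_mkord (2 ^ i) (A i)); exists l'.
  have x0 i : 0 <= x i by rewrite /x mulr_ge0 ?exprn_ge0 ?divr_ge0// ltW.
  have chain := @dyadic_chaining _ (G^~ w) y0 D x I x0 inc.
  pose r := (a t - y0) * 2 ^+ I / D.
  have r0 : 0 <= r by rewrite /r divr_ge0 ?(ltW D0)// mulr_ge0 ?exprn_ge0// subr_ge0.
  pose l' := Num.truncn r.
  have /andP[rl rr] := truncn_itv r0.
  have c2 : 0 < 2 ^+ I :> R by rewrite exprn_gt0.
  have lI : (l' < 2 ^ I)%N.
    rewrite -(ltr_nat R) (le_lt_trans rl)// natrX /r ltr_pdivrMr// mulrC ltr_pM2l//.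
    by rewrite ltrBlDl.
  have e1 : pt I l' <= a t.
    rewrite /pt -lerBrDl ler_pdivrMr// -ler_pdivlMl// mulrC; exact: rl.
  have e2 : a t < pt I l'.+1.
    by rewrite /pt -ltrBlDl ltr_pdivlMr// -ltr_pdivrMl// mulrC.
  have Kt : K t w <= K (tau (pt I l'.+1)) w by apply: Kmono => //; exact: before_tau.
  have /chain : (l'.+1 <= 2 ^ I)%N by [].
  rewrite -/(pt I l'.+1) => hG.
  have sx : \sum_(i < I.+1) x i <= 4 * X.
    rewrite /x -mulr_sumr mulrC ler_pM2r//.
    have : (3 / 4 : R) < 1 by rewrite ltr_pdivrMr// mul1r ltr_nat.
    have h34 : (0 : R) <= 3 / 4 by rewrite divr_ge0.
    move=> /(geometric_sum_le I.+1 h34)/le_trans; apply.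
    have -> : 1 - 3 / 4 = 4^-1 :> R by field.
    by rewrite invrK.
  have step : pt I l'.+1 - pt I l' <= X.
    have -> : pt I l'.+1 - pt I l' = D / 2 ^+ I by rewrite /pt -natr1; field; rewrite gt_eqF.
    by rewrite ler_pdivrMr.
  move: hG Kt step sx e1; rewrite /G; lra.
Qed.

(** The Chernoff bound with the parameter [h := x / V], optimal for a Gaussian
    variable; as [V] dominates [l], [h] is small and the correction factor
    [1 + h] harmless. *)
Let endpoint y eta l : 0 <= y -> 0 < eta -> eta <= 1 -> 0 <= l -> 0 < v (tau y) ->
  32 * l / eta ^+ 2 <= v (tau y) ->
  (P [set w | ((1 + eta) * Num.sqrt (2 * v (tau y) * l) <= G y w)%R] <=
   (expR (- ((1 + eta) * l)))%:E)%E.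
Proof.
move=> y0 eta0 eta1 l0; set V := v (tau y) => V0 lV.
set x := (1 + eta) * Num.sqrt _; pose h := x / V.
have x0 : 0 <= x by rewrite mulr_ge0 ?sqrtr_ge0// addr_ge0// ltW.
have x2 : x ^+ 2 = (1 + eta) ^+ 2 * (2 * V * l).
  by rewrite /x exprMn sqr_sqrtr// mulr_ge0// mulr_ge0// ltW.
have h0 : 0 <= h by rewrite divr_ge0// ltW.
have h2 : h <= eta / 2.
  rewrite -(@ler_pXn2r _ 2)// ?nnegrE ?divr_ge0 ?(ltW eta0)//.
  have -> : h ^+ 2 = (1 + eta) ^+ 2 * (2 * l) / V.
    by rewrite /h expr_div_n x2; field; rewrite gt_eqF.
  rewrite ler_pdivrMr//; apply: (@le_trans _ _ (2 ^+ 2 * (2 * l))).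
    rewrite ler_wpM2r ?mulr_ge0//; apply: lerXn2r; rewrite ?nnegrE ?addr_ge0 ?(ltW eta0)//; lra.
  have e2 : 0 < eta ^+ 2 by rewrite exprn_gt0.
  move: lV; rewrite ler_pdivrMr// => lV.
  have -> : (eta / 2) ^+ 2 * V = (V * eta ^+ 2) / 4 by field.
  by rewrite ler_pdivlMr//; lra.
have h1 : h <= 1 by lra.
apply: (@le_trans _ _ (expR (V * (h ^+ 2 / 2 * (1 + h)) - h * x))%:E).
  apply: chernoff_bound => //.
  have := mgf (tau_ge0 y0) (_ : `|h| <= 1); rewrite ger0_norm// => /(_ h1).
  by rewrite a_tau.
rewrite lee_fin ler_expR.
have -> : V * (h ^+ 2 / 2 * (1 + h)) - h * x = - (x ^+ 2 / (2 * V) * (1 - h)).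
  by rewrite /h; field; rewrite gt_eqF.
rewrite x2 lerN2.
have -> : (1 + eta) ^+ 2 * (2 * V * l) / (2 * V) = (1 + eta) ^+ 2 * l by field; rewrite gt_eqF.
rewrite expr2 -!mulrA ler_wpM2l ?addr_ge0 ?(ltW eta0)//.
rewrite mulrCA -[leLHS]mulr1 ler_wpM2l//.
apply: (@le_trans _ _ ((1 + eta) * (1 - eta / 2))); last by rewrite ler_wpM2l ?addr_ge0 ?(ltW eta0)//; lra.
have : eta * eta <= eta by rewrite ler_piMr// ltW.
lra.
Qed.

Theorem lil_upper e : 0 < e ->
  {ae P, forall w, forall s t, 0 <= s -> s <= t -> K s w <= K t w} ->
  {ae P, forall w, \forall t \near +oo,
    K t w - a t <= (1 + e) * Num.sqrt (2 * (v t * ln (ln (v t))))}.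
Proof.
move=> e0 Kmono.
pose eta := Num.min e 1 / 8.
have eta0 : 0 < eta by rewrite divr_gt0// lt_min e0 ltr01.
have eta8 : eta <= 1 / 8 by rewrite /eta ler_pM2r ?invr_gt0// ge_min lexx orbT.
have etae : 8 * eta <= e by rewrite /eta mulrCA divff// mulr1 ge_min lexx.
(* with this ratio the oscillation [5 * X m] of a block is exactly [eta] times
   the size of the normalization *)
pose ga := 1 + kappa * eta ^+ 2 / 100.
have ga1 : 0 < ga - 1 by rewrite /ga addrAC subrr add0r divr_gt0// mulr_gt0// exprn_gt0.
have ga1' : 1 < ga by rewrite -subr_gt0.
have ga0 : 0 < ga by exact: lt_trans ga1'.
pose y m := ga ^+ m; have y0 m : 0 < y m by rewrite exprn_gt0.
pose l m : R := ln m.+1%:R; have l0 m : 0 <= l m by rewrite ln_ge0// ler1n.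
pose D m := (ga - 1) * y m; have D0 m : 0 < D m by rewrite mulr_gt0.
pose X m := Num.sqrt (8 * D m * l m).
have ke0 : 0 < kappa * (1 - eta) by rewrite mulr_gt0//; lra.
have [T0 [T0r hT0]] : \forall t \near +oo, kappa * (1 - eta) * a t <= v t <= kappa * (1 + eta) * a t.
  have ke : 0 < kappa * eta by rewrite mulr_gt0.
  have /cvgrPdist_lt/(_ _ ke) hv := va.
  near=> t; have at0 : 0 < a t.
    by apply: (lt_le_trans ltr01); near: t; move/cvgryPge : a_oo; apply.
  have : `|kappa - v t / a t| < kappa * eta by near: t.
  rewrite ltr_distlC ltr_pdivrMr// ltr_pdivlMr// => /andP[h1 h2].
  by rewrite mulrBr mulr1 mulrDr mulr1 !ltW.
have [M _ hM] : \forall m \near \oo, [/\ 4 * ln 4 <= l m, (8 / (ga - 1)) * l m <= y m,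
    (64 / (kappa * eta ^+ 2)) * l m <= y m, (`|T0| + 1) * l m <= y m /\ 1 <= l m &
    expR ((1 - eta) * l m) <= m%:R * ln ga + ln (kappa * (1 - eta))].
  near=> m; split.
  - by near: m; exact: near_ln.
  - by near: m; exact: near_pow.
  - by near: m; exact: near_pow.
  - by split; near: m; [exact: near_pow|exact: near_ln].
  - by near: m; apply: near_loglog => //; rewrite ln_gt0.
have Vbound m : (M <= m)%N -> kappa * (1 - eta) * y m <= v (tau (y m)) <= kappa * (1 + eta) * y m.
  move=> /hM[_ _ _ [h1 h2] _]; have := hT0 (tau (y m)); rewrite a_tau ?(ltW (y0 m))//; apply.
  apply: lt_le_trans (tau_ge (ltW (y0 m))); apply: lt_le_trans h1.
  apply: (@lt_le_trans _ _ (`|T0| + 1)); first by rewrite (le_lt_trans (ler_norm _))// ltrDl.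
  by rewrite ler_peMr// addr_ge0.
have V0 m : (M <= m)%N -> 0 < v (tau (y m)).
  by move=> /Vbound/andP[+ _]; apply: lt_le_trans; rewrite mulr_gt0.
have X2 m : X m ^+ 2 = 8 * D m * l m.
  by rewrite /X sqr_sqrtr// mulr_ge0// mulr_ge0// ltW.
have /choice[B hB] : forall m, exists B : set T, measurable B /\ ((M <= m)%N ->
    (P B <= (2 * expR (- (2 * l m)))%:E)%E /\
    forall w, (forall s t, 0 <= s -> s <= t -> K s w <= K t w) -> ~ B w ->
      forall t, 0 <= t -> y m <= a t < y m + D m -> K t w - a t <= G (y m) w + 5 * X m).
  move=> m; have [Mm|mM] := leqP M m; last by exists set0; split => //; rewrite leqNgt mM.
  have [h1 h2 h3 [h4 h5] h6] := hM m Mm.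
  have [|||B [mB PB hB]] := @block (y m) (D m) (X m) (l m) (ltW (y0 m)) (D0 m) _ _ (l0 m) (X2 m) _.
  - by rewrite sqrtr_gt0 !mulr_gt0// (lt_le_trans ltr01).
  - rewrite -(@ler_pXn2r _ 2)// ?nnegrE ?sqrtr_ge0 ?(ltW (D0 m))// X2 expr2 mulrAC mulrC ler_pM2l//.
    by move: h2; rewrite mulrAC ler_pdivrMr// [y m * _]mulrC.
  - have n4 : 4^-1 = expR (- ln 4) :> R by rewrite expRN lnK// posrE.
    by rewrite [leRHS]n4 ler_expR lerN2 ler_pdivlMr// mulrC.
  - by exists B; split => // _; split.
pose F m := B m `|` (if (M <= m)%N then
  [set w | (1 + eta) * Num.sqrt (2 * v (tau (y m)) * l m) <= G (y m) w] else set0).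
have mF m : measurable (F m).
  apply: measurableU; first by case: (hB m).
  case: ifP => // _; rewrite (_ : [set w | _] = G (y m) @^-1` `[(1 + eta) * Num.sqrt (2 * v (tau (y m)) * l m), +oo[%classic).
    by rewrite -[X in measurable X]setTI; exact: mG.
  by apply/seteqP; split => w; rewrite /= in_itv/= andbT.
have PF m : (M <= m)%N -> (P (F m) <= (3 * expR (- ((1 + eta) * l m)))%:E)%E.
  move=> Mm; have [mB /(_ Mm)[PB _]] := hB m.
  have [h1 h2 h3 [h4 h5] h6] := hM m Mm.
  apply: (@le_trans _ _ (P (B m) + P [set w | ((1 + eta) * Num.sqrt (2 * v (tau (y m)) * l m) <= G (y m) w)%R])%E).
    rewrite /F Mm; apply: measureU2 => //.
    have := mF m; rewrite /F Mm => _.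
    rewrite (_ : [set w | _] = G (y m) @^-1` `[(1 + eta) * Num.sqrt (2 * v (tau (y m)) * l m), +oo[%classic).
      by rewrite -[X in measurable X]setTI; exact: mG.
    by apply/seteqP; split => w; rewrite /= in_itv/= andbT.
  have -> : 3 * expR (- ((1 + eta) * l m)) = 2 * expR (- ((1 + eta) * l m)) + expR (- ((1 + eta) * l m)) by ring.
  rewrite EFinD; apply: leeD.
    apply: (le_trans PB); rewrite lee_fin ler_pM2l// ler_expR lerN2 ler_wpM2r//; lra.
  apply: endpoint => //; [exact: ltW|lra|exact: V0|].
  have /andP[V1 _] := Vbound m Mm; apply: le_trans V1.
  have e2 : 0 < eta ^+ 2 by rewrite exprn_gt0.
  have ke2 : 0 < kappa * eta ^+ 2 by exact: mulr_gt0.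
  move: h3; rewrite mulrAC ler_pdivrMr// => h3.
  rewrite ler_pdivrMr//.
  have : kappa * eta ^+ 2 * y m / 2 <= kappa * (1 - eta) * y m * eta ^+ 2.
    have -> : kappa * (1 - eta) * y m * eta ^+ 2 = kappa * eta ^+ 2 * y m * (1 - eta) by ring.
    have p0 : 0 <= kappa * eta ^+ 2 * y m by rewrite ltW// mulr_gt0.
    by apply: ler_wpM2l => //; lra.
  lra.
have io := eventually_not (e := eta) (C := 3) eta0 _ mF PF.
apply: filterS2 Kmono (io _) => // w Kw [N hN].
pose m1 := maxn M N.
near=> t.
have t0 : 0 <= t by near: t; apply: nbhs_pinfty_ge; rewrite num_real.
have tT0 : T0 < t by near: t; exact: nbhs_pinfty_gt.
have at1 : y m1 <= a t by near: t; move/cvgryPge : a_oo; apply.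
have exm : exists m, a t < y m.
  have [m0 _ /(_ m0 (leqnn m0))[h1 h2]] := filterI (near_pow (a t + 1) ga1') (near_ln (1 : R)).
  exists m0; apply: lt_le_trans h1; apply: (@lt_le_trans _ _ (a t + 1)); first by rewrite ltrDl.
  by rewrite ler_peMr// addr_ge0// a_ge0.
(* the block that contains [t] *)
case: (ex_minnP exm) => m' atm' minm.
have m1m' : (m1 < m')%N.
  rewrite ltnNge; apply/negP => mm; have := le_lt_trans at1 atm'.
  by rewrite ltNge /y ler_eXn2l// mm.
case: m' atm' minm m1m' => // m atm minm; rewrite ltnS geq_max => /andP[Mm Nm].
have aty : y m <= a t by rewrite leNgt; apply/negP => /minm; rewrite ltnn.
have ySm : y m.+1 = y m + D m by rewrite /D /y exprS mulrBl mul1r addrC subrK.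
have [h1 h2 h3 [h4 h5] h6] := hM m Mm.
have [mB /(_ Mm)[_ hBm]] := hB m.
have nF := hN m Nm; have nB : ~ B m w by move=> Bw; apply: nF; left.
have aty' : y m <= a t < y m + D m by rewrite aty -ySm.
have low := hBm w Kw nB t t0 aty'.
have lowG : G (y m) w < (1 + eta) * Num.sqrt (2 * v (tau (y m)) * l m).
  by rewrite ltNge; apply/negP => GG; apply: nF; right; rewrite Mm.
pose s := Num.sqrt (2 * kappa * y m * l m).
have s0 : 0 <= s by exact: sqrtr_ge0.
have sq0 : 0 <= 2 * kappa * y m * l m by rewrite !mulr_ge0// ?(ltW kappa0)// ltW.
have sE c : 0 <= c -> c * s = Num.sqrt (c ^+ 2 * (2 * kappa * y m * l m)).
  by move=> c0; rewrite sqrtrM ?sqr_ge0// sqrtr_sqr ger0_norm.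
have /andP[V1 V2] := Vbound m Mm.
have b1 : Num.sqrt (2 * v (tau (y m)) * l m) <= (1 + eta) * s.
  rewrite sE ?addr_ge0 ?(ltW eta0)// ler_wsqrtr//.
  have -> : (1 + eta) ^+ 2 * (2 * kappa * y m * l m) = 2 * ((1 + eta) ^+ 2 * kappa * y m) * l m by ring.
  rewrite ler_wpM2r// ler_pM2l//; apply: le_trans V2 _; rewrite ler_pM2r// mulrC ler_pM2r//.
  by rewrite expr2 ler_peMl ?addr_ge0 ?(ltW eta0)// lerDl ltW.
have b2 : 5 * X m = eta * s.
  rewrite sE ?(ltW eta0)// /X -[5 in LHS]ger0_norm// -sqrtr_sqr -sqrtrM ?sqr_ge0//.
  by congr Num.sqrt; rewrite /D /ga; field.
have b3 : (1 - eta) * s <= Num.sqrt (2 * (v t * ln (ln (v t)))).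
  rewrite sE; last by lra.
  apply: ler_wsqrtr.
  have -> : (1 - eta) ^+ 2 * (2 * kappa * y m * l m) = 2 * ((kappa * (1 - eta) * y m) * ((1 - eta) * l m)) by ring.
  rewrite ler_pM2l//.
  have /andP[v1 _] := hT0 t tT0.
  have v2 : kappa * (1 - eta) * y m <= v t by apply: le_trans v1; rewrite ler_wpM2l// ltW.
  have kp : 0 < kappa * (1 - eta) * y m by rewrite mulr_gt0.
  have vt0 : 0 < v t by exact: lt_le_trans v2.
  apply: ler_pM => //; [exact: ltW|by rewrite mulr_ge0//; lra|].
  have lv : expR ((1 - eta) * l m) <= ln (v t).
    apply: le_trans h6 _; rewrite -(_ : ln (kappa * (1 - eta) * y m) = m%:R * ln ga + ln (kappa * (1 - eta))).
      by rewrite ler_ln ?posrE.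
    by rewrite lnM ?posrE// /y lnXn// mulr_natl addrC.
  rewrite -[leLHS]expRK ler_ln ?posrE ?expR_gt0//.
  by apply: lt_le_trans lv; exact: expR_gt0.
apply: le_trans low _; rewrite b2.
apply: (@le_trans _ _ ((1 + eta) * ((1 + eta) * s) + eta * s)).
  by rewrite lerD2r; apply: le_trans (ltW lowG) _; rewrite ler_wpM2l// addr_ge0// ltW.
apply: (@le_trans _ _ ((1 + e) * ((1 - eta) * s))); last by rewrite ler_wpM2l// addr_ge0// ltW.
rewrite !mulrA -mulrDl ler_wpM2r//.
have ee : 0 <= eta * eta by rewrite mulr_ge0 ?(ltW eta0).
have e1 : (1 + e) * (1 - eta) >= (1 + 8 * eta) * (1 - eta) by rewrite ler_wpM2r//; lra.
apply: le_trans e1.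
have e2 : eta * eta <= eta * (1 / 8) by rewrite ler_wpM2l// ltW.
lra.
Unshelve. all: by end_near. Qed.

End lil_upper_bound.

(** * The lower bound *)

Section kolmogorov_lower_bound.
Context d (T : measurableType d) (R : realType) (P : probability T R).
Local Notation Ex f := (Rintegral P setT f).
Local Notation bm := bounded_measurable.

Lemma bm_expR (f : T -> R) : bm f -> bm (fun w => expR (f w)).
Proof.
move=> [mf [M fM]]; split; first exact: measurableT_comp.
by exists (expR M) => w; rewrite ger0_norm ?expR_ge0// ler_expR (le_trans (ler_norm _)).
Qed.

Lemma bm_gt (U : T -> R) (x : R) : bm U -> bm (\1_[set w | x < U w] : T -> R).
Proof.
move=> [mU _]; apply: bm_indic.
rewrite (_ : [set w | _] = U @^-1` `]x, +oo[%classic).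
  by rewrite -[X in measurable X]setTI; exact: mU.
by apply/seteqP; split => w; rewrite /= in_itv/= andbT.
Qed.

(** With [m] the exponent of the lower bound for the tilted total weight, the first
    two inequalities make each of the other terms at most a quarter of [expR m], and
    the third one compares the tilting factor with the Gaussian tail. *)
Let exponents (V c e : R) : 0 < V -> 0 < c -> 0 < e -> e <= 1 ->
  96 * c <= e ^+ 2 -> ln 4 <= V * c ^+ 2 * (e ^+ 2 / 4) ->
  let m := V * (((1 + e) * c) ^+ 2 / 2 * (1 - 2 * ((1 + e) * c))) in
  [/\ e * c * (V * c) + V * (c ^+ 2 / 2 * (1 + c)) <= m - ln 4,
   - (e * c * ((1 + 2 * e) * (V * c))) +
     V * (((1 + 2 * e) * c) ^+ 2 / 2 * (1 + (1 + 2 * e) * c)) <= m - ln 4 &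
   (1 + e) * c * ((1 + 2 * e) * (V * c)) - V * c ^+ 2 / 2 * (1 + 9 * e) <= m].
Proof.
move=> V0 c0 e0 e1 c48 r4 m.
pose r := V * c ^+ 2; have r0 : 0 < r by rewrite mulr_gt0// exprn_gt0.
have mE : m = r * ((1 + e) ^+ 2 / 2 - (1 + e) ^+ 3 * c) by rewrite /m /r; field.
have cube1 : (1 + e) ^+ 3 * c <= 8 * c.
  rewrite ler_pM2r// (_ : 8 = 2 ^+ 3); last by ring.
  by apply: lerXn2r; rewrite ?nnegrE; lra.
have cube2 : (1 + 2 * e) ^+ 3 / 2 * c <= 14 * c.
  rewrite ler_pM2r//; apply: (@le_trans _ _ (3 ^+ 3 / 2)); last by rewrite ler_pdivrMr//; lra.
  by rewrite ler_pM2r ?invr_gt0//; apply: lerXn2r; rewrite ?nnegrE; lra.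
have ee : e ^+ 2 <= e by rewrite expr2 ler_piMl// ltW.
have rr : m - r * (e ^+ 2 / 4) <= m - ln 4 by rewrite lerD2l lerN2.
have s1 : (1 + e) ^+ 2 = 1 + 2 * e + e ^+ 2 by ring.
have s2 : (1 + 2 * e) ^+ 2 = 1 + 4 * e + 4 * e ^+ 2 by ring.
clear r4; split.
- apply: le_trans rr; rewrite mE s1.
  have -> : e * c * (V * c) + V * (c ^+ 2 / 2 * (1 + c)) = r * (e + 2^-1 + c / 2) by rewrite /r; field.
  by rewrite -mulrBr ler_pM2l//; clear mE r0 m r; lra.
- apply: le_trans rr; rewrite mE s1.
  have -> : - (e * c * ((1 + 2 * e) * (V * c))) + V * (((1 + 2 * e) * c) ^+ 2 / 2 * (1 + (1 + 2 * e) * c)) =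
      r * (- (e + 2 * e ^+ 2) + (1 + 2 * e) ^+ 2 / 2 + (1 + 2 * e) ^+ 3 / 2 * c) by rewrite /r; field.
  by rewrite s2 -mulrBr ler_pM2l//; clear mE r0 m r; lra.
- rewrite mE s1.
  have -> : (1 + e) * c * ((1 + 2 * e) * (V * c)) - V * c ^+ 2 / 2 * (1 + 9 * e) =
      r * (1 + 3 * e + 2 * e ^+ 2 - (1 + 9 * e) / 2) by rewrite /r; field.
  by rewrite ler_pM2l//; clear rr mE r0 m r; lra.
Qed.

(** Kolmogorov's lower exponential bound, by exponential tilting: under the weight
    [expR (h * U)] with [h] slightly larger than [c], the mean of [U] is
    slightly larger than [V * c], and the two other terms bound the weight of
    the values of [U] away from it. *)
Lemma kolmogorov_lower (U : T -> R) (V c e : R) : bm U -> 0 < V -> 0 < c -> 0 < e -> e <= 1 ->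
  96 * c <= e ^+ 2 -> ln 4 <= V * c ^+ 2 * (e ^+ 2 / 4) ->
  (forall h, 0 <= h -> h <= 1 ->
    expR (V * (h ^+ 2 / 2 * (1 - 2 * h))) <= Ex (fun w => expR (h * U w)) /\
    Ex (fun w => expR (h * U w)) <= expR (V * (h ^+ 2 / 2 * (1 + h)))) ->
  expR (- (V * c ^+ 2 / 2 * (1 + 9 * e))) / 2 <= Ex (\1_[set w | V * c < U w]).
Proof.
move=> bU V0 c0 e0 e1 c48 r4 mgf.
have [E1 E2 E3] := exponents V0 c0 e0 e1 c48 r4.
have c31 : 3 * c <= 1.
  have : e ^+ 2 <= 1 by rewrite expr_le1// ltW.
  by move: c48 c0; lra.
have ec0 : 0 < e * c by exact: mulr_gt0.
have ec : e * c <= c by rewrite ler_piMl// ltW.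
move: E1 E2 E3; set x := V * c; set h := (1 + e) * c; set hp := (1 + 2 * e) * c.
set y := (1 + 2 * e) * x; set de := e * c.
have hE : h = c + de by rewrite /h /de; ring.
have hpE : hp = h + de by rewrite /h /hp /de; ring.
have h0 : 0 <= h by rewrite hE addr_ge0// ltW.
have hp0 : 0 <= hp by rewrite hpE addr_ge0// ltW.
have c1 : c <= 1 by move: c31 c0; lra.
have h1 : h <= 1 by rewrite hE; move: c31 c0 ec; rewrite -/de; lra.
have hp1 : hp <= 1 by rewrite hpE hE; move: c31 c0 ec; rewrite -/de; lra.
have [main _] := mgf h h0 h1.
have [_ lower] := mgf c (ltW c0) c1.
have [_ upper] := mgf hp hp0 hp1.
set M := V * (h ^+ 2 / 2 * (1 - 2 * h)) => E1 E2 E3.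
have bexp (k : R) : bm (fun w => expR (k * U w)) by apply: bm_expR; apply: bmM => //; exact: bm_cst.
have bZ (k : R) (f : T -> R) : bm f -> bm (fun w => k * f w) by move=> bf; apply: bmM => //; exact: bm_cst.
(* below [x] the tilting parameter is lowered to [c], above [y] it is raised to
   [hp], and in between [expR (h * U)] is at most [expR (h * y)] *)
have split3 : Ex (fun w => expR (h * U w)) <=
    expR (de * x) * Ex (fun w => expR (c * U w)) +
    expR (- (de * y)) * Ex (fun w => expR (hp * U w)) +
    expR (h * y) * Ex (\1_[set w | x < U w]).
  have b1 := bZ (expR (de * x)) _ (bexp c).
  have b2 := bZ (expR (- (de * y))) _ (bexp hp).
  have b3 := bZ (expR (h * y)) _ (bm_gt x bU).
  rewrite -(ExZ P _ (bexp c)) -(ExZ P _ (bexp hp)) -(ExZ P _ (bm_gt x bU)).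
  rewrite -(ExD P b1 b2) -(ExD P (bmD b1 b2) b3).
  apply: (le_Ex P (bexp h) (bmD (bmD b1 b2) b3)) => w; rewrite indicE -!expRD.
  have [Ux|xU] := leP (U w) x.
    apply: (@le_trans _ _ (expR (de * x + c * U w))); last first.
      by rewrite -addrA lerDl addr_ge0 ?expR_ge0// mulr_ge0 ?expR_ge0.
    by rewrite ler_expR hE mulrDl addrC lerD2r ler_pM2l.
  rewrite mem_set//= mulr1.
  have [Uy|yU] := leP (U w) y.
    apply: (@le_trans _ _ (expR (h * y))); last by rewrite lerDr addr_ge0 ?expR_ge0.
    by rewrite ler_expR ler_wpM2l.
  apply: (@le_trans _ _ (expR (- (de * y) + hp * U w))).
    by rewrite ler_expR hpE mulrDl addrCA lerDl addrC subr_ge0 ler_pM2l// ltW.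
  by rewrite -addrA addrCA lerDl addr_ge0 ?expR_ge0.
have quarter (k F t : R) : 0 <= F -> F <= expR k -> t + k <= M - ln 4 -> expR t * F <= expR M / 4.
  move=> F0 Fk hE'; apply: (@le_trans _ _ (expR t * expR k)); first by rewrite ler_wpM2l// expR_ge0.
  rewrite -expRD; apply: (@le_trans _ _ (expR (M - ln 4))); first by rewrite ler_expR.
  by rewrite expRD [expR (- ln 4)]expRN lnK// posrE.
have q1 := quarter _ _ _ (Ex_ge0 P (fun w => expR_ge0 (c * U w))) lower E1.
have q3 := quarter _ _ _ (Ex_ge0 P (fun w => expR_ge0 (hp * U w))) upper E2.
have q2 : expR M / 2 <= expR (h * y) * Ex (\1_[set w | x < U w]).
  have := le_trans main split3; move: q1 q3; lra.
rewrite -(ler_pM2l (expR_gt0 (h * y))); apply: le_trans q2.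
by rewrite mulrA ler_pM2r ?invr_gt0// -expRD ler_expR.
Qed.

End kolmogorov_lower_bound.

Section disjoint_windows.
Context d (T : measurableType d) (R : realType) (P : probability T R).
Local Notation Ex f := (Rintegral P setT f).
Local Notation bm := bounded_measurable.
Variables (D : nat -> T -> R) (q : nat -> R).
Hypothesis DqI : independent_indicators P D q.

Let bm_affine (b : bool) (u y : R) k : bm (fun w => if b then u + y * D k w else 1).
Proof.
case: b; last exact: bm_cst.
apply: bmD; first exact: bm_cst.
by apply: bmM; [exact: bm_cst|exact: (bm_indicator DqI)].
Qed.

Let prod_update n (f : nat -> R) (x : R) i : (i < n)%N ->
  \prod_(k < n) (if k == i :> nat then x else f k) = x * \prod_(k < n | k != i :> nat) f k.
Proof.
move=> ik; rewrite (bigD1 (Ordinal ik))//= eqxx; congr (_ * _).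
by apply: eq_big => [k|k]; [rewrite -val_eqE|move=> /negbTE; rewrite -val_eqE/= => ->].
Qed.

Lemma mean_prod_affine n (u y : nat -> R) :
  Ex (fun w => \prod_(k < n) (u k + y k * D k w)) = \prod_(k < n) (u k + y k * q k).
Proof.
suff main i : forall u, (forall k, (i <= k)%N -> u k = 1) -> forall y : nat -> R,
    Ex (fun w => \prod_(k < n) (u k + y k * D k w)) = \prod_(k < n) (u k + y k * q k).
  pose u' k := if (k < n)%N then u k else 1.
  have := main n u' _ y.
  have E (x : nat -> R) : \prod_(k < n) (u' k + y k * x k) = \prod_(k < n) (u k + y k * x k).
    by apply: eq_bigr => k _; rewrite /u' ltn_ord.
  rewrite (E q) => <-; last by move=> k; rewrite leqNgt /u' => /negbTE ->.
  by apply: eq_Rintegral => w _; rewrite (E (D ^~ w)).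
elim: i => {u y} [u u1 y|i IH u u1 y].
  under eq_bigr do rewrite u1//.
  rewrite -(indicator_mean DqI); apply: eq_Rintegral => w _.
  by apply: eq_bigr => k _; rewrite u1.
have [ni|iN] := leqP n i.
  pose u' k := if (k < i)%N then u k else 1.
  have E (x : nat -> R) : \prod_(k < n) (u k + y k * x k) = \prod_(k < n) (u' k + y k * x k).
    by apply: eq_bigr => k _; rewrite /u' (leq_trans (ltn_ord k) ni).
  rewrite (E q) -IH; last by move=> k; rewrite leqNgt /u' => /negbTE ->.
  by apply: eq_Rintegral => w _; rewrite (E (D ^~ w)).
(* [u + y * D] is a combination of [1 + D] and [1] *)
pose u' k := if k == i then 1 else u k.
pose y1 k := if k == i then 1 else y k.
pose y0 k := if k == i then 0 else y k.
have u'1 k : (i <= k)%N -> u' k = 1.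
  rewrite leq_eqVlt /u' eq_sym; case: eqP => //= _; exact: u1.
have E (x : nat -> R) : \prod_(k < n) (u k + y k * x k) =
    y i * \prod_(k < n) (u' k + y1 k * x k) + (u i - y i) * \prod_(k < n) (u' k + y0 k * x k).
  have e1 : \prod_(k < n) (u' k + y1 k * x k) = (1 + x i) * \prod_(k < n | k != i :> nat) (u k + y k * x k).
    rewrite -(prod_update (fun k => u k + y k * x k) _ iN); apply: eq_bigr => k _.
    by rewrite /u' /y1; case: eqP => // ->; rewrite mul1r.
  have e0 : \prod_(k < n) (u' k + y0 k * x k) = 1 * \prod_(k < n | k != i :> nat) (u k + y k * x k).
    rewrite -(prod_update (fun k => u k + y k * x k) _ iN); apply: eq_bigr => k _.
    by rewrite /u' /y0; case: eqP => // ->; rewrite mul0r addr0.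
  have e2 : \prod_(k < n) (u k + y k * x k) = (u i + y i * x i) * \prod_(k < n | k != i :> nat) (u k + y k * x k).
    rewrite -(prod_update (fun k => u k + y k * x k) _ iN); apply: eq_bigr => k _.
    by case: eqP => // ->.
  by rewrite e1 e0 e2; ring.
have bp (z : nat -> R) : bm (fun w => \prod_(k < n) (u' k + z k * D k w)).
  by apply: bm_prod => k _; exact: (bm_affine true).
have bz (c : R) f : bm f -> bm (fun w : T => c * f w) by move=> bf; apply: bmM => //; exact: bm_cst.
rewrite E -!(IH u' u'1) -(ExZ P _ (bp y1)) -(ExZ P _ (bp y0)).
rewrite -(ExD P (bz _ _ (bp y1)) (bz _ _ (bp y0))).
by apply: eq_Rintegral => w _; rewrite (E (D ^~ w)).
Qed.

(** The indicators of the window [W] among the first [n], those outside the window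
    being set to [false]: functions of the patterns of disjoint windows are
    independent. *)
Definition pattern (W : pred nat) n w : {ffun 'I_n -> bool} := [ffun k : 'I_n => W k && (D k w == 1)].

Let ext n (c : {ffun 'I_n -> bool}) (k : nat) := if insub k : option 'I_n is Some i then c i else false.

Let extE n (c : {ffun 'I_n -> bool}) (k : 'I_n) : ext c k = c k.
Proof. by rewrite /ext valK. Qed.

(* The affine function of the indicator that is [1] if it agrees with [c] and [0]
   otherwise; [ext] extends [c] to all indices. *)
Let factor (W : pred nat) n (c : {ffun 'I_n -> bool}) (x : nat -> R) k :=
  if W k then (if ext c k then 0 else 1) + (if ext c k then 1 else -1) * x k else 1.

Let pattern_factor W n c w :
  ((pattern W n w == c)%:R : R) =
  ([forall k, c k ==> W k] : bool)%:R * \prod_(k < n) factor W c (D ^~ w) k.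
Proof.
have Fk (k : 'I_n) : c k ==> W k -> factor W c (D ^~ w) k = (pattern W n w k == c k)%:R.
  rewrite /factor extE ffunE; case: (W k); case: (c k) => //= _.
    rewrite add0r mul1r; have [->|->] := indicator_bool DqI k w; rewrite ?eqxx//.
    by rewrite [0 == 1 :> R]eq_sym oner_eq0.
  have [->|->] := indicator_bool DqI k w; last by rewrite eqxx mulN1r subrr.
  by rewrite mulr0 addr0 [0 == 1 :> R]eq_sym oner_eq0.
have [/forallP Wc|/forallPn[k Wk]] := boolP [forall k, c k ==> W k]; last first.
  rewrite mul0r; suff -> : (pattern W n w == c) = false by [].
  apply/eqP => /ffunP/(_ k); rewrite ffunE; move: Wk.
  by rewrite negb_imply => /andP[-> /negbTE ->].
rewrite mul1r; have [e|ne] := eqVneq (pattern W n w) c.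
  by rewrite big1// => k _; rewrite Fk ?e ?eqxx//; exact: Wc.
have [k kne] : exists k, pattern W n w k != c k.
  by apply/existsP; rewrite -negb_forall; apply: contraNN ne => /forallP h; apply/eqP/ffunP => k; exact/eqP.
by rewrite (bigD1 k)//= Fk// (negbTE kne) mul0r.
Qed.

Let bm_factor W n (c : {ffun 'I_n -> bool}) : bm (fun w => \prod_(k < n) factor W c (D ^~ w) k).
Proof. by apply: bm_prod => k _; exact: bm_affine. Qed.

Let bm_pattern_eq W n c : bm (fun w => (pattern W n w == c)%:R : R).
Proof.
rewrite (_ : (fun _ => _) = fun w => ([forall k, c k ==> W k] : bool)%:R * \prod_(k < n) factor W c (D ^~ w) k).
  by apply: bmM; [exact: bm_cst|exact: bm_factor].
by apply/funext => w; exact: pattern_factor.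
Qed.

Let pattern_sum W n (G : {ffun 'I_n -> bool} -> R) w :
  G (pattern W n w) = \sum_c G c * (pattern W n w == c)%:R.
Proof.
rewrite (bigD1 (pattern W n w))//= eqxx mulr1 big1 ?addr0// => c.
by rewrite eq_sym => /negbTE ->; rewrite mulr0.
Qed.

Lemma bm_pattern W n (G : {ffun 'I_n -> bool} -> R) : bm (fun w => G (pattern W n w)).
Proof.
under eq_fun do rewrite pattern_sum.
by apply: bm_sum => c _; apply: bmM; [exact: bm_cst|exact: bm_pattern_eq].
Qed.

(** Every function of the indicators of a window is a linear combination of products
    of affine functions of them, so that it is uncorrelated with [Z] if these
    products are. *)
Let mean_mul_pattern (Z : T -> R) (W : pred nat) n (G : {ffun 'I_n -> bool} -> R) : bm Z ->
  (forall u y : nat -> R,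
    Ex (fun w => Z w * \prod_(k < n) (if W k then u k + y k * D k w else 1)) =
    Ex Z * \prod_(k < n) (if W k then u k + y k * q k else 1)) ->
  Ex (fun w => Z w * G (pattern W n w)) =
  Ex Z * \sum_c G c * (([forall k, c k ==> W k] : bool)%:R * \prod_(k < n) factor W c q k).
Proof.
move=> bZ hZ.
transitivity (Ex (fun w => \sum_c (G c * ([forall k, c k ==> W k] : bool)%:R) *
    (Z w * \prod_(k < n) factor W c (D ^~ w) k))).
  apply: eq_Rintegral => w _; rewrite pattern_sum mulr_sumr; apply: eq_bigr => c _.
  by rewrite pattern_factor; ring.
rewrite Ex_sum; last first.
  move=> c; apply: bmM; first exact: bm_cst.
  by apply: bmM => //; exact: bm_factor.
rewrite mulr_sumr; apply: eq_bigr => c _.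
rewrite ExZ; last by apply: bmM => //; exact: bm_factor.
by rewrite (hZ (fun k => if ext c k then 0 else 1) (fun k => if ext c k then 1 else -1)) /factor; ring.
Qed.

Let mean_pattern (W : pred nat) n (G : {ffun 'I_n -> bool} -> R) : Ex (fun w => G (pattern W n w)) =
  \sum_c G c * (([forall k, c k ==> W k] : bool)%:R * \prod_(k < n) factor W c q k).
Proof.
have bc : bm (fun _ : T => 1 : R) by exact: bm_cst.
have := @mean_mul_pattern (fun _ => 1) W n G bc; rewrite Ex_cst mul1r => <-.
  by apply: eq_Rintegral => w _; rewrite mul1r.
move=> u y; rewrite mul1r.
pose u' k := if W k then u k else 1; pose y' k := if W k then y k else 0.
have E (x : nat -> R) : \prod_(k < n) (if W k then u k + y k * x k else 1) = \prod_(k < n) (u' k + y' k * x k).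
  by apply: eq_bigr => k _; rewrite /u' /y'; case: ifP => // _; rewrite mul0r addr0.
rewrite E -mean_prod_affine; apply: eq_Rintegral => w _; rewrite mul1r.
exact: (E (D ^~ w)).
Qed.

Lemma mean_prod_windows (W : nat -> pred nat) n (G : nat -> {ffun 'I_n -> bool} -> R) m :
  (forall i i' k, W i k -> W i' k -> i = i') ->
  Ex (fun w => \prod_(i < m) G i (pattern (W i) n w)) =
  \prod_(i < m) Ex (fun w => G i (pattern (W i) n w)).
Proof.
move=> W_disjoint; pose cov m k := [exists i : 'I_m, W i k].
pose rest m (u y x : nat -> R) := \prod_(k < n) (if cov m k then 1 else u k + y k * x k).
have brest m' u y : bm (fun w => rest m' u y (D ^~ w)).
  by apply: bm_prod => k _; case: (cov m' k); [exact: bm_cst|exact: (bm_affine true)].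
suff main u y : Ex (fun w => \prod_(i < m) G i (pattern (W i) n w) * rest m u y (D ^~ w)) =
    \prod_(i < m) Ex (fun w => G i (pattern (W i) n w)) * rest m u y q.
  have E x : rest m (fun=> 1) (fun=> 0) x = 1.
    by rewrite /rest big1// => k _; case: ifP => // _; rewrite mul0r addr0.
  have := main (fun=> 1) (fun=> 0); rewrite E mulr1 => <-.
  by apply: eq_Rintegral => w _; rewrite E mulr1.
elim: m u y => [|m IH] u y.
  rewrite !big_ord0 mul1r /rest.
  have cov0 k : cov 0%N k = false by apply/negbTE/existsPn => -[].
  under [RHS]eq_bigr do rewrite cov0.
  rewrite -mean_prod_affine; apply: eq_Rintegral => w _; rewrite big_ord0 mul1r.
  by apply: eq_bigr => k _; rewrite cov0.
pose Z w := \prod_(i < m) G i (pattern (W i) n w) * rest m.+1 u y (D ^~ w).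
have covS k : cov m.+1 k = cov m k || W m k.
  apply/existsP/orP => [[i Wi]|[/existsP[i Wi]|Wm]].
  - have := ltn_ord i; rewrite ltnS leq_eqVlt => /predU1P[im|im].
      by right; rewrite -im.
    by left; apply/existsP; exists (Ordinal im).
  - by exists (widen_ord (leqnSn m) i).
  - by exists ord_max.
have mcov k : W m k -> cov m k = false.
  move=> Wm; apply/negbTE/existsPn => i; apply/negP => Wi.
  by have := ltn_ord i; rewrite (W_disjoint _ _ _ Wi Wm) ltnn.
have merge (u' y' x : nat -> R) :
    rest m.+1 u y x * \prod_(k < n) (if W m k then u' k + y' k * x k else 1) =
    rest m (fun k => if W m k then u' k else u k) (fun k => if W m k then y' k else y k) x.
  rewrite /rest -big_split/=; apply: eq_bigr => k _; rewrite covS.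
  case: (boolP (W m k)) => [/mcov ->|_]; first by rewrite mul1r.
  by rewrite orbF mulr1.
have bG : bm (fun w => \prod_(i < m) G i (pattern (W i) n w)).
  by apply: bm_prod => i _; exact: bm_pattern.
have bZ : bm Z by exact: bmM.
have hZ (u' y' : nat -> R) :
    Ex (fun w => Z w * \prod_(k < n) (if W m k then u' k + y' k * D k w else 1)) =
    \prod_(i < m) Ex (fun w => G i (pattern (W i) n w)) *
    (rest m.+1 u y q * \prod_(k < n) (if W m k then u' k + y' k * q k else 1)).
  rewrite merge -IH; apply: eq_Rintegral => w _.
  by rewrite /Z -mulrA (merge u' y' (D ^~ w)).
have EZ : Ex Z = \prod_(i < m) Ex (fun w => G i (pattern (W i) n w)) * rest m.+1 u y q.
  have E (x : nat -> R) : \prod_(k < n) (if W m k then 1 + 0 * x k else 1) = 1.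
    by rewrite big1// => k _; case: ifP => // _; rewrite mul0r addr0.
  have := hZ (fun=> 1) (fun=> 0); rewrite E mulr1 => <-.
  by apply: eq_Rintegral => w _; rewrite (E (D ^~ w)) mulr1.
have := @mean_mul_pattern Z (W m) n (G m) bZ.
rewrite -mean_pattern EZ => h.
rewrite big_ord_recr/= mulrAC -h.
  by apply: eq_Rintegral => w _; rewrite big_ord_recr/= /Z mulrAC.
by move=> u' y'; rewrite hZ mulrA.
Qed.

Variable W : nat -> pred nat.
Hypothesis W_disjoint : forall i i' k, W i k -> W i' k -> i = i'.
Variables (N : nat -> nat) (x : nat -> R).
Hypothesis WN : forall i k, W i k -> (k < N i)%N.

Let U i w := centered (fun k w => (W i k)%:R * D k w) (fun k => (W i k)%:R * q k) (N i) w.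

Let A i := [set w | x i < U i w].

Let bU i : bm (U i).
Proof. exact: (bm_centered (independent_indicators_restrict (W i) DqI)). Qed.

Let mA i : measurable (A i).
Proof.
rewrite (_ : A i = U i @^-1` `]x i, +oo[%classic).
  by rewrite -[X in measurable X]setTI; apply: (bU i).1.
by apply/seteqP; split => w; rewrite /A /= in_itv/= andbT.
Qed.

Let UE n i w : (N i <= n)%N -> U i w = \sum_(k < n) (W i k)%:R * ((pattern (W i) n w k)%:R - q k).
Proof.
move=> Nn; have := big_ord_widen n (fun k => (W i k)%:R * D k w - (W i k)%:R * q k) Nn.
rewrite /U /centered => ->; rewrite big_mkcond/=; apply: eq_bigr => k _.
rewrite ffunE; case: ltnP => kN.
  rewrite mulrBr; case: (W i k); rewrite ?mul0r ?subrr// !mul1r.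
  have [->|->] := indicator_bool DqI k w; last by rewrite eqxx.
  by rewrite [0 == 1 :> R]eq_sym oner_eq0.
suff -> : W i k = false by rewrite mul0r.
by apply/negP => /WN; rewrite ltnNge kN.
Qed.

Lemma mean_prod_window_events n0 m :
  Ex (fun w => \prod_(i < m) (1 - \1_(A (n0 + i)%N) w)) =
  \prod_(i < m) (1 - Ex (\1_(A (n0 + i)%N))).
Proof.
pose n := \max_(i < m) N (n0 + i)%N.
have Nn (i : 'I_m) : (N (n0 + i) <= n)%N.
  exact: (leq_bigmax_cond (F := fun i : 'I_m => N (n0 + i)%N)).
pose G i (c : {ffun 'I_n -> bool}) : R :=
  1 - ((x (n0 + i)%N < \sum_(k < n) (W (n0 + i)%N k)%:R * ((c k)%:R - q k))%R)%:R.
have GE (i : 'I_m) w : G i (pattern (W (n0 + i)%N) n w) = 1 - \1_(A (n0 + i)%N) w.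
  rewrite /G -UE// indicE; congr (1 - (_ : bool)%:R).
  by apply/idP/idP; rewrite /A inE.
have dis i i' k : W (n0 + i)%N k -> W (n0 + i')%N k -> i = i'.
  by move=> h1 h2; have /addnI := W_disjoint h1 h2.
transitivity (Ex (fun w => \prod_(i < m) G i (pattern (W (n0 + i)%N) n w))).
  by apply: eq_Rintegral => w _; apply: eq_bigr => i _; rewrite GE.
rewrite (@mean_prod_windows (fun i => W (n0 + i)%N) n G m dis); apply: eq_bigr => i _.
have bA : bm (\1_(A (n0 + i)%N) : T -> R) by exact: bm_indic.
rewrite -[X in _ = X - _](Ex_cst P 1) -(ExB P (bm_cst _ _) bA).
by apply: eq_Rintegral => w _; rewrite GE.
Qed.

(** The second Borel-Cantelli lemma: by independence, the probability that none of
    the events from [n0] on occurs is at most the exponential of minus any partial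
    sum of their probabilities. *)
Lemma windows_infinitely_often :
  (forall n0 (C : R), exists m, C <= \sum_(i < m) Ex (\1_(A (n0 + i)%N))) ->
  {ae P, forall w, forall n0, exists2 i, (n0 <= i)%N & x i < U i w}.
Proof.
move=> div; apply: ae_foralln => n0.
pose B := \bigcap_i ~` A (n0 + i)%N.
have mB : measurable B by apply: bigcapT_measurable => i; exact: measurableC.
exists B; split => //; last first.
  move=> w /= h i _ /= Ai; apply: h; exists (n0 + i)%N => //; exact: leq_addr.
have PB C : fine (P B) <= expR (- C).
  have [m Cm] := div n0 C.
  rewrite -Ex_indic//; apply: (@le_trans _ _ (Ex (fun w => \prod_(i < m) (1 - \1_(A (n0 + i)%N) w)))).
    apply: le_Ex; first exact: bm_indic.
      by apply: bm_prod => i _; apply: bmB; [exact: bm_cst|exact: bm_indic].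
    move=> w; rewrite [leLHS]indicE; case: (boolP (w \in B)) => [|_]; last first.
      by apply: prodr_ge0 => i _; rewrite indicE; case: (w \in _); rewrite ?subrr ?subr0.
    rewrite inE => Bw; rewrite big1// => i _; rewrite indicE memNset ?subr0//.
    exact: (Bw i).
  rewrite mean_prod_window_events; apply: (@le_trans _ _ (\prod_(i < m) expR (- Ex (\1_(A (n0 + i)%N))))).
    apply: ler_prod => i _; rewrite subr_ge0 (le_trans (le_Ex P _ _ (g := cst 1) _)) ?Ex_cst//=.
    - exact: expR_ge1Dx.
    - exact: bm_indic.
    - exact: bm_cst.
  by rewrite -expR_sum ler_expR sumrN lerN2.
have fB : P B \is a fin_num by exact: fin_num_measure.
suff h : fine (P B) = 0 by rewrite -[LHS](fineK fB) h.
apply/eqP; rewrite eq_le fine_ge0 ?measure_ge0// andbT leNgt; apply/negP => x0.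
have := PB (1 - ln (fine (P B))); rewrite opprB leNgt => /negP; apply.
by rewrite -[ltRHS]lnK ?posrE// ltr_expR ltrBlDr ltrDl.
Qed.

End disjoint_windows.

Section lil_lower_bound.
Context d (T : measurableType d) (R : realType) (P : probability T R).
Variables (p : nat -> R) (X : nat -> {RV P >-> nat}) (E : nat -> {RV P >-> R}).
Variables (alpha : R) (n : nat).
Hypothesis hp : discrete_distribution p.
Hypothesis hXE : poissonized_karlin p X E.
Hypothesis alpha01 : 0 < alpha < 1.
Hypothesis rv : forall l, 0 < l -> rho p (l * t) / rho p t @[t --> +oo] --> l `^ alpha.
Local Notation Ex f := (Rintegral P setT f).
Let K := occupancy X E n.+1.
Let a := mean_occ p n.+1.
Let v := var_occ p n.+1.

Let p0 k : 0 <= p k. Proof. exact: hp.1. Qed.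

(* Hence a window contains only finitely many boxes. *)
Let prob_cvg0 : p k @[k --> \oo] --> 0.
Proof.
apply: cvg_series_cvg_0; apply: nondecreasing_is_cvgn.
  by apply/nondecreasing_seqP => m; rewrite /series/= big_nat_recr//= lerDl.
by exists 1 => _ [m _ <-]; rewrite /series/= big_mkord sum_prob_le1.
Qed.

(** Regular variation multiplies [rho], and so the variance, by a factor close to
    [b `^ alpha > 1] at each step; this geometric growth beats every multiple of the
    logarithm. *)
Lemma var_occ_geometric (b C : R) : 1 < b ->
  \forall i \near \oo, C * ln (i.+1%:R : R) <= v (b ^+ i).
Proof.
move=> b1; have b0 : 0 < b by exact: lt_trans b1.
have /andP[al0 _] := alpha01.
have ba : 1 < b `^ alpha by rewrite /powR gt_eqF// expR_gt1 mulr_gt0// ln_gt0.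
pose g := (1 + b `^ alpha) / 2.
have g1 : 1 < g by rewrite /g; lra.
have gb : g < b `^ alpha by rewrite /g; lra.
have g0 : 0 < g by exact: lt_trans g1.
pose c := var_coef alpha n.+1; have c0 : 0 < c by exact: (var_coef_gt0 hp alpha01 rv).
have c20 : 0 < c / 2 by rewrite divr_gt0.
have hv : \forall t \near +oo, c / 2 * rho p t <= v t.
  have /cvgrPdist_lt/(_ _ c20) : v t / rho p t @[t --> +oo] --> c by exact: var_occ_rho.
  move=> h; near=> t; have r0 : 0 < rho p t by near: t; exact: (rho_gt0_near rv).
  have : `|c - v t / rho p t| < c / 2 by near: t.
  rewrite ltr_distlC => /andP[+ _]; rewrite ltr_pdivlMr// => /ltW; apply: le_trans.
  by rewrite ler_pM2r//; lra.
have hg : \forall t \near +oo, g * rho p t <= rho p (b * t).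
  have gap : 0 < b `^ alpha - g by rewrite subr_gt0.
  have /cvgrPdist_lt/(_ _ gap) h := rv b0.
  near=> t; have r0 : 0 < rho p t by near: t; exact: (rho_gt0_near rv).
  have : `|b `^ alpha - rho p (b * t) / rho p t| < b `^ alpha - g by near: t.
  by rewrite ltr_distlC => /andP[+ _]; rewrite ltr_pdivlMr// => /ltW; rewrite opprB addrCA subrr addr0.
have [T0 [T0r hT]] := filterI (filterI hv hg) (rho_gt0_near rv).
have [i0 hi0] : exists i0, T0 < b ^+ i0.
  have [m0 _ /(_ m0 (leqnn m0))[h1 h2]] := filterI (near_pow (`|T0| + 1) b1) (near_ln (1 : R)).
  exists m0; apply: lt_le_trans h1; apply: (@lt_le_trans _ _ (`|T0| + 1)).
    by rewrite (le_lt_trans (ler_norm _))// ltrDl.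
  by rewrite ler_peMr// addr_ge0.
have bi0 i : (i0 <= i)%N -> T0 < b ^+ i.
  by move=> ii; apply: lt_le_trans hi0 _; rewrite ler_eXn2l.
have grow m : g ^+ m * rho p (b ^+ i0) <= rho p (b ^+ (i0 + m)).
  elim: m => [|m IH]; first by rewrite expr0 mul1r addn0.
  have [[_ h] _] := hT (b ^+ (i0 + m)) (bi0 _ (leq_addr _ _)).
  rewrite addnS exprS -mulrA [b ^+ _.+1]exprS; apply: le_trans h.
  by rewrite ler_pM2l.
have [_ r0] := hT _ hi0.
pose c1 := c / 2 * rho p (b ^+ i0) * g ^- i0.
have c10 : 0 < c1 by apply: mulr_gt0; [exact: mulr_gt0|rewrite invr_gt0 exprn_gt0].
near=> i.
have ii : (i0 <= i)%N by near: i; exact: nbhs_infty_ge.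
have [[h _] _] := hT _ (bi0 _ ii); apply: le_trans h.
apply: (@le_trans _ _ (c1 * g ^+ i)).
  rewrite -ler_pdivrMl// mulrA; near: i; exact: near_pow.
have -> : c1 * g ^+ i = c / 2 * (g ^+ (i - i0) * rho p (b ^+ i0)).
  rewrite /c1 -[in LHS](subnKC ii) exprD; field.
  by rewrite expf_neq0// gt_eqF.
by rewrite ler_pM2l// -[in leRHS](subnKC ii).
Unshelve. all: by end_near. Qed.

Section along_windows.
Variables (e : R).
Hypothesis e01 : 0 < e < 1.

(* [1 - e] has to be below [((1 - eta) ^+ 2 - eta) / (1 + eta)]; [th] compensates
   the loss [1 + 9 * eps] in Kolmogorov's bound; the variance [de] outside the
   window, relative to the whole, gives a deviation of size [eta] the exponent
   [- eta ^+ 2 / (2 * de) * l = - (2 * l)]. *)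
Let eta := e / 8.
Let eps := e / 72.
Let th := (1 + 9 * eps)^-1.
Let de := eta ^+ 2 / 4.

Let eta0 : 0 < eta. Proof. by rewrite divr_gt0//; case/andP: e01. Qed.
Let eta1 : eta <= 1 / 8. Proof. by have /andP[_ e1] := e01; rewrite /eta; lra. Qed.
Let eps0 : 0 < eps. Proof. by rewrite divr_gt0//; case/andP: e01. Qed.
Let eps1 : eps <= 1. Proof. by have /andP[_ e1] := e01; rewrite /eps; lra. Qed.
Let th9 : 0 < 1 + 9 * eps. Proof. by rewrite addr_gt0// mulr_gt0. Qed.
Let th0 : 0 < th. Proof. by rewrite invr_gt0. Qed.
Let th1 : th <= 1. Proof. by rewrite /th invf_le1// lerDl mulr_ge0// ltW. Qed.
Let th_ge : 1 - eta <= th.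
Proof.
rewrite /th -[leRHS]mul1r ler_pdivlMr//.
have -> : 9 * eps = eta by rewrite /eps /eta; field.
have : 0 <= eta * eta by rewrite mulr_ge0// ltW.
lra.
Qed.
Let de0 : 0 < de. Proof. by rewrite divr_gt0// exprn_gt0. Qed.
Let de_eta : de <= eta.
Proof.
have : eta * eta <= eta by rewrite ler_piMl ?(ltW eta0)//; move: eta1; lra.
by rewrite /de expr2; move: eta0; lra.
Qed.

Variable B : R.
Hypothesis B2 : 2 <= B.
Hypothesis remainder : \forall t \near +oo, forall m,
  \sum_(k < m) (~~ in_window p B t k)%:R *
    (poisson_tail n.+1 (p k * t) * (1 - poisson_tail n.+1 (p k * t))) <= de * v t.

Let B0 : 0 < B. Proof. exact: lt_le_trans B2. Qed.
Let B1 : 1 < B. Proof. by apply: lt_le_trans B2; rewrite ltr1n. Qed.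
Let tt i := (B ^+ 2) ^+ i.
Let tt0 i : 0 < tt i. Proof. by rewrite !exprn_gt0. Qed.
Let l i : R := ln i.+1%:R.
Let l0 i : 0 <= l i. Proof. by rewrite ln_ge0// ler1n. Qed.
Let W i : pred nat := in_window p B (tt i).

Let W_lt i i' k : (i < i')%N -> W i k -> W i' k -> False.
Proof.
move=> ii /andP[lo _] /andP[_ hi].
have : p k * tt i * B ^+ 2 <= p k * tt i'.
  rewrite -mulrA ler_wpM2l// /tt -exprSr ler_eXn2l//.
  by rewrite expr_gt1 ?(ltW B0).
rewrite expr2 mulrA => h; have := le_lt_trans h hi.
by rewrite ltNge ler_peMl// ltW.
Qed.

Let W_disjoint i i' k : W i k -> W i' k -> i = i'.
Proof.
by move=> h h'; case: (ltngtP i i') => // ii; [case: (W_lt ii h h')|case: (W_lt ii h' h)].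
Qed.

Let window_bound i : exists N, forall k, W i k -> (k < N)%N.
Proof.
have c0 : 0 < (tt i * B)^-1 by rewrite invr_gt0 mulr_gt0.
have /cvgrPdist_lt/(_ _ c0) [N _ hN] := prob_cvg0.
exists N => k /andP[lo _]; rewrite ltnNge; apply/negP => /hN.
rewrite /= sub0r normrN ger0_norm// -[ltRHS]mul1r ltr_pdivlMr ?mulr_gt0// ltNge mulrA.
by rewrite lo.
Qed.

Let N i := sval (cid (window_bound i)).
Let WN i k : W i k -> (k < N i)%N.
Proof. exact: (svalP (cid (window_bound i))). Qed.

(** Each box is observed at the time of its own window, which makes the
    observations of all the windows functions of one independent family. *)
Let tau k := if pselect (exists i, W i k) is left h then tt (sval (cid h)) else 0.

Let tauE i k : W i k -> tau k = tt i.
Proof.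
rewrite /tau => h; case: pselect => [h'|[]]; last by exists i.
by case: (cid h') => i' /= h''; rewrite (W_disjoint h h'').
Qed.

Let tau0 k : 0 <= cst (0 : R) k <= tau k.
Proof. by rewrite lexx /tau /=; case: pselect => // h; exact: ltW. Qed.

Let D := arrival X E n.+1 (cst 0) tau.
Let q := crossing_prob p (cst 0) tau n.+1.
Let DqI : independent_indicators P D q := arrival_independent hXE n.+1 tau0.

Let WD i k w : W i k -> D k w = arrival X E n.+1 (cst 0) (cst (tt i)) k w.
Proof. by move=> h; rewrite /D /arrival (tauE h). Qed.

Let pt i k := poisson_tail n.+1 (p k * tt i).

Let Wq i k : W i k -> q k = pt i k.
Proof. by move=> h; rewrite /q /crossing_prob (tauE h) /= mulr0 poisson_tail0 subr0. Qed.

Let WDq i := independent_indicators_restrict (W i) DqI.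
Let U i w := centered (fun k w => (W i k)%:R * D k w) (fun k => (W i k)%:R * q k) (N i) w.
Let V i := variance_sum (fun k => (W i k)%:R * q k) (N i).

Let VE i : V i = \sum_(k < N i) (W i k)%:R * (pt i k * (1 - pt i k)).
Proof.
apply: eq_bigr => k _; case: (boolP (W i k)) => [h|_]; last by rewrite !mul0r.
by rewrite !mul1r (Wq h).
Qed.

Let pt01 i k : 0 <= pt i k <= 1.
Proof. by rewrite /pt poisson_tail_ge0 ?poisson_tail_le1 ?mulr_ge0// ltW. Qed.

Let pt_var i k : 0 <= pt i k * (1 - pt i k).
Proof. by have /andP[h1 h2] := pt01 i k; rewrite mulr_ge0// subr_ge0. Qed.

Let split_sum i m (f g : nat -> R) : (N i <= m)%N -> (forall k, W i k -> g k = f k) ->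
  \sum_(k < m) (~~ W i k)%:R * f k = \sum_(k < m) f k - \sum_(k < N i) (W i k)%:R * g k.
Proof.
move=> Nm gf; apply/eqP; rewrite -subr_eq opprK eq_sym; apply/eqP.
rewrite (big_ord_widen m (fun k => (W i k)%:R * g k) Nm).
rewrite [X in _ = _ + X]big_mkcond/= -big_split/=; apply: eq_bigr => k _.
case: (boolP (W i k)) => [h|_]; last by rewrite mul1r mul0r if_same addr0.
by rewrite mul0r add0r mul1r (WN h) gf.
Qed.

Let window_sum i m : (N i <= m)%N ->
  \sum_(k < m) pt i k * (1 - pt i k) =
  V i + \sum_(k < m) (~~ W i k)%:R * (pt i k * (1 - pt i k)).
Proof.
move=> Nm; rewrite (split_sum (f := fun k => pt i k * (1 - pt i k)) (g := fun k => pt i k * (1 - pt i k)) Nm)//.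
by rewrite VE addrC subrK.
Qed.

Let near_tt (Q : R -> Prop) : (\forall t \near +oo, Q t) -> \forall i \near \oo, Q (tt i).
Proof.
case=> M [Mr hM]; have B21 : 1 < B ^+ 2 by rewrite expr_gt1 ?(ltW B0).
near=> i; apply: hM; apply: (@lt_le_trans _ _ (`|M| + 1)).
  by rewrite (le_lt_trans (ler_norm _))// ltrDl.
apply: (@le_trans _ _ ((`|M| + 1) * l i)).
  by rewrite ler_peMr ?addr_ge0//; near: i; exact: near_ln.
by near: i; exact: near_pow.
Unshelve. all: by end_near. Qed.

Let V_ge : \forall i \near \oo, (1 - de) * v (tt i) <= V i.
Proof.
have := near_tt remainder; apply: filterS => i rem.
rewrite mulrBl mul1r lerBlDr.
have c := @var_occ_cvg _ _ hp n _ (ltW (tt0 i)).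
rewrite -[leLHS](cvg_lim (@Rhausdorff R) c); apply: limr_le; first by apply/cvg_ex; eexists; exact: c.
near=> m; rewrite (window_sum (_ : (N i <= m)%N)); last by near: m; exact: nbhs_infty_ge.
by rewrite lerD2l; exact: rem.
Unshelve. all: by end_near. Qed.

Let V_le i : V i <= v (tt i).
Proof.
apply: le_trans (var_occ_ge_sum hp n (N i) (ltW (tt0 i))).
by rewrite (window_sum (leqnn _)) lerDl sumr_ge0// => k _; rewrite mulr_ge0.
Qed.

Let x i := V i * Num.sqrt (2 * th * l i / V i).

Let V_large (C : R) : \forall i \near \oo, C * l i <= V i.
Proof.
near=> i.
have h1 : (1 - de) * v (tt i) <= V i by near: i; exact: V_ge.
apply: le_trans h1.
have h2 : 2 * `|C| * l i <= v (tt i).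
  by near: i; apply: var_occ_geometric; rewrite expr_gt1 ?(ltW B0).
have h3 : 1 / 2 <= 1 - de by have := eta1; have := de_eta; lra.
have C1 : C * l i <= `|C| * l i by rewrite ler_wpM2r// ler_norm.
have C0 : 0 <= `|C| * l i by rewrite mulr_ge0.
have : 1 / 2 * (2 * `|C| * l i) <= (1 - de) * v (tt i).
  by apply: ler_pM => //; rewrite mulr_ge0// mulr_ge0.
by apply: le_trans; lra.
Unshelve. all: by end_near. Qed.

(** By the choice of [th] the exponent in Kolmogorov's bound is exactly [- l i]. *)
Let window_event_prob : \forall i \near \oo,
  expR (- l i) / 2 <= Ex (\1_[set w | x i < U i w]).
Proof.
pose C := 2 * (96 / eps ^+ 2) ^+ 2.
have e2 : 0 < eps ^+ 2 by rewrite exprn_gt0.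
near=> i.
have VC : C * l i <= V i by near: i; exact: V_large.
have V1 : 1 * l i <= V i by near: i; exact: V_large.
have l1 : 1 <= l i by near: i; exact: near_ln.
have l4 : 2 * ln 4 / (th * eps ^+ 2) <= l i by near: i; exact: near_ln.
have li0 : 0 < l i by exact: lt_le_trans l1.
have V0 : 0 < V i by apply: lt_le_trans V1; rewrite mul1r.
pose c := Num.sqrt (2 * th * l i / V i).
have ratio0 : 0 < 2 * th * l i / V i by rewrite divr_gt0// !mulr_gt0.
have c0 : 0 < c by rewrite sqrtr_gt0.
have c2 : c ^+ 2 = 2 * th * l i / V i by rewrite sqr_sqrtr// ltW.
have Vc2 : V i * c ^+ 2 = 2 * th * l i by rewrite c2; field; rewrite gt_eqF.
have := @kolmogorov_lower _ _ _ P (U i) (V i) c eps (bm_centered (WDq i) (N i)) V0 c0 eps0 eps1.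
rewrite Vc2.
have -> : 2 * th * l i / 2 * (1 + 9 * eps) = l i by rewrite /th; field; rewrite gt_eqF.
apply.
- rewrite -ler_pdivlMl// mulrC -(@ler_pXn2r _ 2)// ?nnegrE ?divr_ge0 ?(ltW c0) ?(ltW e2)//.
  rewrite c2 ler_pdivrMr//.
  have p0' : 0 < (eps ^+ 2 / 96) ^+ 2 by rewrite exprn_gt0// divr_gt0.
  apply: (@le_trans _ _ ((eps ^+ 2 / 96) ^+ 2 * (C * l i))); last by rewrite ler_pM2l.
  have -> : (eps ^+ 2 / 96) ^+ 2 * (C * l i) = 2 * l i by rewrite /C; field; rewrite gt_eqF.
  by rewrite mulrAC ler_piMr// mulr_ge0.
- have te : 0 < th * eps ^+ 2 by exact: mulr_gt0.
  move: l4; rewrite ler_pdivrMr//.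
  have -> : 2 * th * l i * (eps ^+ 2 / 4) = (l i * (th * eps ^+ 2)) / 2 by field.
  by rewrite ler_pdivlMr// mulrC.
- move=> h h0 h1; have hN : `|h| <= 1 by rewrite ger0_norm.
  have := mean_exp_centered_ge (WDq i) (N i) hN; have := mean_exp_centered_le (WDq i) (N i) hN.
  by rewrite ger0_norm.
Unshelve. all: by end_near. Qed.

(** Since [expR (- l i)] is [1 / (i + 1)], this is the divergence of the harmonic
    series, by comparison with the logarithm. *)
Let window_events_diverge n0 (C : R) :
  exists m, C <= \sum_(i < m) Ex (\1_[set w | x (n0 + i)%N < U (n0 + i)%N w]).
Proof.
have [i1 _ hi1] := window_event_prob.
have grow m : (ln (n0 + i1 + m).+1%:R - ln (n0 + i1).+1%:R) / 2 <=
    \sum_(i < i1 + m) Ex (\1_[set w | x (n0 + i)%N < U (n0 + i)%N w]) :> R.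
  elim: m => [|m IH].
    rewrite !addn0 subrr mul0r sumr_ge0// => i _; apply: Ex_ge0 => w.
    by rewrite indicE; case: (w \in _).
  rewrite !addnS big_ord_recr/=.
  have := hi1 (n0 + (i1 + m))%N; rewrite /= => h.
  apply: le_trans (lerD IH (h _)); last by rewrite addnA addnAC leq_addl.
  rewrite -mulrDl ler_pM2r ?invr_gt0// addrAC lerD2r /l expRN lnK ?posrE// addnA.
  set k := (n0 + i1 + m)%N.
  have -> : (k.+2%:R : R) = k.+1%:R * (1 + k.+1%:R^-1).
    by rewrite mulrDr mulr1 divff ?pnatr_eq0// natr1.
  rewrite lnM ?posrE ?addr_gt0 ?invr_gt0// lerD2l; apply: le_ln1Dx.
  by rewrite (lt_le_trans (ltrN10 R))// invr_ge0.
have [m _ hm] := near_ln (2 * C + ln (n0 + i1).+1%:R).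
exists (i1 + m)%N; apply: le_trans (grow m); rewrite ler_pdivlMr// lerBrDr.
have := hm (n0 + i1 + m)%N; rewrite /= leq_addl [C * 2]mulrC; exact.
Qed.

Let infinitely_often : {ae P, forall w, forall n0, exists2 i, (n0 <= i)%N & x i < U i w}.
Proof. exact: (windows_infinitely_often DqI W_disjoint WN window_events_diverge). Qed.

Let y i := eta * Num.sqrt (2 * v (tt i) * l i).

(** The boxes outside the window of [i], all observed at the time [tt i], have a total
    variance of at most [de * v (tt i)], to which the Chernoff bound applies. *)
Let remainder_tail : \forall i \near \oo,
  (P [set w | (y i <= - ((K (tt i) w - a (tt i)) - U i w))%R] <= (expR (- (2 * l i)))%:E)%E.
Proof.
have rem0 := near_tt remainder.
near=> i.
have rem : forall m, \sum_(k < m) (~~ W i k)%:R * (pt i k * (1 - pt i k)) <= de * v (tt i).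
  by near: i.
have l1 : 1 <= l i by near: i; exact: near_ln.
have V1 : 1 * l i <= V i by near: i; exact: V_large.
have VC : 2 * (eta / (2 * de)) ^+ 2 * l i <= V i by near: i; exact: V_large.
have v0 : 0 < v (tt i).
  by apply: lt_le_trans (V_le i); apply: lt_le_trans V1; rewrite mul1r (lt_le_trans ltr01).
have t0 := ltW (tt0 i).
have stk (k : nat) : 0 <= cst (0 : R) k <= cst (tt i) k by rewrite lexx.
pose Di := arrival X E n.+1 (cst 0) (cst (tt i)).
pose qi := crossing_prob p (cst 0) (cst (tt i)) n.+1.
have qiE k : qi k = pt i k by rewrite /qi /crossing_prob /= mulr0 poisson_tail0 subr0.
have DiqI : independent_indicators P Di qi by exact: arrival_independent.
have DcI := independent_indicators_restrict (fun k => ~~ W i k) DiqI.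
pose S w := K (tt i) w - \sum_(k < N i) (W i k)%:R * D k w.
pose a' := a (tt i) - \sum_(k < N i) (W i k)%:R * q k.
have mS : measurable_fun setT S.
  apply: measurable_funB; first exact: measurable_occupancy.
  apply: measurable_sum => k; apply: measurable_funM => //.
  exact: (indicator_measurable DqI).
have cS : {ae P, forall w, \sum_(k < m) (~~ W i k)%:R * Di k w @[m --> \oo] --> S w}.
  apply: filterS (arrival_series_from_start hXE n t0) => w cw.
  have h : \sum_(k < m) Di k w - \sum_(k < N i) (W i k)%:R * D k w @[m --> \oo] --> S w.
    by apply: cvgB; [exact: cw|exact: cvg_cst].
  apply: cvg_trans h; apply: near_eq_cvg; near=> m.
  rewrite -(split_sum (f := Di^~ w) (g := D^~ w))//; last by move=> k; exact: WD.
  by near: m; exact: nbhs_infty_ge.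
have ca : \sum_(k < m) (~~ W i k)%:R * qi k @[m --> \oo] --> a'.
  have h : \sum_(k < m) pt i k - \sum_(k < N i) (W i k)%:R * q k @[m --> \oo] --> a'.
    by apply: cvgB; [exact: mean_occ_cvg|exact: cvg_cst].
  apply: cvg_trans h; apply: near_eq_cvg; near=> m.
  rewrite -(split_sum (f := pt i) (g := q)).
  - by apply: eq_bigr => k _; rewrite qiE.
  - by near: m; exact: nbhs_infty_ge.
  - by move=> k; exact: Wq.
have vsE m : variance_sum (fun k => (~~ W i k)%:R * qi k) m =
    \sum_(k < m) (~~ W i k)%:R * (pt i k * (1 - pt i k)).
  by apply: eq_bigr => k _; rewrite qiE; case: (W i k); rewrite ?mul0r ?mul1r.
have vc : cvgn (variance_sum (fun k => (~~ W i k)%:R * qi k)).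
  apply: nondecreasing_is_cvgn.
    by apply/nondecreasing_seqP => m; rewrite !vsE big_ord_recr/= lerDl mulr_ge0.
  by exists (de * v (tt i)) => _ [m _ <-]; rewrite vsE.
have vl : limn (variance_sum (fun k => (~~ W i k)%:R * qi k)) <= de * v (tt i).
  by apply: limr_le => //; apply: nearW => m; rewrite vsE.
pose h := y i / (2 * de * v (tt i)).
have sq0 : 0 <= 2 * v (tt i) * l i by rewrite mulr_ge0// mulr_ge0// ltW.
have dv0 : 0 < 2 * de * v (tt i) by apply: mulr_gt0 => //; exact: mulr_gt0.
have y0 : 0 <= y i by rewrite mulr_ge0 ?sqrtr_ge0// ltW.
have y2 : y i ^+ 2 = eta ^+ 2 * (2 * v (tt i) * l i) by rewrite /y exprMn sqr_sqrtr.
have h0 : 0 <= h by rewrite divr_ge0// ltW.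
have h1 : h <= 1.
  rewrite -(@ler_pXn2r _ 2)// ?nnegrE// expr1n expr_div_n y2 ler_pdivrMr ?exprn_gt0// mul1r.
  have -> : eta ^+ 2 * (2 * v (tt i) * l i) = (2 * de) ^+ 2 * v (tt i) * (2 * (eta / (2 * de)) ^+ 2 * l i).
    by field; rewrite gt_eqF.
  have -> : (2 * de * v (tt i)) ^+ 2 = (2 * de) ^+ 2 * v (tt i) * v (tt i) by ring.
  apply: ler_wpM2l; last exact: (le_trans VC (V_le i)).
  by rewrite mulr_ge0 ?sqr_ge0// ltW.
have SE w : S w - a' = (K (tt i) w - a (tt i)) - U i w.
  by rewrite /S /a' /U /centered sumrB; ring.
have -> : - (2 * l i) = de * v (tt i) * h ^+ 2 - h * y i.
  rewrite /h expr_div_n y2.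
  have -> : eta ^+ 2 = 4 * de by rewrite /de; field.
  rewrite [_ / _ * y i]mulrAC -expr2 y2; have -> : eta ^+ 2 = 4 * de by rewrite /de; field.
  by field; rewrite !gt_eqF.
have mZ : measurable_fun setT (fun w => - ((K (tt i) w - a (tt i)) - U i w)).
  by apply: measurableT_comp => //; under eq_fun do rewrite -SE; exact: measurable_funB.
apply: (@chernoff_bound _ _ _ P (fun w => - ((K (tt i) w - a (tt i)) - U i w)) h (de * v (tt i) * h ^+ 2) (y i) mZ h0).
have hN : `|- h| <= 1 by rewrite normrN ger0_norm.
have := mean_exp_series_le DcI mS cS ca vc hN.
rewrite normrN ger0_norm// sqrrN => hS.
apply: (@le_trans _ _ (\int[P]_w (expR (- h * (S w - a')))%:E)%E).
  by rewrite le_eqVlt; apply/orP; left; apply/eqP; apply: eq_integral => w _; rewrite SE mulrN mulNr.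
apply: (le_trans hS); rewrite lee_fin ler_expR.
apply: (@le_trans _ _ (de * v (tt i) * (h ^+ 2 / 2 * (1 + h)))).
  by apply: ler_wpM2r => //; apply: mulr_ge0; [rewrite divr_ge0 ?sqr_ge0|rewrite addr_ge0].
rewrite ler_wpM2l ?(ltW (mulr_gt0 de0 v0))// -[leRHS](_ : h ^+ 2 / 2 * 2 = _); last by field.
by rewrite ler_wpM2l ?divr_ge0 ?sqr_ge0//; lra.
Unshelve. all: by end_near. Qed.

(** The variance is at most the time [tt i], whose logarithm is linear in [i]. *)
Let loglog_le : \forall i \near \oo, ln (ln (v (tt i))) <= (1 + eta) * l i.
Proof.
near=> i.
have l1 : 1 <= l i by near: i; exact: near_ln.
have V1 : 1 * l i <= V i by near: i; exact: V_large.
have lB : ln (2 * ln B) / eta <= l i by near: i; exact: near_ln.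
have v0 : 0 < v (tt i).
  by apply: lt_le_trans (V_le i); apply: lt_le_trans V1; rewrite mul1r (lt_le_trans ltr01).
have vt : v (tt i) <= tt i.
  by apply: le_trans (var_occ_le hp n (ltW (tt0 i))) _; exact: (mean_occ_le hp n (ltW (tt0 i))).
have B20 : 0 < 2 * ln B by rewrite mulr_gt0// ln_gt0.
have lv : ln (v (tt i)) <= expR ((1 + eta) * l i).
  apply: (@le_trans _ _ (ln (tt i))); first by rewrite ler_ln ?posrE.
  have -> : ln (tt i) = i%:R * (2 * ln B).
    by rewrite /tt lnXn ?exprn_gt0// lnXn// !mulr_natl.
  have -> : expR ((1 + eta) * l i) = i.+1%:R * expR (eta * l i).
    by rewrite mulrDl mul1r expRD lnK// posrE.
  apply: ler_pM; [by []|exact: ltW|by rewrite ler_nat|].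
  by rewrite -[leLHS]lnK ?posrE// ler_expR [eta * _]mulrC -ler_pdivrMr.
have [lv0|lv0] := leP (ln (v (tt i))) 0.
  by rewrite ln0// mulr_ge0// addr_ge0// ltW.
by rewrite -[leRHS]expRK ler_ln ?posrE ?expR_gt0.
Unshelve. all: by end_near. Qed.

Lemma lil_lower_along_windows : {ae P, forall w, forall T0, exists2 t, T0 < t &
  (1 - e) * Num.sqrt (2 * (v t * ln (ln (v t)))) <= K t w - a t}.
Proof.
have [N1 _ hN1] := remainder_tail.
pose Z i w := - ((K (tt i) w - a (tt i)) - U i w).
have mZ i : measurable_fun setT (Z i).
  apply: measurableT_comp => //; apply: measurable_funB; last exact: (bm_centered (WDq i) (N i)).1.
  by apply: measurable_funB => //; exact: measurable_occupancy.
have mF i : measurable [set w | y i <= Z i w].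
  rewrite (_ : [set w | _] = Z i @^-1` `[y i, +oo[%classic).
    by rewrite -[X in measurable X]setTI; exact: mZ.
  by apply/seteqP; split => w; rewrite /= in_itv/= andbT.
have io := eventually_not (e := 1) (C := 1) (N := N1) ltr01 ler01 mF.
have {}io : {ae P, forall w, exists M, forall m, (M <= m)%N -> ~ y m <= Z m w}.
  apply: io => m Nm; rewrite mul1r; apply: le_trans (hN1 m Nm) _.
  by rewrite lee_fin ler_expR.
apply: filterS2 infinitely_often io => w iow [M hM] T0.
have [N2 _ hN2] := filterI (filterI V_ge loglog_le) (filterI (near_ln (1 : R)) (near_tt (nbhs_pinfty_gt (num_real T0)))).
have [i] := iow (maxn M N2); rewrite geq_max => /andP[Mi Ni] xU.
have [[Vge ll] [l1 Tt]] := hN2 i Ni.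
exists (tt i) => //.
have /negP := hM i Mi; rewrite -ltNge /Z => Zy.
pose s := Num.sqrt (2 * v (tt i) * l i).
have s0 : 0 <= s by exact: sqrtr_ge0.
have v0 : 0 <= v (tt i) by exact: (var_occ_ge0 hp n (ltW (tt0 i))).
have sE c : 0 <= c -> c * s = Num.sqrt (c ^+ 2 * (2 * v (tt i) * l i)).
  by move=> c0; rewrite sqrtrM ?sqr_ge0// sqrtr_sqr ger0_norm.
have de1 : 0 <= 1 - de by have := eta1; have := de_eta; lra.
have V0 : 0 <= V i by apply: le_trans Vge; rewrite mulr_ge0.
have xE : x i = Num.sqrt (2 * th * l i * V i).
  have [V00|Vn0] := eqVneq (V i) 0; first by rewrite /x V00 mul0r mulr0 sqrtr0.
  rewrite /x -{1}(ger0_norm V0) -sqrtr_sqr -sqrtrM ?sqr_ge0//; congr Num.sqrt.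
  by field.
have xs : th * (1 - de) * s <= x i.
  rewrite sE ?mulr_ge0 ?(ltW th0)// xE; apply: ler_wsqrtr.
  have -> : (th * (1 - de)) ^+ 2 * (2 * v (tt i) * l i) = (2 * th * l i) * (th * (1 - de) * ((1 - de) * v (tt i))) by ring.
  rewrite ler_wpM2l ?mulr_ge0 ?(ltW th0)//; apply: le_trans Vge.
  rewrite ler_piMl ?mulr_ge0// mulr_ile1 ?(ltW th0)//.
  by rewrite lerBlDr lerDl ltW.
have s2 : Num.sqrt (2 * (v (tt i) * ln (ln (v (tt i))))) <= (1 + eta) * s.
  rewrite sE ?addr_ge0 ?(ltW eta0)//; apply: ler_wsqrtr.
  have -> : (1 + eta) ^+ 2 * (2 * v (tt i) * l i) = 2 * (v (tt i) * ((1 + eta) * ((1 + eta) * l i))) by ring.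
  rewrite ler_pM2l// ler_wpM2l//; apply: le_trans ll _.
  by rewrite ler_peMl ?mulr_ge0 ?addr_ge0 ?(ltW eta0)// lerDl ltW.
have e1 : 0 <= 1 - e by have /andP[_ e1] := e01; lra.
apply: le_trans (ler_wpM2l e1 s2) _; rewrite mulrA.
have key : (1 - e) * (1 + eta) * s <= (th * (1 - de) - eta) * s.
  rewrite ler_wpM2r//.
  have h1 : (1 - eta) * (1 - eta) <= th * (1 - de).
    by apply: ler_pM => //; have := eta1; have := de_eta; lra.
  have h2 : 0 <= eta * eta by rewrite mulr_ge0 ?(ltW eta0).
  have -> : e = 8 * eta by rewrite /eta; field.
  by move: h1 h2 (ltW eta0); lra.
apply: (le_trans key); rewrite mulrBl.
move: xs xU Zy; rewrite /y -/s; lra.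
Qed.

End along_windows.

Theorem lil_lower e : 0 < e < 1 -> {ae P, forall w, forall T0, exists2 t, T0 < t &
  (1 - e) * Num.sqrt (2 * (v t * ln (ln (v t)))) <= K t w - a t}.
Proof.
move=> e01; have /andP[e0 _] := e01.
have d0 : 0 < (e / 8) ^+ 2 / 4 by rewrite divr_gt0// exprn_gt0// divr_gt0.
have [B B2 rem] := window_remainder hp alpha01 rv n d0.
exact: (lil_lower_along_windows e01 B2 rem).
Qed.

End lil_lower_bound.

(** * The law of the iterated logarithm *)

Section conclusions.
Context (R : realType) (p : nat -> R) (alpha : R) (L : R -> R).
Hypothesis hp : discrete_distribution p.
Hypothesis hpinf : infinite_set [set k | 0 < p k].
Hypothesis alpha01 : 0 < alpha < 1.
Hypothesis rv : forall l, 0 < l -> rho p (l * t) / rho p t @[t --> +oo] --> l `^ alpha.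
Hypothesis hrho : asymp_equiv (rho p) (fun t => t `^ alpha * L t).

Let rho_gt0 := rho_gt0_near rv.

Lemma asymp_equiv_rho (x y : R -> R) (c : R) : 0 < c ->
  x t / rho p t @[t --> +oo] --> c -> (forall t, 0 <= t -> y t = x t) ->
  asymp_equiv y (fun t => c * (t `^ alpha * L t)).
Proof.
move=> c0 xc yx; rewrite /asymp_equiv.
have h : c^-1 * (x t / rho p t) * (rho p t / (t `^ alpha * L t)) @[t --> +oo] --> (1 : R).
  rewrite -[X in _ --> X]mulr1; apply: cvgM => //.
  by rewrite -[X in _ --> X](mulVf (lt0r_neq0 c0)); apply: cvgM => //; exact: cvg_cst.
apply: cvg_trans h; apply: near_eq_cvg; near=> t => /=.
have t0 : 0 <= t by near: t; apply: nbhs_pinfty_ge; rewrite num_real.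
have r0 : 0 < rho p t by near: t; exact: rho_gt0.
by rewrite (yx t t0) [(c * _)^-1]invfM; move: (t `^ alpha * L t)^-1 => z; field; rewrite !gt_eqF.
Unshelve. all: by end_near. Qed.

Lemma cvg_pinfty_rho (x : R -> R) (c : R) : 0 < c ->
  x t / rho p t @[t --> +oo] --> c -> x t @[t --> +oo] --> +oo.
Proof.
move=> c0 xc; have c20 : 0 < c / 2 by rewrite divr_gt0.
have /cvgrPdist_lt/(_ _ c20) h := xc.
apply/cvgryPge => A; near=> t.
have r0 : 0 < rho p t by near: t; exact: rho_gt0.
have : `|c - x t / rho p t| < c / 2 by near: t.
rewrite ltr_distlC => /andP[+ _]; rewrite ltr_pdivlMr// => /ltW; apply: le_trans.
have -> : c - c / 2 = c / 2 by field.
rewrite -ler_pdivrMl//; near: t.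
by have /cvgryPge := rho_unbounded hp hpinf; exact.
Unshelve. all: by end_near. Qed.

Lemma cvg_ratio_rho (x y : R -> R) (c c' : R) : 0 < c' ->
  x t / rho p t @[t --> +oo] --> c -> y t / rho p t @[t --> +oo] --> c' ->
  x t / y t @[t --> +oo] --> c / c'.
Proof.
move=> c'0 xc yc.
have h : x t / rho p t * (y t / rho p t)^-1 @[t --> +oo] --> c / c'.
  by apply: cvgM => //; apply: cvgV => //; rewrite gt_eqF.
apply: cvg_trans h; apply: near_eq_cvg; near=> t => /=.
have r0 : 0 < rho p t by near: t; exact: rho_gt0.
by rewrite invf_div; move: (y t)^-1 => z; field; rewrite gt_eqF.
Unshelve. all: by end_near. Qed.

End conclusions.

Lemma limf_esup_eq (R : realType) (f : R -> R) (l : R) :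
  (forall e : R, 0 < e -> \forall t \near +oo, f t <= l + e) ->
  (forall e : R, 0 < e -> forall T0, exists2 t, T0 < t & l - e <= f t) ->
  limf_esup (fun t => (f t)%:E) (pinfty_nbhs R) = l%:E.
Proof.
move=> up lo; apply/eqP; rewrite eq_le; apply/andP; split.
  apply/lee_addgt0Pr => e e0; apply: (@le_trans _ _ (ereal_sup ((fun t => (f t)%:E) @` [set t | f t <= l + e]))).
    by apply: ereal_inf_lbound; exists [set t | f t <= l + e] => //; exact: up.
  by apply: ub_ereal_sup => _ [t /= ft <-]; rewrite -EFinD lee_fin.
apply: le_ereal_inf_tmp => _ [A [M [Mr hM]] <-].
apply/lee_addgt0Pr => e e0; have [t Mt lt] := lo e e0 M.
rewrite -leeBlDr//; apply: (@le_trans _ _ (f t)%:E); first by rewrite -EFinB lee_fin.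
by apply: ereal_sup_ubound; exists t => //; exact: hM.
Qed.

Theorem theorem4p3 (R : realType) (d : measure_display) (T : measurableType d)
    (P : probability T R) (p : nat -> R)
    (X : nat -> {RV P >-> nat}) (E : nat -> {RV P >-> R})
    (alpha : R) (L : R -> R)
    (hp : discrete_distribution p)
    (hpinf : infinite_set [set k | 0 < p k])
    (hXE : poissonized_karlin p X E)
    (halpha : 0 < alpha < 1)
    (hL : slowly_varying L)
    (hrho : asymp_equiv (rho p) (fun t => t `^ alpha * L t)) :
  forall j : nat, (0 < j)%N ->
    let K := occupancy X E j in
    let EK := fun t => fine 'E_P[K t] in
    let VK := fun t => fine 'V_P[K t] in
    [/\ {ae P, forall w,
          limf_esup
            (fun t => ((K t w - EK t) / Num.sqrt (VK t * ln (ln (VK t))))%:E)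
            (pinfty_nbhs R) = (Num.sqrt 2)%:E},
        asymp_equiv EK
          (fun t => Gamma (j%:R - alpha) / (j.-1)`!%:R * (t `^ alpha * L t)),
        asymp_equiv VK (fun t => var_coef alpha j * (t `^ alpha * L t)) &
        0 < var_coef alpha j].
Proof.
case=> // n _ K EK VK.
have rv := regular_variation_rho hL hrho.
have EKE t : 0 <= t -> EK t = mean_occ p n.+1 t.
  by move=> t0; rewrite /EK (expectation_occupancy hp hXE n t0).
have VKE t : 0 <= t -> VK t = var_occ p n.+1 t.
  by move=> t0; rewrite /VK (variance_occupancy hp hXE n t0).
have ca : mean_occ p n.+1 t / rho p t @[t --> +oo] --> Gamma (n.+1%:R - alpha) / n`!%:R.
  exact: (mean_occ_rho hp halpha rv).
have ca0 := mean_coef_gt0 hp halpha rv n.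
have cv : var_occ p n.+1 t / rho p t @[t --> +oo] --> var_coef alpha n.+1.
  exact: (var_occ_rho hp halpha rv).
have cv0 := var_coef_gt0 hp halpha rv n.
split => //; last 2 first.
- exact: (asymp_equiv_rho rv hrho ca0 ca EKE).
- exact: (asymp_equiv_rho rv hrho cv0 cv VKE).
pose a := mean_occ p n.+1; pose v := var_occ p n.+1.
have a_oo : a t @[t --> +oo] --> +oo by exact: (cvg_pinfty_rho hp hpinf rv ca0 ca).
have v_oo : v t @[t --> +oo] --> +oo by exact: (cvg_pinfty_rho hp hpinf rv cv0 cv).
have va : v t / a t @[t --> +oo] --> var_coef alpha n.+1 / (Gamma (n.+1%:R - alpha) / n`!%:R).
  exact: (cvg_ratio_rho rv ca0 cv ca).
have Kmono : {ae P, forall w, forall s t, 0 <= s -> s <= t -> K s w <= K t w}.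
  apply: filterS (ae_regular hXE) => w rw s t s0 st.
  by apply: (occupancy_homo X rw) => //; rewrite st andbT (le_trans _ s0)// lerN10.
have upper (e : R) : 0 < e -> {ae P, forall w, \forall t \near +oo,
    K t w - a t <= (1 + e) * Num.sqrt (2 * (v t * ln (ln (v t))))}.
  move=> e0; apply: (@lil_upper _ _ _ P K a v _ _ _ _ a_oo _ _ _ va e e0 Kmono).
  - by move=> t; exact: measurable_occupancy.
  - by move=> s t; exact: mean_occ_incr.
  - exact: mean_occ0.
  - by move=> s t h s0 st; exact: (mean_exp_increment hp hXE n s0 st).
  - by move=> t h t0; exact: (mean_exp_occupancy hp hXE n t0).
  - exact: divr_gt0.
have lower (e : R) : 0 < e < 1 -> {ae P, forall w, forall T0, exists2 t, T0 < t &
    (1 - e) * Num.sqrt (2 * (v t * ln (ln (v t)))) <= K t w - a t}.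
  exact: (lil_lower n hp hXE halpha rv).
(* countably many values of [e] are enough, and keep the exceptional set null *)
have small (e : R) : 0 < e -> exists m : nat, m.+2%:R^-1 * Num.sqrt 2 <= e.
  move=> e0; exists (Num.truncn (Num.sqrt 2 / e)).
  rewrite mulrC ler_pdivrMr// mulrC -ler_pdivrMr//.
  by apply: (le_trans (ltW (truncnS_gt _))); rewrite ler_nat.
have e01 m : 0 < (m.+2%:R^-1 : R) < 1 by rewrite invr_gt0 ltr0n/= invf_lt1// ltr1n.
have uppers : {ae P, forall w, forall m : nat, \forall t \near +oo,
    K t w - a t <= (1 + m.+2%:R^-1) * Num.sqrt (2 * (v t * ln (ln (v t))))}.
  by apply: ae_foralln => m; apply: upper; case/andP: (e01 m).
have lowers : {ae P, forall w, forall m : nat, forall T0, exists2 t, T0 < t &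
    (1 - m.+2%:R^-1) * Num.sqrt (2 * (v t * ln (ln (v t)))) <= K t w - a t}.
  by apply: ae_foralln => m; exact: lower.
(* so that the iterated logarithm of the variance is at least 1 *)
have [M [Mr hM]] : \forall t \near +oo, expR (expR 1) <= v t.
  by move/cvgryPge : v_oo; apply.
have pos t : Num.max 0 M < t -> [/\ EK t = a t, VK t = v t & 0 < v t * ln (ln (v t))].
  rewrite gt_max => /andP[t0 /hM vt]; rewrite EKE ?VKE ?ltW//; split => //.
  have v0 : 0 < v t by apply: lt_le_trans vt; exact: expR_gt0.
  have lv : expR 1 <= ln (v t) by rewrite -[leLHS]expRK ler_ln ?posrE ?expR_gt0.
  have lv0 : 0 < ln (v t) by apply: lt_le_trans lv; exact: expR_gt0.
  rewrite mulr_gt0// (lt_le_trans ltr01)// -[leLHS]expRK ler_ln ?posrE ?expR_gt0//.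
have sqrtE x : Num.sqrt (2 * x) = Num.sqrt 2 * Num.sqrt x :> R by rewrite sqrtrM.
apply: filterS2 uppers lowers => w up lo; apply: limf_esup_eq => e e0; have [m me] := small e e0.
  near=> t.
  have [-> -> pt] : [/\ EK t = a t, VK t = v t & 0 < v t * ln (ln (v t))].
    by apply: pos; near: t; exact: (nbhs_pinfty_gt (num_real _)).
  rewrite ler_pdivrMr ?sqrtr_gt0//.
  have : K t w - a t <= (1 + m.+2%:R^-1) * Num.sqrt (2 * (v t * ln (ln (v t)))) by near: t; exact: up.
  move=> /le_trans; apply; rewrite sqrtE mulrA ler_wpM2r ?sqrtr_ge0//.
  by rewrite mulrDl mul1r lerD2l.
move=> T0; have [t] := lo m (Num.max T0 (Num.max 0 M)).
rewrite gt_max => /andP[Tt /pos[Et Vt pt]] h; exists t => //.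
rewrite Et Vt ler_pdivlMr ?sqrtr_gt0//; apply: le_trans h; rewrite sqrtE mulrA ler_wpM2r ?sqrtr_ge0//.
by rewrite mulrBl mul1r lerD2l lerN2.
Unshelve. all: by end_near. Qed.
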